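(* Let $\mathbf{a}$ be a Turing degree. There is an algorithm of Turing degree $\mathbf{a}$ that, given - a finitely generated group $G$, given by a finite generating set $S$, - an algorithm of Turing degree $\mathbf{a}$ solving the word problem of $G$, - a matrix $A\in M_{n\times n}(\mathbb{Z}[S^*])$ (with $n\in\mathbb{N}$) whose image in $M_{n\times n}(\mathbb{Z}G)$ is self-adjoint and of determinant class, and - a rational number $q$ testifying that $A$ is of determinant class, i.e., with $\int_{0^+}^1\log(x)\,d\mu_A(x)\ge -q$, computes a sequence $\mathbb{N}\to\mathbb{Q}$ that effectively converges to $\dim_{\mathcal{R}G}\ker(R_A^{(2)})$. In particular, $\dim_{\mathcal{R}G}\ker(R_A^{(2)})$ is $\mathbf{a}$-computable.
   Context: Turing degrees and algorithms: for $f,g:\mathbb{N}\to\mathbb{N}$, $f\le_T g$ means that $f$ is computable by a Turing machine with oracle $g$; the Turing degree of $f$ is its class under mutual reducibility. An algorithm of Turing degree $\mathbf{a}$ is a Turing machine with access to an oracle of degree $\mathbf{a}$. Functions to $\mathbb{Q}$, words, matrices, etc. are handled through standard encodings. For a finite generating set $S$ of $G$, $S^*$ is the set of words in the elements of $S$ and their formal inverses, and $\mathbb{Z}[S^*]$ is the set of finite $\mathbb{Z}$-linear combinations of such words; elements of $M_{n\times n}(\mathbb{Z}[S^*])$ represent matrices over the group ring $\mathbb{Z}G$ (their images). Solving the word problem of $G$ (with respect to $S$) means deciding the set $\{w\in S^*\mid w=e\text{ in }G\}$. A sequence $(q_k)_{k\in\mathbb{N}}$ in $\mathbb{Q}$ effectively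 converges to $r\in\mathbb{R}$ if $|r-q_k|\le 2^{-k}$ for all $k\in\mathbb{N}$. A real $r$ is $\mathbf{a}$-computable if there is a sequence $\mathbb{N}\to\mathbb{Q}$ of Turing degree at most $\mathbf{a}$ effectively converging to $r$. $\ell^2G$ is the Hilbert space of square-summable functions $G\to\mathbb{C}$. $R_A^{(2)}:(\ell^2G)^n\to(\ell^2G)^n$ is right multiplication by (the image of) $A$, and $\|R_A^{(2)}\|$ is its operator norm. The von Neumann dimension of a closed $G$-invariant subspace $V\subset(\ell^2G)^n$ with orthogonal projection $P_V$ is $\dim_{\mathcal{R}G}V=\sum_{i=1}^n\langle P_V(e_i),e_i\rangle$, where $e_i$ has $\delta_e$ in position $i$ and $0$ elsewhere. The involution on matrices over $\mathbb{Z}G$ is the transpose combined with the entrywise involution $\sum a_g g\mapsto\sum a_g g^{-1}$; $A$ is self-adjoint if $A^*=A$. The trace is $\operatorname{tr}_{\mathbb{C}G}(A)=\sum_{i}(A_{ii})_e$, where $(\cdot)_e$ is the coefficient of the neutral element. The spectral measure $\mu_A$ of a self-adjoint $A$ is the unique Borel measure on $[0,\|R_A^{(2)}\|]$ with $\operatorname{tr}_{\mathbb{C}G}(p(A))=\int_0^{\|R_A^{(2)}\|} p(x)\,d\mu_A(x)$ for all $p\in\mathbb{R}[x]$. A self-adjoint $A$ is of determinant class if $\ln\det(A)>-\infty$, where $\ln\det(A):=\int_{0^+}^\infty\log(x)\,d\mu_A(x)$ if this integral converges and $\ln\det(A):=-\infty$ otherwise. Here $\int_{0^+}$ indicates that $0$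 is excluded from the domain of integration. *)

(* Defs.v *)
From HB Require Import structures.
From mathcomp Require Import all_boot all_order all_algebra finmap.
From mathcomp Require Import all_classical all_reals all_analysis.
From mathcomp Require Import complex.

Set Implicit Arguments.
Unset Strict Implicit.
Unset Printing Implicit Defensive.

Import Order.TTheory GRing.Theory Num.Theory.

(** Deterministic machines with finitely many tapes, each infinite to the right.
  States and tape symbols are natural numbers; as the transition table is
  finite, only finitely many of them are relevant. Symbol 0 is the blank. A
  number [x] is written as [x] ones from the leftmost cell on. Tape 0 carries
  the input and the output, tape 1 is the oracle tape. *)

Inductive move := MLeft | MStay | MRight.

(** [Act q r q' w]: in state [q], when the tapes show the symbols [r], write and
  move on every tape as told by [w] and go to state [q'].
  [Ask q q']: in state [q], replace the number [x] on the oracle tape by the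
  value of the oracle at [x] and go to state [q']. *)
Inductive instr (t : nat) :=
| Act of nat & t.-tuple nat & nat & t.-tuple (nat * move)
| Ask of nat & nat.

Record oracle_machine := OracleMachine {
  extra_tapes : nat;
  table : seq (instr extra_tapes.+2) }.

Section Run.

(** cells, from the left (blank beyond the end of the list), and head position *)
Definition tape : Type := seq nat * nat.

Definition scan (T : tape) : nat := nth 0 T.1 T.2.

Definition num_tape (x : nat) : tape := (nseq x 1, 0).

Definition tape_num (T : tape) : nat := find (fun s => s != 1) T.1.

(** a head on the leftmost cell that is told to move left stays there *)
Definition write_move (T : tape) (p : nat * move) : tape :=
  (set_nth 0 T.1 T.2 p.1,
   match p.2 with MLeft => T.2.-1 | MStay => T.2 | MRight => T.2.+1 end).

Definition config (t : nat) : Type := nat * t.+2.-tuple tape.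

Variable g : nat -> nat.

Definition exec t (i : instr t.+2) (c : config t) : option (config t) :=
  match i with
  | Act q r q' w =>
      if (c.1 == q) && ([tuple scan (tnth c.2 j) | j < t.+2] == r)
      then Some (q', [tuple write_move (tnth c.2 j) (tnth w j) | j < t.+2])
      else None
  | Ask q q' =>
      if c.1 == q then
        Some (q', [tuple if val j == 1
                         then num_tape (g (tape_num (tnth c.2 j)))
                         else tnth c.2 j | j < t.+2])
      else None
  end.

(** The first applicable instruction is executed; the machine halts when there
  is none. *)
Fixpoint step t (l : seq (instr t.+2)) (c : config t) : option (config t) :=
  if l is i :: l' then
    if exec i c is Some c' then Some c' else step l' c
  else None.

Variable M : oracle_machine.

Definition init_config (x : nat) : config (extra_tapes M) :=
  (0, [tuple if val j == 0 then num_tape x else num_tape 0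
      | j < (extra_tapes M).+2]).

Definition output (c : config (extra_tapes M)) : nat :=
  tape_num (tnth c.2 ord0).

Definition computes (x y : nat) : Prop :=
  exists (s : nat) (c : config (extra_tapes M)),
    [/\ iter s (obind (step (table M))) (Some (init_config x)) = Some c,
        step (table M) c = None
      & output c = y].

End Run.

Definition turing_le (f g : nat -> nat) : Prop :=
  exists M, forall x, computes g M x (f x).

Definition turing_equiv (f g : nat -> nat) : Prop :=
  turing_le f g /\ turing_le g f.

Definition is_turing_degree (a : set (nat -> nat)) : Prop :=
  exists f, a = [set g | turing_equiv f g]%classic.

Definition degree_at_most (f : nat -> nat) (a : set (nat -> nat)) : Prop :=
  exists2 g, a g & turing_le f g.

(** the Cantor pairing; all encodings below are injective *)
Definition pair_code (x y : nat) : nat := ((x + y) * (x + y).+1)./2 + y.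

Definition seq_code (s : seq nat) : nat :=
  foldr (fun x c => (pair_code x c).+1) 0 s.

Definition int_code (z : int) : nat :=
  match z with Posz n => n.*2 | Negz n => n.*2.+1 end.

Definition rat_code (q : rat) : nat :=
  pair_code (int_code (numq q)) (absz (denq q)).

Definition move_code (d : move) : nat :=
  match d with MLeft => 0 | MStay => 1 | MRight => 2 end.

Definition instr_code t (i : instr t) : nat :=
  match i with
  | Act q r q' w =>
      seq_code [:: 0; q; seq_code r; q';
                   seq_code [seq pair_code p.1 (move_code p.2) | p <- w]]
  | Ask q q' => seq_code [:: 1; q; q']
  end.

Definition machine_code (M : oracle_machine) : nat :=
  pair_code (extra_tapes M) (seq_code [seq instr_code i | i <- table M]).

(** A generating set with [m] elements is listed as [S : m.-tuple G]; the letter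
  [(i, b)] stands for the [i]-th generator, formally inverted when [b]. *)

Definition word (m : nat) : Type := seq ('I_m * bool).

(** The element of [Z[S*]] denoted by a list is the sum of its terms. *)
Definition word_comb (m : nat) : Type := seq (int * word m).

Definition word_code m (w : word m) : nat :=
  seq_code [seq (nat_of_ord l.1).*2 + nat_of_bool l.2 | l <- w].

Definition word_comb_code m (c : word_comb m) : nat :=
  seq_code [seq pair_code (int_code t.1) (word_code t.2) | t <- c].

Definition word_mx_code m n (A : 'M[word_comb m]_n) : nat :=
  seq_code [seq seq_code [seq word_comb_code (A i j) | j <- enum 'I_n]
           | i <- enum 'I_n].

(** the input of the algorithm; of the generating set, only its size matters *)
Definition input_code m (W : oracle_machine) n (A : 'M[word_comb m]_n) (q : rat)
    (k : nat) : nat :=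
  seq_code [:: m; machine_code W; n; word_mx_code A; rat_code q; k].

Definition word_eval (G : groupType) m (S : m.-tuple G) (w : word m) : G :=
  (\big[*%g/1]_(l <- w) (if l.2 then (tnth S l.1)^-1 else tnth S l.1))%g.

Definition generating (G : groupType) m (S : m.-tuple G) : Prop :=
  forall x : G, exists w, word_eval S w = x.

Definition solves_word_problem (g : nat -> nat) (M : oracle_machine)
    (G : groupType) m (S : m.-tuple G) : Prop :=
  forall w : word m,
    computes g M (word_code w) (word_eval S w == 1%g : bool).

(** The group ring of [G] over [K], as finitely supported functions with the
  convolution product. *)

Local Open Scope ring_scope.

Definition group_ring (K : nzRingType) (G : groupType) : Type :=
  {fsfun G -> K with 0}.

Section GroupRing.

Local Open Scope fset_scope.
Local Open Scope ring_scope.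

Variables (K : nzRingType) (G : groupType).
Local Notation KG := (group_ring K G).
Implicit Types (a b c : KG) (g h : G).

HB.instance Definition _ := Choice.on KG.

Definition gr_coef a g : K := (a : {fsfun G -> K with 0}) g.
Definition gr_supp a : {fset G} := finsupp (a : {fsfun G -> K with 0}).

Definition gr_single (x : K) h : KG := [fsfun g in [fset h] => x | 0].
Definition gr_const (x : K) : KG := gr_single x 1%g.
Definition gr_zero : KG := [fsfun].
Definition gr_opp a : KG := [fsfun g in gr_supp a => - gr_coef a g | 0].
Definition gr_add a b : KG :=
  [fsfun g in gr_supp a `|` gr_supp b => gr_coef a g + gr_coef b g | 0].
Definition gr_mul a b : KG :=
  [fsfun g in [fset (h * k)%g | h in gr_supp a, k in gr_supp b] =>
     \sum_(h <- gr_supp a) gr_coef a h * gr_coef b (h^-1 * g)%g | 0].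
Definition gr_star a : KG :=
  [fsfun g in [fset (h^-1)%g | h in gr_supp a] => gr_coef a (g^-1)%g | 0].

Lemma gr_ext a b : gr_coef a =1 gr_coef b -> a = b.
Proof. by move=> ab; apply/fsfunP. Qed.

Lemma gr_coef_out a g : g \notin gr_supp a -> gr_coef a g = 0.
Proof. exact: fsfun_dflt. Qed.

Lemma gr_singleE x h g : gr_coef (gr_single x h) g = if g == h then x else 0.
Proof. by rewrite /gr_coef fsfunE inE. Qed.

Lemma gr_zeroE g : gr_coef gr_zero g = 0.
Proof. by rewrite /gr_coef fsfunE. Qed.

Lemma gr_oppE a g : gr_coef (gr_opp a) g = - gr_coef a g.
Proof.
rewrite {1}/gr_coef fsfunE; case: ifPn => // /gr_coef_out ->.
by rewrite oppr0.
Qed.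

Lemma gr_addE a b g : gr_coef (gr_add a b) g = gr_coef a g + gr_coef b g.
Proof.
rewrite {1}/gr_coef fsfunE; case: ifPn => //; rewrite inE negb_or.
by case/andP => /gr_coef_out -> /gr_coef_out ->; rewrite addr0.
Qed.

Lemma gr_mulE a b g : gr_coef (gr_mul a b) g =
  \sum_(h <- gr_supp a) gr_coef a h * gr_coef b (h^-1 * g)%g.
Proof.
rewrite {1}/gr_coef fsfunE; case: ifPn => // gN.
rewrite big_seq big1 // => h ha; rewrite [gr_coef b _]gr_coef_out ?mulr0 //.
apply: contra gN => hb; apply/imfset2P; exists h => //.
by exists (h^-1 * g)%g; rewrite // mulVKg.
Qed.

Lemma gr_starE a g : gr_coef (gr_star a) g = gr_coef a (g^-1)%g.
Proof.
rewrite {1}/gr_coef fsfunE; case: ifPn => // gN.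
rewrite gr_coef_out //; apply: contra gN => ga.
by apply/imfsetP; exists (g^-1)%g; rewrite // invgK.
Qed.

Lemma gr_sum_supp a (X : {fset G}) (F : G -> K) : gr_supp a `<=` X ->
  \sum_(h <- gr_supp a) gr_coef a h * F h = \sum_(h <- X) gr_coef a h * F h.
Proof.
by move=> aX; apply: big_fset_incl => // h _ /gr_coef_out ->; rewrite mul0r.
Qed.

Fact gr_addA : associative gr_add.
Proof. by move=> a b c; apply: gr_ext => g; rewrite !gr_addE addrA. Qed.

Fact gr_addC : commutative gr_add.
Proof. by move=> a b; apply: gr_ext => g; rewrite !gr_addE addrC. Qed.

Fact gr_add0 : left_id gr_zero gr_add.
Proof. by move=> a; apply: gr_ext => g; rewrite gr_addE gr_zeroE add0r. Qed.

Fact gr_addN : left_inverse gr_zero gr_opp gr_add.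
Proof.
by move=> a; apply: gr_ext => g; rewrite gr_addE gr_oppE gr_zeroE addNr.
Qed.

HB.instance Definition _ :=
  GRing.isZmodule.Build KG gr_addA gr_addC gr_add0 gr_addN.

Lemma gr_sum_pick (X : {fset G}) y (F : G -> K) : y \in X ->
  \sum_(x <- X) (if x == y then F x else 0) = F y.
Proof.
move=> yX; rewrite (bigD1_seq y) ?fset_uniq //= eqxx big1 ?addr0 // => x.
by move/negPf ->.
Qed.

Lemma gr_coef_sum a g :
  gr_coef a g = \sum_(k <- gr_supp a) (if k == g then gr_coef a k else 0).
Proof.
have [ga|/gr_coef_out ag0] := boolP (g \in gr_supp a).
  by rewrite gr_sum_pick.
by rewrite ag0 big1 // => k _; case: eqP => // ->.
Qed.

Fact gr_mulA : associative gr_mul.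
Proof.
move=> a b c; apply: gr_ext => g; rewrite [RHS]gr_mulE.
pose X : {fset G} := [fset (h * k)%g | h in gr_supp a, k in gr_supp b].
have sX : gr_supp (gr_mul a b) `<=` X.
  apply/fsubsetP => x; apply: contraLR => xN.
  by rewrite memNfinsupp fsfunE (negPf xN).
rewrite (gr_sum_supp (fun h => gr_coef c (h^-1 * g)%g) sX) gr_mulE.
under [RHS]eq_bigr do rewrite gr_mulE mulr_suml.
rewrite exchange_big /= big_seq [RHS]big_seq; apply: eq_bigr => h ha.
under [RHS]eq_bigr do rewrite -mulrA.
rewrite -mulr_sumr gr_mulE; congr (_ * _).
transitivity (\sum_(x <- X) \sum_(k <- gr_supp b)
    (if x == (h * k)%g then gr_coef b k * gr_coef c (x^-1 * g)%g else 0)).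
  rewrite exchange_big /= big_seq [RHS]big_seq; apply: eq_bigr => k kb.
  rewrite (@gr_sum_pick _ (h * k)%g
            (fun x => gr_coef b k * gr_coef c (x^-1 * g)%g)).
    by rewrite invgM mulgA.
  by apply/imfset2P; exists h => //; exists k.
apply: eq_bigr => x _; rewrite (gr_coef_sum b) mulr_suml.
apply: eq_bigr => k _.
have -> : (k == h^-1 * x)%g = (x == h * k)%g.
  by rewrite eq_sym; exact: (can2_eq (mulVKg h) (mulKg h)).
by case: ifP => //; rewrite mul0r.
Qed.

Fact gr_mul1l : left_id (gr_const 1) gr_mul.
Proof.
move=> a; apply: gr_ext => g; rewrite gr_mulE.
rewrite (@gr_sum_supp _ [fset 1%g] (fun h => gr_coef a (h^-1 * g)%g)).
  by rewrite big_seq_fset1 gr_singleE eqxx mul1r invg1 mul1g.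
apply/fsubsetP => x; apply: contraLR => xN.
by rewrite memNfinsupp fsfunE (negPf xN).
Qed.

Fact gr_mul1r : right_id (gr_const 1) gr_mul.
Proof.
move=> a; apply: gr_ext => g; rewrite gr_mulE [RHS]gr_coef_sum.
apply: eq_bigr => h _; rewrite gr_singleE mulg_eq1 eqg_inv.
by case: ifP; rewrite ?mulr1 ?mulr0.
Qed.

Fact gr_mulDl : left_distributive gr_mul gr_add.
Proof.
move=> a b c; apply: gr_ext => g; rewrite gr_addE !gr_mulE.
pose X := gr_supp a `|` gr_supp b.
pose F h := gr_coef c (h^-1 * g)%g.
rewrite (@gr_sum_supp a X F) ?fsubsetUl // (@gr_sum_supp b X F) ?fsubsetUr //.
rewrite (@gr_sum_supp _ X F) -?big_split /=.
  by apply: eq_bigr => h _; rewrite gr_addE mulrDl.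
apply/fsubsetP => x; apply: contraLR => xN.
by rewrite memNfinsupp fsfunE (negPf xN).
Qed.

Fact gr_mulDr : right_distributive gr_mul gr_add.
Proof.
move=> a b c; apply: gr_ext => g; rewrite gr_addE !gr_mulE -big_split /=.
by apply: eq_bigr => h _; rewrite gr_addE mulrDr.
Qed.

Fact gr_1neq0 : gr_const 1 != 0 :> KG.
Proof.
apply/eqP => /(congr1 (gr_coef ^~ 1%g)); rewrite gr_singleE eqxx gr_zeroE.
by move/eqP; rewrite oner_eq0.
Qed.

HB.instance Definition _ := GRing.Zmodule_isNzRing.Build KG
  gr_mulA gr_mul1l gr_mul1r gr_mulDl gr_mulDr gr_1neq0.

End GroupRing.

Definition gr_map (K L : nzRingType) (G : groupType) (f : K -> L)
    (a : group_ring K G) : group_ring L G :=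
  [fsfun g in gr_supp a => f (gr_coef a g) | 0].

Definition word_mx_image (G : groupType) m (S : m.-tuple G) n
    (A : 'M[word_comb m]_n) : 'M[group_ring int G]_n :=
  \matrix_(i, j) \sum_(t <- A i j) gr_single t.1 (word_eval S t.2).

Definition mx_star (G : groupType) n (A : 'M[group_ring int G]_n) :
    'M[group_ring int G]_n := map_mx (@gr_star int G) A^T.

Definition self_adjoint (G : groupType) n (A : 'M[group_ring int G]_n) : Prop :=
  mx_star A = A.

Definition gr_trace (K : nzRingType) (G : groupType) n
    (A : 'M[group_ring K G]_n) : K := \sum_i gr_coef (A i i) 1%g.

Definition mx_poly_eval (K : nzRingType) (G : groupType) n (p : {poly K})
    (A : 'M[group_ring K G]_n) : 'M[group_ring K G]_n :=
  \sum_(k < size p) gr_const G p`_k *: A ^+ k.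

Section Hilbert.

Local Open Scope classical_set_scope.
Local Open Scope complex_scope.

Variables (R : realType) (G : groupType) (n : nat).

(** unconditional sums, for absolutely summable families *)
Definition real_sum (f : G -> R) : R :=
  fine (\esum_(g in [set: G]) (Num.max (f g) 0)%:E)
  - fine (\esum_(g in [set: G]) (Num.max (- f g) 0)%:E).

Definition complex_sum (f : G -> R[i]) : R[i] :=
  real_sum (fun g => complex.Re (f g)) +i* real_sum (fun g => complex.Im (f g)).

Definition l2 : set (G -> R[i]) :=
  [set u | (\esum_(g in [set: G])
     (complex.Re (u g) ^+ 2 + complex.Im (u g) ^+ 2)%:E < +oo)%E].

Definition l2n : set ('I_n -> G -> R[i]) := [set u | forall i, l2 (u i)].

Definition inner (u v : 'I_n -> G -> R[i]) : R[i] :=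
  \sum_(i < n) complex_sum (fun g => u i g * (v i g)^*).

Definition l2_norm (u : 'I_n -> G -> R[i]) : R :=
  Num.sqrt (complex.Re (inner u u)).

(** row vector times matrix, where [(u h) g = u (g h^-1)] for [h] in [G] *)
Definition right_mul (A : 'M[group_ring int G]_n) (u : 'I_n -> G -> R[i]) :
    'I_n -> G -> R[i] := fun j g =>
  \sum_(i < n) \sum_(h <- gr_supp (A i j))
    u i (g * h^-1)%g * (gr_coef (A i j) h)%:~R.

Definition right_mul_norm (A : 'M[group_ring int G]_n) : R :=
  sup [set l2_norm (right_mul A u) | u in l2n `&` [set u | l2_norm u <= 1]].

Definition right_mul_ker (A : 'M[group_ring int G]_n) :
    set ('I_n -> G -> R[i]) :=
  [set u | l2n u /\ forall j g, right_mul A u j g = 0].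

Definition orth_proj (V : set ('I_n -> G -> R[i])) (u : 'I_n -> G -> R[i]) :
    'I_n -> G -> R[i] :=
  xget (fun _ _ => 0)
    [set p | V p /\
       forall v, V v -> inner (fun i g => u i g - p i g) v = 0].

Definition delta_vec (i : 'I_n) : 'I_n -> G -> R[i] :=
  fun j g => ((j == i) && (g == 1%g))%:R.

(** The sum is real, as [<P e, e> = <P e, P e>]. *)
Definition vn_dim (V : set ('I_n -> G -> R[i])) : R :=
  complex.Re (\sum_(i < n) inner (orth_proj V (delta_vec i)) (delta_vec i)).

End Hilbert.

Arguments right_mul_norm R {G n} A.
Arguments right_mul_ker R {G n} A.

Section Spectral.

Local Open Scope classical_set_scope.

Variables (R : realType) (G : groupType) (n : nat).

(** A Borel measure on [0, N] is taken as a Borel measure on the line that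
  vanishes outside of [0, N]. *)
Definition is_spectral_measure (A : 'M[group_ring int G]_n)
    (mu : {measure set (measurableTypeR R) -> \bar R}) : Prop :=
  let D : set R := `[0, right_mul_norm R A] in
  mu (~` D) = 0%E /\
  forall p : {poly R},
    (\int[mu]_(x in D) (p.[x])%:E =
      (gr_trace (mx_poly_eval p (map_mx (gr_map intr) A)))%:E)%E.

Definition ln_det (mu : {measure set (measurableTypeR R) -> \bar R}) : \bar R :=
  let D : set R := `]0, +oo[ in
  if `[< mu.-integrable D (fun x => (ln x)%:E) >]
  then (\int[mu]_(x in D) (ln x)%:E)%E else -oo%E.

Definition determinant_class (A : 'M[group_ring int G]_n) : Prop :=
  exists mu, is_spectral_measure A mu /\ (-oo < ln_det mu)%E.

End Spectral.

Arguments determinant_class R {G n} A.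

Definition effectively_converges (R : realType) (s : nat -> rat) (r : R) : Prop :=
  forall k, `|r - ratr (s k)| <= 2 ^- k.

Definition computable_in_degree (R : realType) (a : set (nat -> nat)) (r : R) :
    Prop :=
  exists s : nat -> rat,
    degree_at_most (fun k => rat_code (s k)) a /\ effectively_converges s r.

(* Main.v *)
Require Import Defs.
From HB Require Import structures.
From mathcomp Require Import all_boot all_order all_algebra finmap.
From mathcomp Require Import all_classical all_reals all_analysis.
From mathcomp Require Import complex.
From mathcomp Require Import zify ring lra measurable_realfun.

Set Implicit Arguments.
Unset Strict Implicit.
Unset Printing Implicit Defensive.

Import Order.TTheory GRing.Theory Num.Theory.
Import numFieldNormedType.Exports.

(** Let [A] be the image of the given matrix, let [K] exceed the spectrum of
  [A], let [T := 1 - A / K], and let [a d] be the integral of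
  [(1 - x / K) ^ d] against the spectral measure. Integrals of polynomials are
  traces, so [a d = tr ((K - A) ^ d) / K ^ d]. The numerator is an integer that
  can be computed from the word problem: multiply out [(K - A) ^ d] over words
  and add the coefficients of the words on the diagonal that represent the
  neutral element ([power_traceP], [total_trace]).

  The sequence [a] decreases to the dimension of the kernel. The proof
  constructs the projection instead of calling on the spectral theorem: by
  self-adjointness, the squared distances of [T ^ d e_i] and [T ^ d' e_i], summed
  over [i], give [a (2 d) - 2 a (d + d') + a (2 d')], which is at most
  [a (2 d) - a (2 d')] for [d <= d']. Hence [T ^ d e_i] is a Cauchy sequence. Its
  limit is in the kernel, as [A T ^ d = K (T ^ d - T ^ d.+1)], and [e_i] differs
  from it by a vector orthogonal to the kernel, as [T] is self-adjoint and fixes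
  the kernel. The dimension is the sum of the diagonal entries of the limits,
  which is the limit of [a] ([vn_dim_kernel]).

  The bound on the logarithm makes the convergence effective. The integrand of
  [a d] is 1 at 0, at most 1 on ]0, e], and at most [(1 - e / K) ^ d] above [e],
  while ]0, e] has mass at most [q / ln (1 / e)] ([measure_near0],
  [scaled_trace_tail]). So an explicit [d] suffices for an error of [2 ^ - k]
  ([kernel_dim_approx]), and one dyadic number near [a d] is the output.

  For the machine, programs with registers are compiled to machines
  ([compileP]), and the functions in the inductive class [rec], recursive
  relative to an oracle, are shown to have programs ([realizes_rec]). Functions
  between encoded types that act on codes as a function of [rec] are
  [effective]; this notion is closed under the usual operations on lists, and
  covers the simulation of a machine given by its code ([raw_runP]) as well as
  everything else in the algorithm, up to one unbounded search for a time at
  which the machine for the word problem has answered all queries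
  ([search_machine], [uniform_machine]). Any function computed by a machine is
  in [rec] ([computes_rec]), so oracles of the same degree can be exchanged
  ([rec_oracle_trans]); this also turns the output for a fixed input into a
  sequence of the given degree. *)

(** * Register programs and their machines *)

(** Register [j] of a program is tape [j] of the compiled machine; [Query] acts
  on register 1 since tape 1 is the oracle tape. *)
Inductive cmd :=
| Inc of nat
| Dec of nat
| Query
| Then of cmd & cmd
| While of nat & cmd.

Definition store := nat -> nat.

Definition upd (s : store) (j x : nat) : store :=
  fun k => if k == j then x else s k.

Inductive run (g : nat -> nat) : cmd -> store -> store -> Prop :=
| run_inc j s : run g (Inc j) s (upd s j (s j).+1)
| run_dec j s : run g (Dec j) s (upd s j (s j).-1)
| run_query s : run g Query s (upd s 1 (g (s 1)))
| run_then c1 c2 s s1 s2 :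
    run g c1 s s1 -> run g c2 s1 s2 -> run g (Then c1 c2) s s2
| run_while0 j c s : s j = 0 -> run g (While j c) s s
| run_whileS j c s s1 s2 : s j != 0 ->
    run g c s s1 -> run g (While j c) s1 s2 -> run g (While j c) s s2.

Fixpoint width (c : cmd) : nat :=
  match c with
  | Inc j | Dec j => j.+1
  | Query => 2
  | Then c1 c2 => maxn (width c1) (width c2)
  | While j c => maxn j.+1 (width c)
  end.

Section Compile.

Variable t : nat.
Local Notation instr := (instr t.+2).

Definition one_tape (j b q q' : nat) (p : nat * move) : instr :=
  Act q [tuple if val k == j then b else 0 | k < t.+2] q'
      [tuple if val k == j then p else (0, MStay) | k < t.+2].

Fixpoint states (c : cmd) : nat :=
  match c with
  | Inc _ => 1
  | Dec _ | Query => 2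
  | Then c1 c2 => states c1 + states c2
  | While _ c => (states c).+3
  end.

(** A head on the first blank cannot see whether its register is empty. It has
  to move left and, if it finds a mark there, to move back. *)
Definition while_control (j q n : nat) : seq instr :=
  [:: one_tape j 0 q q.+1 (0, MLeft);
      one_tape j 1 q.+1 q.+2 (1, MRight);
      one_tape j 0 q.+1 (q + n.+3) (0, MStay);
      one_tape j 0 (q + n.+2) q (0, MStay)].

Fixpoint compile (c : cmd) (q : nat) : seq instr :=
  match c with
  | Inc j => [:: one_tape j 0 q q.+1 (1, MRight)]
  | Dec j => [:: one_tape j 0 q q.+1 (0, MLeft);
                 one_tape j 1 q.+1 q.+2 (0, MStay);
                 one_tape j 0 q.+1 q.+2 (0, MStay)]
  | Query => [:: Ask _ q q.+1;
                 one_tape 1 1 q.+1 q.+1 (1, MRight);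
                 one_tape 1 0 q.+1 q.+2 (0, MStay)]
  | Then c1 c2 => compile c1 q ++ compile c2 (q + states c1)
  | While j c => while_control j q (states c) ++ compile c q.+2
  end.

Variable g : nat -> nat.

Definition source (i : instr) : nat :=
  match i with Act q _ _ _ | Ask q _ => q end.

Lemma step_source (l : seq instr) (c : config t) :
  step g l c <> None -> c.1 \in map source l.
Proof.
elim: l => //= i l IH; rewrite inE.
case E: (exec g i c) => [c'|] // h; last by rewrite IH ?orbT.
case: i E => [q r q' w|q q'] /=; case: eqP => //= -> _; by rewrite eqxx.
Qed.

Lemma source_compile c q x :
  x \in map source (compile c q) -> q <= x < q + states c.
Proof.
elim: c q => [j|j||c1 IH1 c2 IH2|j c IH] q /=; rewrite ?inE.
- by move/eqP->; lia.
- by lia.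
- by lia.
- by rewrite map_cat mem_cat => /orP[/IH1|/IH2]; lia.
- case/or4P => [||| /orP[|/IH]]; by lia.
Qed.

(** The first applicable instruction is executed, so that a fragment of a table
  acts as it does alone only if no earlier instruction shares its states. *)
Definition embeds (l L : seq instr) : Prop :=
  forall c, step g l c <> None -> step g L c = step g l c.

Lemma step_cat (l1 l2 : seq instr) c : step g (l1 ++ l2) c =
  if step g l1 c is Some c' then Some c' else step g l2 c.
Proof. by elim: l1 => //= i l ->; case: (exec g i c). Qed.

Lemma embeds_catl l1 l2 L : embeds (l1 ++ l2) L -> embeds l1 L.
Proof.
move=> h c hc; rewrite h step_cat; last by case: (step g l1 c) hc.
by case: (step g l1 c) hc.
Qed.

Lemma embeds_catr l1 l2 L :
  (forall x, x \in map source l1 -> x \notin map source l2) ->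
  embeds (l1 ++ l2) L -> embeds l2 L.
Proof.
move=> d h c hc.
have h1 : step g l1 c = None.
  case E: (step g l1 c) => [c'|] //.
  have /d : c.1 \in map source l1 by apply: step_source; rewrite E.
  by rewrite (step_source hc).
by rewrite h step_cat h1.
Qed.

Definition reach (L : seq instr) (c c' : config t) : Prop :=
  exists n, iter n (obind (step g L)) (Some c) = Some c'.

Lemma reach_refl L c : reach L c c.
Proof. by exists 0. Qed.

Lemma reach_trans L c1 c2 c3 : reach L c1 c2 -> reach L c2 c3 -> reach L c1 c3.
Proof. by move=> [n hn] [m hm]; exists (m + n); rewrite iterD hn. Qed.

Lemma reach1 L c c' c'' : step g L c = Some c' -> reach L c' c'' -> reach L c c''.
Proof. by move=> h; apply: reach_trans; exists 1. Qed.

(** Between two commands, a register of value [x] is a tape with [x] ones, and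
  its head is on the first blank; hence all heads scan the blank. The cells may
  include blanks that were written explicitly. *)
Definition tape_rep (x h : nat) (T : tape) : Prop :=
  T.2 = h /\ forall i, nth 0 T.1 i = (i < x) :> nat.

Lemma tape_rep_num x h T : tape_rep x h T -> tape_num T = x.
Proof.
case=> _ hT; rewrite /tape_num.
have hx : x <= size T.1.
  case: x hT => // x hT; rewrite ltnNge; apply/negP => hs.
  by have := hT x; rewrite nth_default // ltnSn.
apply/eqP; rewrite eqn_leq; apply/andP; split.
  rewrite leqNgt; apply/negP => /(before_find 0).
  by rewrite hT ltnn.
rewrite leqNgt; apply/negP => hf.
have hh : has (fun s => s != 1) T.1.
  by rewrite has_find (leq_trans hf).
by have := nth_find 0 hh; rewrite hT hf.
Qed.

Definition rep (s : store) (T : t.+2.-tuple tape) : Prop :=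
  forall k : 'I_t.+2, tape_rep (s k) (s k) (tnth T k).

(** While an instruction is carried out, at most one tape [j] deviates from
  [rep]: it holds [x] marks and its head is at [h]. *)
Definition rep_but (j x h : nat) (s : store) (T : t.+2.-tuple tape) : Prop :=
  forall k : 'I_t.+2, if val k == j then tape_rep x h (tnth T k)
                      else tape_rep (s k) (s k) (tnth T k).

Lemma rep_to_but j s T : rep s T -> rep_but j (s j) (s j) s T.
Proof. by move=> h k; case: eqP => [<-|_]; apply: h. Qed.

Lemma rep_of_but j x s T : rep_but j x x s T -> rep (upd s j x) T.
Proof. by move=> h k; have := h k; rewrite /upd; case: eqP. Qed.

Lemma rep_same j s T : rep_but j (s j) (s j) s T -> rep s T.
Proof. by move=> h k; have := h k; case: eqP => // ->. Qed.

Definition rewrite_to (p : nat * move) (x h x' h' : nat) : Prop :=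
  forall T, tape_rep x h T -> tape_rep x' h' (write_move T p).

Lemma exec_one_tape j b q q' p x h x' h' s (T : t.+2.-tuple tape) :
  rep_but j x h s T -> rewrite_to p x h x' h' -> (h < x : nat) = b ->
  exists T', rep_but j x' h' s T' /\
    exec g (one_tape j b q q' p) (q, T) = Some (q', T').
Proof.
move=> hT hp hb /=; rewrite eqxx /= ifT.
  eexists; split; last by [].
  move=> k; rewrite !tnth_mktuple; have := hT k; case: eqP => [_ /hp //|_].
  case=> h1 h2; split=> //= i; rewrite nth_set_nth /= h1 h2.
  by case: eqP => [->|//]; rewrite ltnn.
apply/eqP; apply: eq_mktuple => k; have := hT k.
by rewrite /scan; case: eqP => _ [-> ->] //; rewrite ltnn.
Qed.

Lemma write1_right x : rewrite_to (1, MRight) x x x.+1 x.+1.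
Proof.
move=> T [h1 h2]; split=> /=; first by rewrite h1.
move=> i; rewrite nth_set_nth /= h1 h2; case: eqP => [->|]; lia.
Qed.

Lemma skip1_right x h : h < x -> rewrite_to (1, MRight) x h x h.+1.
Proof.
move=> hx T [h1 h2]; split=> /=; first by rewrite h1.
by move=> i; rewrite nth_set_nth /= h1 h2; case: eqP => [->|]; rewrite ?hx.
Qed.

Lemma keep0 (x h : nat) : x <= h -> rewrite_to (0, MStay) x h x h.
Proof.
move=> hx T [h1 h2]; split=> //= i; rewrite nth_set_nth /= h1 h2.
by case: eqP => [->|//]; rewrite ltnNge hx.
Qed.

Lemma left0 (x : nat) : rewrite_to (0, MLeft) x x x x.-1.
Proof.
move=> T [h1 h2]; split=> /=; first by rewrite h1.
by move=> i; rewrite nth_set_nth /= h1 h2; case: eqP => [->|//]; rewrite ltnn.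
Qed.

Lemma erase1 (x : nat) : 0 < x -> rewrite_to (0, MStay) x x.-1 x.-1 x.-1.
Proof.
move=> hx T [h1 h2]; split=> //= i; rewrite nth_set_nth /= h1 h2.
by case: eqP => [->|]; lia.
Qed.

Lemma one_tapeN j b q q' p q1 T : q1 != q ->
  exec g (one_tape j b q q' p) (q1, T) = None.
Proof. by move=> h /=; rewrite (negPf h). Qed.

Lemma one_tapeNb j b q q' p q1 x h s (T : t.+2.-tuple tape) : j < t.+2 ->
  rep_but j x h s T -> (h < x : nat) != b ->
  exec g (one_tape j b q q' p) (q1, T) = None.
Proof.
move=> jt hT hb /=; case: eqP => //= _; rewrite ifN //.
apply/eqP => /(congr1 (fun r => tnth r (Ordinal jt))).
rewrite !tnth_mktuple /= eqxx /scan; have := hT (Ordinal jt).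
by rewrite /= eqxx => -[-> ->]; apply/eqP.
Qed.

Lemma embeds_step l L c c' : embeds l L -> step g l c = Some c' ->
  step g L c = Some c'.
Proof. by move=> h E; rewrite h E. Qed.

Lemma step_cons (i : instr) l (c : config t) : step g (i :: l) c =
  if exec g i c is Some c' then Some c' else step g l c.
Proof. by []. Qed.

Lemma exec_blank j q q' p x x' h' s (T : t.+2.-tuple tape) :
  rep_but j x x s T -> rewrite_to p x x x' h' ->
  exists T', rep_but j x' h' s T' /\
    exec g (one_tape j 0 q q' p) (q, T) = Some (q', T').
Proof. by move=> hT hp; apply: exec_one_tape hT hp _; rewrite ltnn. Qed.

Lemma exec_mark j q q' p x h x' h' s (T : t.+2.-tuple tape) :
  rep_but j x h s T -> h < x -> rewrite_to p x h x' h' ->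
  exists T', rep_but j x' h' s T' /\
    exec g (one_tape j 1 q q' p) (q, T) = Some (q', T').
Proof. by move=> hT hx hp; apply: exec_one_tape hT hp _; rewrite hx. Qed.

(** An answer of the oracle is written with the head on the leftmost cell, so
  the head has to be moved to the end of it. *)
Lemma query_rewind q s x h (T : t.+2.-tuple tape) L :
  embeds (compile Query q) L -> h <= x -> rep_but 1 x h s T ->
  exists T', rep_but 1 x x s T' /\ reach L (q.+1, T) (q.+2, T').
Proof.
move=> hL; move en: (x - h) => n; elim: n h en T => [|n IH] h en T hx hT.
  have eh : h = x by lia.
  rewrite eh in hT.
  have [T' [hT' E]] := exec_blank q.+1 q.+2 hT (keep0 (leqnn x)).
  exists T'; split=> //; apply: reach1 (reach_refl _ _).
  apply: embeds_step hL _.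
  rewrite !step_cons (@one_tapeNb _ _ _ _ _ _ x x s) ?ltnn // E.
  by rewrite /= gtn_eqF.
have hx' : h < x by lia.
have [T1 [hT1 E1]] := exec_mark q.+1 q.+1 hT hx' (skip1_right hx').
have [|||T' [hT' r]] := IH h.+1 _ T1 => //; first by lia.
exists T'; split=> //; apply: reach1 r; apply: embeds_step hL _.
by rewrite !step_cons E1 /= gtn_eqF.
Qed.

Lemma compileP c q L s s' T : width c <= t.+2 -> embeds (compile c q) L ->
  run g c s s' -> rep s T ->
  exists T', rep s' T' /\ reach L (q, T) (q + states c, T').
Proof.
have nS (k : nat) : k.+1 != k by rewrite gtn_eqF.
have nSS (k : nat) : k.+2 != k by rewrite gtn_eqF.
move=> + + r; elim: r q T => {c s s'} [j s|j s|s|c1 c2 s s1 s2 _ IH1 _ IH2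
  |j c s sj0|j c s s1 s2 sj _ IH1 _ IH2] q T.
- move=> jt hL hT.
  have [T' [hT' E]] := exec_blank q q.+1 (rep_to_but j hT) (@write1_right _).
  exists T'; split; first exact: rep_of_but.
  rewrite addn1; apply: reach1 (reach_refl _ _); apply: embeds_step hL _.
  by rewrite step_cons E.
- move=> jt hL hT.
  have [T1 [hT1 E1]] := exec_blank q q.+1 (rep_to_but j hT) (@left0 _).
  have S1 : step g L (q, T) = Some (q.+1, T1).
    by apply: embeds_step hL _; rewrite step_cons E1.
  rewrite addn2; have [sj0|sj] := posnP (s j).
    rewrite sj0 in hT1 *.
    have [T' [hT' E]] := exec_blank q.+1 q.+2 hT1 (keep0 (leqnn 0)).
    exists T'; split; first exact: rep_of_but.
    apply: reach1 S1 _; apply: reach1 (reach_refl _ _); apply: embeds_step hL _.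
    by rewrite !step_cons one_tapeN // (one_tapeNb _ _ _ _ _ hT1) // E.
  have [T' [hT' E]] : exists T', rep_but j (s j).-1 (s j).-1 s T' /\
      exec g (one_tape j 1 q.+1 q.+2 (0, MStay)) (q.+1, T1) = Some (q.+2, T').
    by apply: exec_mark hT1 _ (erase1 sj); lia.
  exists T'; split; first exact: rep_of_but.
  apply: reach1 S1 _; apply: reach1 (reach_refl _ _); apply: embeds_step hL _.
  by rewrite !step_cons one_tapeN // E.
- move=> _ hL hT.
  pose T1 : t.+2.-tuple tape := [tuple if val j == 1
    then num_tape (g (tape_num (tnth T j))) else tnth T j | j < t.+2].
  have S1 : step g L (q, T) = Some (q.+1, T1).
    by apply: embeds_step hL _; rewrite step_cons /= eqxx.
  have hT1 : rep_but 1 (g (s 1)) 0 s T1.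
    move=> k; rewrite tnth_mktuple; case: eqP => [k1|_]; last exact: hT.
    split=> // i; rewrite nth_nseq (tape_rep_num (hT k)) k1.
    by case: ltnP.
  have [T' [hT' r]] := query_rewind hL (leq0n _) hT1.
  exists T'; split; first exact: rep_of_but.
  by rewrite addn2; apply: reach1 S1 r.
- rewrite /= geq_max => /andP[w1 w2] hL hT.
  have [|T1 [hT1 r1]] := IH1 q T w1 _ hT; first exact: embeds_catl hL.
  have [|T2 [hT2 r2]] := IH2 (q + states c1) T1 w2 _ hT1.
    by apply: embeds_catr hL => x /source_compile h; apply/negP => /source_compile; lia.
  by exists T2; split=> //; rewrite addnA; apply: reach_trans r1 r2.
- rewrite [width _]/= geq_max => /andP[jt _] hL hT.
  have [T1 [hT1 E1]] := exec_blank q q.+1 (rep_to_but j hT) (@left0 _).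
  rewrite sj0 in hT1.
  have [T' [hT' E]] := exec_blank q.+1 (q + (states c).+3) hT1 (keep0 (leqnn 0)).
  exists T'; split; first by apply: (rep_same (j := j)); rewrite sj0.
  apply: (@reach1 _ _ (q.+1, T1)).
    by apply: embeds_step hL _; rewrite [compile _ _]/= step_cons E1.
  apply: reach1 (reach_refl _ _); apply: embeds_step hL _.
  rewrite [compile _ _]/= !step_cons one_tapeN //.
  by rewrite (one_tapeNb _ _ _ _ _ hT1) // E.
- move=> w hL hT; move: (w); rewrite [width _]/= geq_max => /andP[jt wc].
  have sj' : (s j).-1 < s j by lia.
  have [T1 [hT1 E1]] := exec_blank q q.+1 (rep_to_but j hT) (@left0 _).
  have [T2 [hT2 E2]] := exec_mark q.+1 q.+2 hT1 sj' (skip1_right sj').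
  rewrite prednK in hT2; last by lia.
  have hL' : embeds (compile c q.+2) L.
    apply: embeds_catr hL => x /=.
    by rewrite !inE => h; apply/negP => /source_compile; lia.
  have [T3 [hT3 r3]] := IH1 q.+2 T2 wc hL' (rep_same hT2).
  have [T4 [hT4 E4]] := exec_blank (q + (states c).+2) q (rep_to_but j hT3) (keep0 (leqnn _)).
  have [T5 [hT5 r5]] := IH2 q T4 w hL (rep_same hT4).
  exists T5; split=> //.
  apply: (@reach1 _ _ (q.+1, T1)).
    by apply: embeds_step hL _; rewrite [compile _ _]/= step_cons E1.
  apply: (@reach1 _ _ (q.+2, T2)).
    apply: embeds_step hL _.
    by rewrite [compile _ _]/= !step_cons one_tapeN // E2.
  apply: reach_trans r3 _; apply: reach1 r5.
  have -> : q.+2 + states c = q + (states c).+2 by lia.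
  apply: embeds_step hL _.
  rewrite [compile _ _]/= !step_cons 3?one_tapeN ?E4 //; lia.
Qed.

End Compile.

(** A machine starts with the head on the leftmost cell of the input; state 0
  moves it to the end, which is the convention of [rep]. *)
Definition machine_of (c : cmd) : oracle_machine :=
  @OracleMachine (width c)
    [:: one_tape (width c) 0 1 0 0 (1, MRight),
        one_tape (width c) 0 0 0 1 (0, MStay) & compile (width c) c 1].

Lemma machine_ofP g c x s : run g c (fun k => if k == 0 then x else 0) s ->
  computes g (machine_of c) x (s 0).
Proof.
move=> r; pose L := table (machine_of c); pose s0 := fun k => if k == 0 then x else 0.
have hL : embeds g (compile (width c) c 1) L.
  apply: (@embeds_catr _ _ [:: one_tape (width c) 0 1 0 0 (1, MRight);
        one_tape (width c) 0 0 0 1 (0, MStay)]) => // k /=.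
  by rewrite !inE => h; apply/negP => /source_compile; lia.
have scroll h (T : (width c).+2.-tuple tape) : h <= x -> rep_but 0 x h s0 T ->
    exists T', rep s0 T' /\ reach g L (0, T) (1, T').
  move en: (x - h) => n; elim: n h en T => [|n IH] h en T hx hT.
    have eh : h = x by lia.
    rewrite eh in hT; have [T' [hT' E]] := exec_blank g 0 1 hT (keep0 (leqnn x)).
    exists T'; split; first exact: (@rep_same _ 0 s0).
    apply: reach1 (reach_refl _ _ _).
    by rewrite /L [table _]/= !step_cons (one_tapeNb _ _ _ _ _ _ hT) ?ltnn // E.
  have hx' : h < x by lia.
  have [T1 [hT1 E1]] := exec_mark g 0 0 hT hx' (skip1_right hx').
  have [|||T' [hT' rr]] := IH h.+1 _ T1 => //; first by lia.
  exists T'; split=> //; apply: reach1 rr.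
  by rewrite /L [table _]/= !step_cons E1.
have [|T1 [hT1 r1]] := scroll 0 (init_config (machine_of c) x).2 (leq0n _).
  move=> k; rewrite tnth_mktuple /s0; case: eqP => _.
    by split=> // i; rewrite nth_nseq; case: ltnP.
  by split=> // i; rewrite nth_nseq; case: ltnP.
have [|T2 [hT2 r2]] := compileP _ hL r hT1; first exact: leqW.
have [n hn] := reach_trans r1 r2; exists n, (1 + states c, T2); split=> //.
  case E: (step _ _ _) => [c'|] //.
  have /step_source : step g (table (machine_of c)) (1 + states c, T2) <> None by rewrite E.
  rewrite [table _]/= !inE => /or3P[| |/source_compile]; by rewrite /=; lia.
exact: tape_rep_num (hT2 ord0).
Qed.

(** * Recursive functions relative to an oracle *)

(** The successor in the order of the codes of pairs, along antidiagonals.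
  Counting up to a code therefore decodes it. *)
Definition next_pair (p : nat * nat) : nat * nat :=
  if p.1 is x.+1 then (x, p.2.+1) else (p.2.+1, 0).

Definition unpair (n : nat) : nat * nat := iter n next_pair (0, 0).

Lemma pair_codeE x y : pair_code x y = 'C((x + y).+1, 2) + y.
Proof. by rewrite /pair_code bin2 mulnC. Qed.

Lemma iter_next_pair y s : y <= s -> iter y next_pair (s, 0) = (s - y, y).
Proof.
elim: y => [|y IH] ys; first by rewrite subn0.
by rewrite iterS IH ?(ltnW ys) // -(subnSK ys).
Qed.

Lemma pair_codeK x y : unpair (pair_code x y) = (x, y).
Proof.
have h s : iter 'C(s.+1, 2) next_pair (0, 0) = (s, 0).
  elim: s => // s IH; rewrite binS bin1 addnC iterD IH iterS.
  by rewrite iter_next_pair // subnn.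
by rewrite pair_codeE addnC /unpair iterD h iter_next_pair ?leq_addl // addnK.
Qed.

(** Functions of one variable suffice, as pairs have codes. Iteration takes the
  place of primitive recursion, and [rec_mu] is a search that is known to
  succeed. *)
Inductive rec (g : nat -> nat) : (nat -> nat) -> Prop :=
| rec_zero : rec g (fun=> 0)
| rec_succ : rec g succn
| rec_id : rec g id
| rec_oracle : rec g g
| rec_fst : rec g (fun x => (unpair x).1)
| rec_snd : rec g (fun x => (unpair x).2)
| rec_pair f h : rec g f -> rec g h -> rec g (fun x => pair_code (f x) (h x))
| rec_comp f h : rec g f -> rec g h -> rec g (fun x => f (h x))
| rec_iter f : rec g f -> rec g (fun x => iter (unpair x).2 f (unpair x).1)
| rec_mu f h : rec g f -> (forall x, f (pair_code x (h x)) = 0) ->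
    (forall x y, y < h x -> f (pair_code x y) <> 0) -> rec g h.

Lemma rec_oracle_trans g g' f : rec g g' -> rec g' f -> rec g f.
Proof.
move=> hg; elim=> {f}.
- exact: rec_zero.
- exact: rec_succ.
- exact: rec_id.
- exact: hg.
- exact: rec_fst.
- exact: rec_snd.
- by move=> f h _ hf _ hh; apply: rec_pair.
- by move=> f h _ hf _ hh; apply: rec_comp.
- by move=> f _; apply: rec_iter.
- by move=> f h _ hf h1 h2; apply: rec_mu hf h1 h2.
Qed.

Section Programs.

Variable g : nat -> nat.

Ltac look_up := rewrite /upd; repeat (case: eqP => ?; subst; try lia); lia.
Ltac store_eq := apply: funext => ?; look_up.

Definition clear j := While j (Dec j).

Lemma run_clear j s : run g (clear j) s (upd s j 0).
Proof.
move ex : (s j) => x; elim: x s ex => [|x IH] s ex.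
  suff -> : upd s j 0 = s by exact: run_while0.
  by store_eq.
apply: run_whileS (run_dec _ _ _) _; first by rewrite ex.
have -> : upd s j 0 = upd (upd s j (s j).-1) j 0 by store_eq.
by apply: IH; rewrite /upd eqxx ex.
Qed.

Definition pour i j := While i (Then (Dec i) (Inc j)).

Lemma run_pour i j s : i <> j ->
  run g (pour i j) s (upd (upd s j (s j + s i)) i 0).
Proof.
move=> ij; move ex : (s i) => x; elim: x s ex => [|x IH] s ex.
  suff -> : upd (upd s j (s j + 0)) i 0 = s by exact: run_while0.
  by store_eq.
apply: run_whileS (run_then (run_dec _ _ _) (run_inc _ _ _)) _; first by rewrite ex.
set s1 := upd _ _ _.
have -> : upd (upd s j (s j + x.+1)) i 0 = upd (upd s1 j (s1 j + x)) i 0.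
  by rewrite /s1; store_eq.
by apply: IH; rewrite /s1; look_up.
Qed.

Definition add_to i j t := Then (clear t)
  (Then (While i (Then (Dec i) (Then (Inc j) (Inc t)))) (pour t i)).

Lemma run_add_to i j t s : i <> j -> i <> t -> j <> t ->
  run g (add_to i j t) s (upd (upd s j (s j + s i)) t 0).
Proof.
move=> ij it jt; apply: run_then (run_clear _ _) _; set s1 := upd _ _ _.
have -> : upd (upd s j (s j + s i)) t 0 = upd (upd s1 j (s1 j + s1 i)) t 0.
  by rewrite /s1; store_eq.
have : s1 t = 0 by rewrite /s1; look_up.
move: s1 => {}s st.
pose s2 := upd (upd (upd s j (s j + s i)) t (s t + s i)) i 0.
apply: (@run_then _ _ _ _ s2).
  rewrite {}/s2; move: {st}(s) => {}s.
  move ex : (s i) => x; elim: x s ex => [|x IH] s ex.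
    set s' := (X in run _ _ _ X); suff -> : s' = s by exact: run_while0.
    by rewrite /s'; store_eq.
  apply: run_whileS (run_then (run_dec _ _ _)
    (run_then (run_inc _ _ _) (run_inc _ _ _))) _; first by rewrite ex.
  set s1 := upd _ t _.
  have -> : upd (upd (upd s j (s j + x.+1)) t (s t + x.+1)) i 0 =
    upd (upd (upd s1 j (s1 j + x)) t (s1 t + x)) i 0 by rewrite /s1; store_eq.
  by apply: IH; rewrite /s1; look_up.
have -> : upd (upd s j (s j + s i)) t 0 = upd (upd s2 i (s2 i + s2 t)) t 0.
  by rewrite /s2; store_eq.
by apply: run_pour => /esym.
Qed.

Definition copy i j t := Then (clear j) (add_to i j t).

Lemma run_copy i j t s : i <> j -> i <> t -> j <> t ->
  run g (copy i j t) s (upd (upd s j (s i)) t 0).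
Proof.
move=> ij it jt; apply: run_then (run_clear _ _) _; set s1 := upd _ _ _.
have -> : upd (upd s j (s i)) t 0 = upd (upd s1 j (s1 j + s1 i)) t 0.
  by rewrite /s1; store_eq.
exact: run_add_to.
Qed.

(** The program ends because the counter [n] decreases. *)
Lemma run_loop (P : store -> Prop) n c :
  (forall s, P s -> s n <> 0 ->
     exists2 s', run g c s s' & P s' /\ s' n < s n) ->
  forall s, P s -> exists2 s', run g (While n c) s s' & P s' /\ s' n = 0.
Proof.
move=> h s; have [x] := ubnP (s n); elim: x s => // x IH s sx Ps.
have [s0|/eqP sn] := eqVneq (s n) 0.
  by exists s; [exact: run_while0|].
have [s1 r1 [P1 l1]] := h s Ps sn.
have [|s2 r2 P2] := IH s1 _ P1; first exact: leq_trans l1 _.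
by exists s2 => //; apply: run_whileS r1 r2; apply/eqP.
Qed.

(** Registers from [b] on are scratch space. So is register 1, as queries are
  made there. *)
Definition realizes (D : nat -> Prop) (f : nat -> nat) : Prop :=
  forall i j b, i < b -> j < b -> 1 < b -> i <> j -> i <> 1 -> j <> 1 ->
  exists c, forall s, D (s i) -> exists2 s', run g c s s' &
    s' j = f (s i) /\ forall k, k < b -> k <> j -> k <> 1 -> s' k = s k.

Lemma realizes_zero D : realizes D (fun=> 0).
Proof.
move=> i j b ib jb b1 ij i1 j1; exists (clear j) => s _; eexists.
  exact: run_clear.
by split=> [|k *]; look_up.
Qed.

Lemma realizes_id D : realizes D id.
Proof.
move=> i j b ib jb b1 ij i1 j1; exists (copy i j b) => s _; eexists.
  by apply: run_copy; lia.
by split=> [|k *]; look_up.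
Qed.

Lemma realizes_succ D : realizes D succn.
Proof.
move=> i j b ib jb b1 ij i1 j1; exists (Then (copy i j b) (Inc j)) => s _; eexists.
  by apply: run_then (run_inc _ _ _); apply: run_copy; lia.
by split=> [|k *]; look_up.
Qed.

Lemma realizes_oracle D : realizes D g.
Proof.
move=> i j b ib jb b1 ij i1 j1.
exists (Then (copy i 1 b) (Then Query (copy 1 j b))) => s _; eexists.
  apply: run_then; first by apply: run_copy; lia.
  by apply: run_then (run_query _ _) _; apply: run_copy; lia.
split=> [|k *]; last by look_up.
have -> : upd (upd s 1 (s i)) b 0 1 = s i by look_up.
by look_up.
Qed.

Lemma realizes_comp (D : nat -> Prop) f h : realizes (fun=> True) f ->
  realizes D h -> realizes D (fun x => f (h x)).
Proof.
move=> hf hh i j b ib jb b1 ij i1 j1.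
have [|||||| c1 h1] := hh i b b.+1; try lia.
have [|||||| c2 h2] := hf b j b.+1; try lia.
exists (Then c1 c2) => s Ds.
have [s1 r1 [e1 k1]] := h1 s Ds; have [s2 r2 [e2 k2]] := h2 s1 I.
exists s2; first exact: run_then r1 r2.
by split=> [|k *]; rewrite ?e2 ?e1 // k2 ?k1 //; lia.
Qed.

Lemma run_pair i1 i2 j b : i1 < b -> i2 < b -> j < b ->
    i1 <> i2 -> i1 <> j -> i2 <> j ->
  exists c, forall s, exists2 s', run g c s s' &
    s' j = pair_code (s i1) (s i2) /\ forall k, k < b -> k <> j -> s' k = s k.
Proof.
move=> h1 h2 h3 h12 h1j h2j.
exists (Then (copy i1 b b.+1) (Then (add_to i2 b b.+1) (Then (copy i2 j b.+1)
  (While b (Then (add_to b j b.+1) (Dec b)))))) => s.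
have [s1 r1 [e1 [e2 k1]]] : exists2 s1, run g (Then (copy i1 b b.+1)
    (Then (add_to i2 b b.+1) (copy i2 j b.+1))) s s1 & s1 b = s i1 + s i2 /\
    s1 j = s i2 /\ (forall k, k < b -> k <> j -> s1 k = s k).
  eexists.
    apply: run_then; first by apply: run_copy; lia.
    by apply: run_then; [apply: run_add_to|apply: run_copy]; lia.
  by split; [|split=> [|k *]]; look_up.
(* The loop adds the numbers up to the sum [s i1 + s i2]. *)
pose P s2 := s2 j + 'C((s2 b).+1, 2) = s i2 + 'C((s i1 + s i2).+1, 2) /\
  forall k, k < b -> k <> j -> s2 k = s k.
have [||s2 r2 [[e3 k2] z2]] := @run_loop P b (Then (add_to b j b.+1) (Dec b)) _ s1.
- move=> s2 [e3 k2] sb; eexists.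
    by apply: run_then (run_dec _ _ _); apply: run_add_to; lia.
  set s3 := upd _ _ _.
  have eb : s3 b = (s2 b).-1 by rewrite /s3; look_up.
  have ej : s3 j = s2 j + s2 b by rewrite /s3; look_up.
  split; last by rewrite eb; lia.
  split=> [|k *]; last by rewrite -k2 // /s3; look_up.
  rewrite -e3 eb ej -addnA; congr (_ + _).
  by case: (s2 b) sb => // x _; rewrite /= [in RHS]binS bin1 addnC.
- by split=> //; rewrite e1 e2.
exists s2.
  inversion r1 as [| | |? ? ? ? ? ra rb| |]; subst.
  inversion rb as [| | |? ? ? ? ? rc rd| |]; subst.
  by apply: run_then ra _; apply: run_then rc _; apply: run_then rd r2.
split=> //; move: e3; rewrite z2 [X in _ + X]bin_small // addn0 => ->.
by rewrite pair_codeE addnC.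
Qed.

Lemma realizes_pair (D : nat -> Prop) f h : realizes D f -> realizes D h ->
  realizes D (fun x => pair_code (f x) (h x)).
Proof.
move=> hf hh i j b ib jb b1 ij i1 j1.
have [|||||| c1 p1] := hf i b b.+1; try lia.
have [|||||| c2 p2] := hh i b.+1 b.+2; try lia.
have [|||||| c3 p3] := @run_pair b b.+1 j b.+2; try lia.
exists (Then c1 (Then c2 c3)) => s Ds.
have [s1 r1 [e1 k1]] := p1 s Ds.
have Ds1 : D (s1 i) by rewrite k1 //; lia.
have [s2 r2 [e2 k2]] := p2 s1 Ds1; have [s3 r3 [e3 k3]] := p3 s2.
exists s3; first by apply: run_then r1 (run_then r2 r3).
split=> [|k *]; last by rewrite k3 ?k2 ?k1; lia.
by rewrite e3 e2 k2 ?e1 ?k1; lia.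
Qed.

Lemma run_unpair i b : i < b -> exists c, forall s, exists2 s', run g c s s' &
  (s' b, s' b.+1) = unpair (s i) /\ forall k, k < b -> s' k = s k.
Proof.
move=> ib.
pose x := b; pose y := b.+1; pose n := b.+2; pose p := b.+3; pose z := b.+4; pose t := b.+4.+1.
(* The inner loops are conditionals: each clears its own counter, and the first
     one clears the counter [z] of the second. *)
pose next := Then (Dec n) (Then (copy x p t) (Then (clear z) (Then (Inc z) (Then
  (While p (Then (clear p) (Then (clear z) (Then (Dec x) (Inc y)))))
  (While z (Then (clear z) (Then (pour y x) (Inc x)))))))).
have nextP s : exists2 s', run g next s s' & (s' x, s' y) = next_pair (s x, s y)
    /\ s' n = (s n).-1 /\ forall k, k < b -> s' k = s k.
  case ex: (s x) => [|x'].
    exists (upd (upd (upd (upd (upd (upd s n (s n).-1) p 0) t 0) z 0) y 0) x (s y).+1);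
      last by rewrite /next_pair /=; split; [congr pair|split=> [|k *]]; look_up.
    apply: run_then (run_dec _ _ _) _.
    apply: run_then; first by apply: run_copy; lia.
    apply: run_then (run_clear _ _) _; apply: run_then (run_inc _ _ _) _.
    apply: run_then; first by apply: run_while0; look_up.
    apply: run_whileS; first by apply/eqP; look_up.
      apply: run_then (run_clear _ _) _.
      by apply: run_then (run_inc _ _ _); apply: run_pour; lia.
    set s1 := upd _ x _; set s2 := (X in run _ _ _ X).
    suff -> : s2 = s1 by apply: run_while0; rewrite /s1; look_up.
    by rewrite /s1 /s2; store_eq.
  exists (upd (upd (upd (upd (upd (upd s n (s n).-1) p 0) t 0) z 0) y (s y).+1) x x');
    last by rewrite /next_pair /=; split; [congr pair|split=> [|k *]]; look_up.
  apply: run_then (run_dec _ _ _) _.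
  apply: run_then; first by apply: run_copy; lia.
  apply: run_then (run_clear _ _) _; apply: run_then (run_inc _ _ _) _.
  apply: run_then.
    apply: run_whileS; first by apply/eqP; look_up.
      apply: run_then (run_clear _ _) _; apply: run_then (run_clear _ _) _.
      by apply: run_then (run_dec _ _ _) (run_inc _ _ _).
    by apply: run_while0; look_up.
  set s1 := upd _ y _; set s2 := (X in run _ _ _ X).
  suff -> : s2 = s1 by apply: run_while0; rewrite /s1; look_up.
  by rewrite /s1 /s2; store_eq.
exists (Then (copy i n t) (Then (clear x) (Then (clear y) (While n next)))) => s.
pose P s1 := s1 n <= s i /\ (s1 x, s1 y) = iter (s i - s1 n) next_pair (0, 0) /\
  forall k, k < b -> s1 k = s k.
pose s1 := upd (upd (upd (upd s n (s i)) t 0) x 0) y 0.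
have [||s2 r2 [[_ [e2 k2]] z2]] := @run_loop P n next _ s1.
- move=> s2 [l2 [e2 k2]] sn; have [s3 r3 [e3 [n3 k3]]] := nextP s2.
  exists s3 => //; split; last by lia.
  split; first by lia.
  split=> [|k kb]; last by rewrite k3 ?k2.
  have -> : s i - s3 n = (s i - s2 n).+1 by lia.
  by rewrite iterS -e2.
- have n1 : s1 n = s i by rewrite /s1; look_up.
  rewrite /P n1 subnn; split=> //.
  by rewrite /s1; split=> [|k *] /=; [congr pair|]; look_up.
exists s2; last by rewrite e2 z2 subn0.
apply: run_then; first by apply: run_copy; lia.
by apply: run_then (run_clear _ _) _; apply: run_then (run_clear _ _) _.
Qed.

Lemma realizes_fst D : realizes D (fun x => (unpair x).1).
Proof.
move=> i j b ib jb b1 ij i1 j1; have [c hc] := run_unpair ib.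
exists (Then c (copy b j b.+1)) => s _; have [s1 r1 [e1 k1]] := hc s.
eexists; first by apply: run_then r1 _; apply: run_copy; lia.
rewrite -e1; split=> [|k kb *] /=; first by look_up.
by rewrite -k1 //; look_up.
Qed.

Lemma realizes_snd D : realizes D (fun x => (unpair x).2).
Proof.
move=> i j b ib jb b1 ij i1 j1; have [c hc] := run_unpair ib.
exists (Then c (copy b.+1 j b)) => s _; have [s1 r1 [e1 k1]] := hc s.
eexists; first by apply: run_then r1 _; apply: run_copy; lia.
rewrite -e1; split=> [|k kb *] /=; first by look_up.
by rewrite -k1 //; look_up.
Qed.

Lemma realizes_iter D f : realizes (fun=> True) f ->
  realizes D (fun x => iter (unpair x).2 f (unpair x).1).
Proof.
move=> hf i j b ib jb b1 ij i1 j1; have [c hc] := run_unpair ib.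
have [|||||| c1 h1] := hf b b.+2 b.+3; try lia.
exists (Then c (Then (While b.+1 (Then (Dec b.+1) (Then c1 (copy b.+2 b b.+3))))
  (copy b j b.+1))) => s _.
have [s1 r1 [e1 k1]] := hc s.
pose P s2 := s2 b.+1 <= s1 b.+1 /\ s2 b = iter (s1 b.+1 - s2 b.+1) f (s1 b) /\
  forall k, k < b -> k <> 1 -> s2 k = s k.
have [||s2 r2 [[_ [e2 k2]] z2]] :=
    @run_loop P b.+1 (Then (Dec b.+1) (Then c1 (copy b.+2 b b.+3))) _ s1.
- move=> s2 [l2 [e2 k2]] sn; pose s3 := upd s2 b.+1 (s2 b.+1).-1.
  have [s4 r4 [e4 k4]] := h1 s3 I; eexists.
    by apply: run_then (run_dec _ _ _) (run_then r4 _); apply: run_copy; lia.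
  set s5 := upd _ _ _.
  have x1 : s5 b.+1 = (s2 b.+1).-1.
    have -> : s5 b.+1 = s4 b.+1 by rewrite /s5; look_up.
    by rewrite k4; try lia; rewrite /s3; look_up.
  have x2 : s5 b = f (s2 b).
    have -> : s5 b = s4 b.+2 by rewrite /s5; look_up.
    by rewrite e4; congr f; rewrite /s3; look_up.
  rewrite /P x1 x2; split; last by lia.
  split; first by lia.
  split=> [|k *].
    have -> : s1 b.+1 - (s2 b.+1).-1 = (s1 b.+1 - s2 b.+1).+1 by lia.
    by rewrite iterS -e2.
  have -> : s5 k = s4 k by rewrite /s5; look_up.
  rewrite k4; try lia; have -> : s3 k = s2 k by rewrite /s3; look_up.
  exact: k2.
- by rewrite /P subnn; split=> //; split=> // k *; rewrite k1.
eexists.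
  by apply: run_then r1 (run_then r2 _); apply: run_copy; lia.
rewrite -e1 /=; split=> [|k *]; last by rewrite -k2 //; look_up.
by rewrite -[s1 b.+1]subn0 -z2 -e2; look_up.
Qed.

(** Outside of [D] the search may run forever, so [h] is arbitrary there. *)
Lemma realizes_mu (D : nat -> Prop) f h : realizes (fun=> True) f ->
  (forall x, D x -> f (pair_code x (h x)) = 0) ->
  (forall x y, D x -> y < h x -> f (pair_code x y) <> 0) -> realizes D h.
Proof.
move=> hf h0 h1 i j b ib jb b1 ij i1 j1.
have [|||||| c1 p1] := @run_pair i b b.+2 b.+3; try lia.
have [|||||| c2 p2] := hf b.+2 b.+1 b.+3; try lia.
pose test := Then c1 c2.
have testP s : exists2 s', run g test s s' & s' b.+1 = f (pair_code (s i) (s b)) /\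
    forall k, k < b.+1 -> k <> 1 -> s' k = s k.
  have [s1 r1 [e1 k1]] := p1 s; have [s2 r2 [e2 k2]] := p2 s1 I.
  exists s2; first exact: run_then r1 r2.
  by rewrite e2 e1; split=> // k *; rewrite k2 ?k1; lia.
exists (Then (clear b) (Then test (Then (While b.+1 (Then (Inc b) test)) (copy b j b.+1)))).
move=> s Ds; pose s1 := upd s b 0.
have [s2 r2 [e2 k2]] := testP s1.
pose P s3 := [/\ s3 b <= h (s i), s3 b.+1 = f (pair_code (s i) (s3 b)) &
  forall k, k < b -> k <> 1 -> s3 k = s k].
have loop m s3 : h (s i) - s3 b < m -> P s3 ->
    exists2 s4, run g (While b.+1 (Then (Inc b) test)) s3 s4 & P s4 /\ s4 b = h (s i).
  elim: m s3 => // m IH s3 lm P3; have [l3 e3 k3] := P3.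
  have [eh|nh] := eqVneq (s3 b) (h (s i)).
    exists s3; last by split.
    by apply: run_while0; rewrite e3 eh h0.
  have lh : s3 b < h (s i) by lia.
  pose s4 := upd s3 b (s3 b).+1; have [s5 r5 [e5 k5]] := testP s4.
  have x4 : s4 b = (s3 b).+1 by rewrite /s4; look_up.
  have x5 : s5 b = (s3 b).+1 by rewrite k5 ?x4; lia.
  have xi : s4 i = s i by rewrite -k3 // /s4; look_up.
  have [||s6 r6 P6] := IH s5; first by lia.
    split; [lia|by rewrite e5 xi x5 x4|move=> k *].
    by rewrite k5 // -?k3 // ?/s4; [look_up|lia].
  exists s6 => //; apply: run_whileS r6.
    by apply/eqP; rewrite e3; apply: h1.
  exact: run_then (run_inc _ _ _) r5.
have z1 : s1 b = 0 by rewrite /s1; look_up.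
have x1 : s1 i = s i by rewrite /s1; look_up.
have [||s3 r3 [[_ _ k3] e3]] := loop (h (s i)).+1 s2.
- by rewrite ltnS leq_subr.
- split; [by rewrite k2 ?z1; lia|by rewrite e2 z1 x1 k2 ?z1; lia|].
  by move=> k *; rewrite k2; try lia; rewrite /s1; look_up.
eexists.
  apply: run_then (run_clear _ _) (run_then r2 (run_then r3 _)).
  by apply: run_copy; lia.
by split=> [|k *]; last rewrite -k3 //; look_up.
Qed.

Lemma realizes_rec f : rec g f -> realizes (fun=> True) f.
Proof.
elim=> {f}.
- exact: realizes_zero.
- exact: realizes_succ.
- exact: realizes_id.
- exact: realizes_oracle.
- exact: realizes_fst.
- exact: realizes_snd.
- by move=> f h _ hf _ hh; apply: realizes_pair.
- by move=> f h _ hf _ hh; apply: realizes_comp.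
- by move=> f _ hf; apply: realizes_iter.
- by move=> f h _ hf h0 h1; apply: realizes_mu hf _ _ => [x _|x y _]; [apply: h0|apply: h1].
Qed.

Lemma realizes_machine D f : realizes D f ->
  exists M, forall x, D x -> computes g M x (f x).
Proof.
move=> hf; have [|||||| c hc] := hf 2 3 4; try lia.
pose c' := Then (copy 0 2 3) (Then c (copy 3 0 2)).
exists (machine_of c') => x Dx.
pose s0 : store := fun k => if k == 0 then x else 0.
pose s1 := upd (upd s0 2 (s0 0)) 3 0.
have x1 : s1 2 = x by [].
have [|s2 r2 [e2 _]] := hc s1; first by rewrite x1.
have -> : f x = upd (upd s2 0 (s2 3)) 2 0 0 by rewrite /upd /= e2 x1.
apply: machine_ofP; apply: run_then; first by apply: run_copy.
by apply: run_then r2 _; apply: run_copy.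
Qed.

(** Partiality is confined to one search, whose test and whose final computation
  are total functions. *)
Lemma search_machine (D : nat -> Prop) p h : rec g p -> rec g h ->
  (forall x, D x -> exists y, p (pair_code x y) = 0) ->
  exists M, forall x, D x ->
    exists y, p (pair_code x y) = 0 /\ computes g M x (h (pair_code x y)).
Proof.
move=> /realizes_rec hp /realizes_rec hh hD.
have {}hD x : exists y, D x -> p (pair_code x y) = 0 /\
    forall z, z < y -> p (pair_code x z) <> 0.
  have [Dx|] := EM (D x); last by move=> nD; exists 0.
  have [y /eqP py] := hD x Dx; have ey : exists y, p (pair_code x y) == 0 by exists y.
  exists (ex_minn ey) => _; case: ex_minnP => z /eqP pz hz; split=> // w wz /eqP /hz.
  by rewrite leqNgt wz.
have [m hm] := choice hD.
have [M hM] := @realizes_machine D (fun x => h (pair_code x (m x))) (realizes_comp hh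
  (realizes_pair (realizes_id D) (realizes_mu hp (fun x Dx => (hm x Dx).1)
     (fun x y Dx => (hm x Dx).2 y)))).
by exists M => x Dx; exists (m x); split; [exact: (hm x Dx).1|exact: hM].
Qed.

Lemma rec_turing_le f : rec g f -> turing_le f g.
Proof.
by move=> /realizes_rec /realizes_machine [M hM]; exists M => x; apply: hM.
Qed.

End Programs.

(** * Computable functions between encoded types *)

Class coded (A : Type) := code : A -> nat.

#[local] Instance coded_nat : coded nat := id.
#[local] Instance coded_bool : coded bool := nat_of_bool.
#[local] Instance coded_pair A B (cA : coded A) (cB : coded B) : coded (A * B) :=
  fun p => pair_code (code p.1) (code p.2).
#[local] Instance coded_seq A (cA : coded A) : coded (seq A) :=
  fun s => seq_code (map code s).

(** The function [r] is the same for all values; this makes an algorithm uniform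
  in data of varying size. *)
Definition effective (g : nat -> nat) A B (cA : coded A) (cB : coded B) (f : A -> B) :=
  exists2 r, rec g r & forall x, r (code x) = code (f x).
Arguments effective g {A B cA cB} f.

Create HintDb cpt discriminated.
(* Functions are decomposed along their syntax, without unfolding. *)
#[local] Hint Constants Opaque : cpt.
(* Unification may have contracted the function. *)
#[local] Hint Extern 3 (@effective ?g ?A ?B ?cA ?cB ?f) =>
  lazymatch f with
  | (fun _ => _) => fail
  | _ => change (@effective g A B cA cB (fun x => f x))
  end : cpt.
Ltac cpt := solve [typeclasses eauto with cpt nocore].

Section Composition.

Variable g : nat -> nat.
Local Notation cpt := (effective g).

Lemma rec_ext f h : rec g f -> f =1 h -> rec g h.
Proof. by move=> + /funext <-. Qed.

Lemma rec_const n : rec g (fun=> n).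
Proof.
elim: n => [|n IH]; first exact: rec_zero.
exact: rec_comp (rec_succ g) IH.
Qed.

(** Iterating [(x, y) -> (y, y)] once or more on [(h x, k x)] leaves [k x] in
  the first component. *)
Lemma rec_if f h k : rec g f -> rec g h -> rec g k ->
  rec g (fun x => if f x == 0 then h x else k x).
Proof.
move=> hf hh hk.
have h1 := rec_iter (rec_pair (rec_snd g) (rec_snd g)).
have h2 := rec_comp (rec_fst g) (rec_comp h1 (rec_pair (rec_pair hh hk) hf)).
apply: rec_ext h2 _ => x; rewrite !pair_codeK /=.
case: (f x) => [|n]; first by rewrite pair_codeK.
suff -> : iter n.+1 (fun x => pair_code (unpair x).2 (unpair x).2)
    (pair_code (h x) (k x)) = pair_code (k x) (k x) by rewrite pair_codeK.
by elim: n => [|n IH]; rewrite iterS ?IH pair_codeK.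
Qed.

Section Types.

Context X A B C (cX : coded X) (cA : coded A) (cB : coded B) (cC : coded C).

(** Only codes matter: a value may be read as a value of another type with the
  same code. *)
Lemma cpt_code (f : X -> A) (h : X -> B) : cpt f ->
  (forall x, code (f x) = code (h x)) -> cpt h.
Proof. by move=> [r hr er] e; exists r => // x; rewrite er. Qed.

Lemma cpt_id : cpt (fun x : X => x).
Proof. by exists id => //; apply: rec_id. Qed.

Lemma cpt_const (a : A) : cpt (fun _ : X => a).
Proof. by exists (fun=> code a) => //; apply: rec_const. Qed.

Lemma cpt_comp (f : A -> B) (h : X -> A) : cpt f -> cpt h ->
  cpt (fun x => f (h x)).
Proof.
move=> [r hr er] [s hs es]; exists (fun x => r (s x)); first exact: rec_comp.
by move=> x; rewrite es er.
Qed.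

Lemma cpt_pair (f : X -> A) (h : X -> B) : cpt f -> cpt h ->
  cpt (fun x => (f x, h x)).
Proof.
move=> [r hr er] [s hs es]; exists (fun x => pair_code (r x) (s x)).
  exact: rec_pair.
by move=> x; rewrite er es.
Qed.

Lemma cpt_fst (f : X -> A * B) : cpt f -> cpt (fun x => (f x).1).
Proof.
move=> [r hr er]; exists (fun x => (unpair (r x)).1).
  exact: rec_comp (rec_fst g) hr.
by move=> x; rewrite er pair_codeK.
Qed.

Lemma cpt_snd (f : X -> A * B) : cpt f -> cpt (fun x => (f x).2).
Proof.
move=> [r hr er]; exists (fun x => (unpair (r x)).2).
  exact: rec_comp (rec_snd g) hr.
by move=> x; rewrite er pair_codeK.
Qed.

Lemma cpt_if (b : X -> bool) (f h : X -> A) : cpt b -> cpt f -> cpt h ->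
  cpt (fun x => if b x then f x else h x).
Proof.
move=> [r hr er] [s hs es] [t ht et].
exists (fun x => if r x == 0 then t x else s x); first exact: rec_if.
by move=> x; rewrite er es et; case: (b x).
Qed.

Lemma cpt_iter (n : X -> nat) (F : X -> A -> A) (z : X -> A) : cpt n ->
  cpt (fun p => F p.1 p.2) -> cpt z -> cpt (fun x => iter (n x) (F x) (z x)).
Proof.
move=> [r hr er] [s hs es] [t ht et].
exists (fun x => (unpair (iter (r x) (fun y => pair_code (unpair y).1 (s y))
  (pair_code x (t x)))).2).
  apply: rec_comp (rec_snd g) _.
  have h1 := rec_comp (rec_iter (rec_pair (rec_fst g) hs))
    (rec_pair (rec_pair (rec_id g) ht) hr).
  by apply: rec_ext h1 _ => x; rewrite pair_codeK.
move=> x; rewrite et; have -> : r (code x) = n x by exact: er.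
have -> : iter (n x) (fun y => pair_code (unpair y).1 (s y))
  (pair_code (code x) (code (z x))) = code (x, iter (n x) (F x) (z x)).
  by elim: (n x) => // k IH; rewrite !iterS IH es pair_codeK.
by rewrite pair_codeK.
Qed.

Lemma cpt_succ (f : X -> nat) : cpt f -> cpt (fun x => (f x).+1).
Proof.
by move=> [r hr er]; exists (fun x => (r x).+1);
  [exact: rec_comp (rec_succ g) hr|move=> x; rewrite er].
Qed.

Lemma cpt_eq0 (f : X -> nat) : cpt f -> cpt (fun x => f x == 0).
Proof.
move=> [r hr er]; exists (fun x => if r x == 0 then 1 else 0).
  by apply: rec_if => //; apply: rec_const.
by move=> x; rewrite er; case: (f x).
Qed.

End Types.

Lemma cpt_comp2 X A B C (cX : coded X) (cA : coded A) (cB : coded B)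
    (cC : coded C) (F : A -> B -> C) (a : X -> A) (b : X -> B) :
  cpt (fun p => F p.1 p.2) -> cpt a -> cpt b -> cpt (fun x => F (a x) (b x)).
Proof.
by move=> hF ha hb; exact: (cpt_comp hF (cpt_pair ha hb)).
Qed.

Lemma cpt_comp3 X A B C D (cX : coded X) (cA : coded A) (cB : coded B)
    (cC : coded C) (cD : coded D) (F : A -> B -> C -> D) (a : X -> A) (b : X -> B)
    (c : X -> C) :
  cpt (fun p => F p.1 p.2.1 p.2.2) -> cpt a -> cpt b -> cpt c ->
  cpt (fun x => F (a x) (b x) (c x)).
Proof.
by move=> hF ha hb hc; exact: (cpt_comp hF (cpt_pair ha (cpt_pair hb hc))).
Qed.

End Composition.

Ltac cpt_hyp :=
  match goal with
  | H : @effective _ _ _ _ _ ?h |- @effective _ _ _ _ _ (fun x => ?h (@?a x)) =>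
      refine (cpt_comp (h:=a) H _)
  | H : @effective _ _ _ _ _ (fun p => ?F p.1 p.2)
    |- @effective _ _ _ _ _ (fun x => ?F (@?a x) (@?b x)) =>
      refine (cpt_comp2 (a:=a) (b:=b) H _ _)
  | H : @effective _ _ _ _ _ (fun p => ?F p.1 p.2.1 p.2.2)
    |- @effective _ _ _ _ _ (fun x => ?F (@?a x) (@?b x) (@?c x)) =>
      refine (cpt_comp3 (a:=a) (b:=b) (c:=c) H _ _ _)
  end.

#[local] Hint Resolve cpt_id cpt_const cpt_pair cpt_fst cpt_snd cpt_if cpt_iter
  cpt_succ cpt_eq0 : cpt.
#[local] Hint Extern 2 (@effective _ _ _ _ _ _) => cpt_hyp : cpt.

Section Toolbox.

Variable g : nat -> nat.
Local Notation cpt := (effective g).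

(** The predecessor is the last but one of the numbers counted. *)
Lemma cpt_pred X (cX : coded X) (f : X -> nat) : cpt f -> cpt (fun x => (f x).-1).
Proof.
move=> hf; have h : cpt (fun x => (iter (f x) (fun p => (p.2, p.2.+1)) (0, 0)).1).
  by cpt.
apply: cpt_code h _ => x; suff -> : iter (f x) (fun p => (p.2, p.2.+1)) (0, 0) =
  ((f x).-1, f x) by [].
by elim: (f x) => // n IH; rewrite iterS IH.
Qed.

Hint Resolve cpt_pred : cpt.

Lemma cpt_ext X A (cX : coded X) (cA : coded A) (f h : X -> A) : cpt f -> f =1 h -> cpt h.
Proof. by move=> + /funext <-. Qed.

Lemma cpt_add X (cX : coded X) (f h : X -> nat) : cpt f -> cpt h -> cpt (fun x => f x + h x).
Proof.
move=> hf hh; have e : cpt (fun x => iter (f x) succn (h x)) by cpt.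
by apply: cpt_ext e _ => x; elim: (f x) => // n IH; rewrite iterS IH addSn.
Qed.
Hint Resolve cpt_add : cpt.

Lemma cpt_mul X (cX : coded X) (f h : X -> nat) : cpt f -> cpt h -> cpt (fun x => f x * h x).
Proof.
move=> hf hh; have e : cpt (fun x => iter (f x) (addn (h x)) 0) by cpt.
by apply: cpt_ext e _ => x; elim: (f x) => // n IH; rewrite iterS IH mulSn.
Qed.
Hint Resolve cpt_mul : cpt.

Lemma cpt_sub X (cX : coded X) (f h : X -> nat) : cpt f -> cpt h -> cpt (fun x => f x - h x).
Proof.
move=> hf hh; have e : cpt (fun x => iter (h x) predn (f x)) by cpt.
apply: cpt_ext e _ => x; elim: (h x) => [|n IH]; first by rewrite subn0.
by rewrite iterS IH subnS.
Qed.
Hint Resolve cpt_sub : cpt.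

Lemma cpt_exp X (cX : coded X) (f h : X -> nat) : cpt f -> cpt h -> cpt (fun x => f x ^ h x).
Proof.
move=> hf hh; have e : cpt (fun x => iter (h x) (muln (f x)) 1) by cpt.
by apply: cpt_ext e _ => x; elim: (h x) => // n IH; rewrite iterS IH expnS.
Qed.

Lemma cpt_double X (cX : coded X) (f : X -> nat) : cpt f -> cpt (fun x => (f x).*2).
Proof.
move=> hf; have e : cpt (fun x => f x + f x) by cpt.
by apply: cpt_ext e _ => x; rewrite addnn.
Qed.

Lemma cpt_and X (cX : coded X) (a b : X -> bool) : cpt a -> cpt b -> cpt (fun x => a x && b x).
Proof.
move=> ha hb; have e : cpt (fun x => if a x then b x else false) by cpt.
by apply: cpt_ext e _ => x; case: (a x).
Qed.
Hint Resolve cpt_and : cpt.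

Lemma cpt_not X (cX : coded X) (a : X -> bool) : cpt a -> cpt (fun x => ~~ a x).
Proof.
move=> ha; have e : cpt (fun x => if a x then false else true) by cpt.
by apply: cpt_ext e _ => x; case: (a x).
Qed.
Hint Resolve cpt_not : cpt.

Lemma cpt_leq X (cX : coded X) (f h : X -> nat) : cpt f -> cpt h -> cpt (fun x => f x <= h x).
Proof. by move=> hf hh; have e : cpt (fun x => f x - h x == 0) by cpt. Qed.
Hint Resolve cpt_leq : cpt.

Lemma cpt_eqn X (cX : coded X) (f h : X -> nat) : cpt f -> cpt h -> cpt (fun x => f x == h x).
Proof.
move=> hf hh; have e : cpt (fun x => (f x <= h x) && (h x <= f x)) by cpt.
by apply: cpt_ext e _ => x; rewrite eqn_leq.
Qed.

Lemma cpt_odd X (cX : coded X) (f : X -> nat) : cpt f -> cpt (fun x => odd (f x)).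
Proof.
move=> hf; have e : cpt (fun x => iter (f x) negb false) by cpt.
by apply: cpt_ext e _ => x; elim: (f x) => // n IH; rewrite iterS IH.
Qed.

Lemma cpt_divn X (cX : coded X) (f h : X -> nat) : cpt f -> cpt h -> cpt (fun x => f x %/ h x).
Proof.
move=> hf hh; have e : cpt (fun x => iter (f x) (fun q =>
  if (0 < h x) && (q.+1 * h x <= f x) then q.+1 else q) 0) by cpt.
apply: cpt_ext e _ => x; have [->|d0] := posnP (h x).
  by rewrite divn0; elim: (f x) => // n IH; rewrite iterS IH.
have w n : iter n (fun q => if q.+1 * h x <= f x then q.+1 else q) 0
    = minn n (f x %/ h x).
  elim: n => [|n IH]; first by rewrite min0n.
  rewrite iterS IH -leq_divRL //; case: ifP; lia.
by rewrite [iter _ _ _]w; apply/minn_idPr; rewrite leq_div.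
Qed.
Hint Resolve cpt_divn : cpt.

Lemma cpt_half X (cX : coded X) (f : X -> nat) : cpt f -> cpt (fun x => (f x)./2).
Proof.
move=> hf; have e : cpt (fun x => f x %/ 2) by cpt.
by apply: cpt_ext e _ => x; rewrite divn2.
Qed.

Hint Resolve cpt_exp cpt_double cpt_eqn cpt_odd cpt_half : cpt.

Lemma size_code A (cA : coded A) (s : seq A) : size s <= code s.
Proof.
elim: s => //= a s IH; rewrite [code _]/= ltnS (leq_trans IH) //.
by rewrite pair_codeE; exact: leq_addl.
Qed.

(** The function [code] is the identity on codes. *)
Lemma cpt_codeof X A (cX : coded X) (cA : coded A) (f : X -> A) : cpt f -> cpt (fun x => code (f x)).
Proof. by move=> hf; apply: cpt_code hf _. Qed.
Hint Resolve cpt_codeof : cpt.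

Lemma cpt_cons X A (cX : coded X) (cA : coded A) (f : X -> A) (s : X -> seq A) :
  cpt f -> cpt s -> cpt (fun x => f x :: s x).
Proof.
move=> [r hr er] [t ht et]; exists (fun x => (pair_code (r x) (t x)).+1).
  exact: rec_comp (rec_succ g) (rec_pair hr ht).
by move=> x; rewrite er et.
Qed.
Hint Resolve cpt_cons : cpt.

Lemma cpt_case X A B (cX : coded X) (cA : coded A) (cB : coded B)
    (s : X -> seq A) (z : X -> B) (F : X -> A -> seq A -> B) : cpt s -> cpt z ->
  cpt (fun p => F p.1 p.2.1 p.2.2) ->
  cpt (fun x => if s x is a :: l then F x a l else z x).
Proof.
move=> [r hr er] [t ht et] [u hu eu].
have [p hp ep] : cpt predn by cpt.
exists (fun x => if r x == 0 then t x else u (pair_code x (p (r x)))).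
  by apply: rec_if => //; apply: rec_comp hu (rec_pair (rec_id g) (rec_comp hp hr)).
move=> x; rewrite er et; case: (s x) => [|a l] //=.
have -> : p (code (a :: l)) = pair_code (code a) (code l) by exact: ep.
exact: (eu (x, (a, l))).
Qed.

Lemma cpt_head X A (cX : coded X) (cA : coded A) (a : X -> A) (s : X -> seq A) :
  cpt a -> cpt s -> cpt (fun x => head (a x) (s x)).
Proof. by move=> ha hs; apply: (@cpt_case _ _ _ _ _ _ s a (fun _ b _ => b)) => //; cpt. Qed.
Hint Resolve cpt_head : cpt.

Lemma cpt_behead X A (cX : coded X) (cA : coded A) (s : X -> seq A) :
  cpt s -> cpt (fun x => behead (s x)).
Proof.
move=> hs; apply: (@cpt_ext _ _ _ _ (fun x => if s x is _ :: l then l else [::])).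
  by apply: (@cpt_case _ _ _ _ _ _ s (fun=> [::]) (fun _ _ l => l)) => //; cpt.
by move=> x; case: (s x).
Qed.
Hint Resolve cpt_behead : cpt.

Lemma cpt_foldl X A B (cX : coded X) (cA : coded A) (cB : coded B)
    (s : X -> seq A) (z : X -> B) (F : X -> B -> A -> B) : cpt s -> cpt z ->
  cpt (fun p => F p.1 p.2.1 p.2.2) -> cpt (fun x => foldl (F x) (z x) (s x)).
Proof.
move=> hs hz hF.
have [step [stepE hstep]] : exists step,
    (forall x p, step x p = if p.1 is a :: l then (l, F x p.2 a) else p) /\
    cpt (fun q => step q.1 q.2).
  eexists; split=> [x p|]; first reflexivity.
  apply: (@cpt_case _ _ _ _ _ _ (fun q : X * (seq A * B) => q.2.1) (fun q => q.2)
    (fun q a l => (l, F q.1 q.2.2 a))); by cpt.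
(* The code of a list bounds its length, hence the number of steps; steps in
   excess change nothing. *)
have e : cpt (fun x => (iter (code (s x)) (step x) (s x, z x)).2) by cpt.
apply: cpt_ext e _ => x; move: (size_code cA (s x)); move: (code (s x)) => n.
elim: n (s x) (z x) => [|n IH] [|a l] b // h; rewrite iterSr stepE /=.
  exact: (IH [::]).
exact: IH.
Qed.

Lemma cpt_rev X A (cX : coded X) (cA : coded A) (s : X -> seq A) :
  cpt s -> cpt (fun x => rev (s x)).
Proof.
move=> hs; have e : cpt (fun x => foldl (fun l a => a :: l) [::] (s x)).
  by apply: cpt_foldl => //; cpt.
by apply: cpt_ext e _ => x; rewrite -[s x in LHS]revK foldl_rev; elim: (rev _) => //= a l ->.
Qed.
Hint Resolve cpt_rev : cpt.

Lemma cpt_foldr X A B (cX : coded X) (cA : coded A) (cB : coded B)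
    (s : X -> seq A) (z : X -> B) (F : X -> A -> B -> B) : cpt s -> cpt z ->
  cpt (fun p => F p.1 p.2.1 p.2.2) -> cpt (fun x => foldr (F x) (z x) (s x)).
Proof.
move=> hs hz hF; have e : cpt (fun x => foldl (fun b a => F x a b) (z x) (rev (s x))).
  by apply: cpt_foldl => //; cpt.
by apply: cpt_ext e _ => x; rewrite foldl_rev.
Qed.
Hint Resolve cpt_foldr : cpt.

Lemma cpt_map X A B (cX : coded X) (cA : coded A) (cB : coded B)
    (s : X -> seq A) (F : X -> A -> B) : cpt s -> cpt (fun p => F p.1 p.2) ->
  cpt (fun x => map (F x) (s x)).
Proof.
move=> hs hF; have e : cpt (fun x => foldr (fun a l => F x a :: l) [::] (s x)) by cpt.
by apply: cpt_ext e _ => x; elim: (s x) => //= a l ->.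
Qed.
Hint Resolve cpt_map : cpt.

Lemma cpt_cat X A (cX : coded X) (cA : coded A) (s t : X -> seq A) :
  cpt s -> cpt t -> cpt (fun x => s x ++ t x).
Proof.
move=> hs ht; have e : cpt (fun x => foldr cons (t x) (s x)) by cpt.
by apply: cpt_ext e _ => x; elim: (s x) => //= a l ->.
Qed.
Hint Resolve cpt_cat : cpt.

Lemma cpt_flatten X A (cX : coded X) (cA : coded A) (s : X -> seq (seq A)) :
  cpt s -> cpt (fun x => flatten (s x)).
Proof. by move=> hs; have e : cpt (fun x => foldr cat [::] (s x)) by cpt. Qed.
Hint Resolve cpt_flatten : cpt.

Lemma cpt_size X A (cX : coded X) (cA : coded A) (s : X -> seq A) :
  cpt s -> cpt (fun x => size (s x)).
Proof.
move=> hs; have e : cpt (fun x => foldr (fun _ => succn) 0 (s x)) by cpt.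
by apply: cpt_ext e _ => x; elim: (s x) => //= a l ->.
Qed.
Hint Resolve cpt_size : cpt.

Lemma cpt_sumn X (cX : coded X) (s : X -> seq nat) :
  cpt s -> cpt (fun x => sumn (s x)).
Proof. by move=> hs; have e : cpt (fun x => foldr addn 0 (s x)) by cpt. Qed.
Hint Resolve cpt_sumn : cpt.

Lemma cpt_all X A (cX : coded X) (cA : coded A) (s : X -> seq A) (p : X -> A -> bool) :
  cpt s -> cpt (fun q => p q.1 q.2) -> cpt (fun x => all (p x) (s x)).
Proof.
move=> hs hp; have e : cpt (fun x => foldr (fun a b => p x a && b) true (s x)) by cpt.
by apply: cpt_ext e _ => x; elim: (s x) => //= a l ->.
Qed.
Hint Resolve cpt_all : cpt.

Lemma cpt_find X A (cX : coded X) (cA : coded A) (s : X -> seq A) (p : X -> A -> bool) :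
  cpt s -> cpt (fun q => p q.1 q.2) -> cpt (fun x => find (p x) (s x)).
Proof.
move=> hs hp.
have e : cpt (fun x => foldr (fun a n => if p x a then 0 else n.+1) 0 (s x)) by cpt.
by apply: cpt_ext e _ => x; elim: (s x) => //= a l ->.
Qed.
Hint Resolve cpt_find : cpt.

Lemma cpt_nth X A (cX : coded X) (cA : coded A) (a : X -> A) (s : X -> seq A) n :
  cpt a -> cpt s -> cpt n -> cpt (fun x => nth (a x) (s x) (n x)).
Proof.
move=> ha hs hn; have e : cpt (fun x => head (a x) (iter (n x) behead (s x))) by cpt.
apply: cpt_ext e _ => x; suff -> : iter (n x) behead (s x) = drop (n x) (s x).
  by rewrite -nth0 nth_drop addn0.
by elim: (n x) => [|k IH]; rewrite ?drop0 // iterS IH -drop1 drop_drop.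
Qed.
Hint Resolve cpt_nth : cpt.

Lemma cpt_iota X (cX : coded X) (n : X -> nat) : cpt n -> cpt (fun x => iota 0 (n x)).
Proof.
move=> hn; have e : cpt (fun x => iter (n x) (fun l => l ++ [:: size l]) [::]) by cpt.
apply: cpt_ext e _ => x; elim: (n x) => // k IH.
by rewrite iterS IH size_iota -addn1 iotaD.
Qed.
Hint Resolve cpt_iota : cpt.

Lemma cpt_nseq X A (cX : coded X) (cA : coded A) (n : X -> nat) (a : X -> A) :
  cpt n -> cpt a -> cpt (fun x => nseq (n x) (a x)).
Proof. by move=> hn ha; have e : cpt (fun x => iter (n x) (cons (a x)) [::]) by cpt. Qed.
Hint Resolve cpt_nseq : cpt.

Lemma cpt_set_nth X A (cX : coded X) (cA : coded A) (a : X -> A) (s : X -> seq A) n b :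
  cpt a -> cpt s -> cpt n -> cpt b ->
  cpt (fun x => set_nth (a x) (s x) (n x) (b x)).
Proof.
move=> ha hs hn hb.
have e : cpt (fun x => [seq if i == n x then b x else nth (a x) (s x) i
    | i : nat <- iota 0 (size (s x) + ((n x).+1 - size (s x)))]) by cpt.
apply: cpt_ext e _ => x; apply: (@eq_from_nth _ (a x)).
  by rewrite size_map size_iota size_set_nth; lia.
move=> i; rewrite size_map size_iota => hi.
by rewrite (nth_map 0) ?size_iota // nth_iota // nth_set_nth.
Qed.
Hint Resolve cpt_set_nth : cpt.

End Toolbox.

#[local] Hint Resolve cpt_pred cpt_add cpt_mul cpt_sub cpt_exp cpt_double cpt_and
  cpt_not cpt_leq cpt_eqn cpt_odd cpt_divn cpt_half cpt_codeof cpt_cons cpt_head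
  cpt_behead cpt_rev cpt_foldr cpt_map cpt_cat cpt_flatten cpt_size cpt_sumn
  cpt_all cpt_find cpt_nth cpt_iota cpt_nseq cpt_set_nth : cpt.

(** * Simulation of machines *)

Lemma pair_code_inj x y x' y' : pair_code x y = pair_code x' y' -> x = x' /\ y = y'.
Proof. by move=> /(congr1 unpair); rewrite !pair_codeK => -[]. Qed.

Lemma seq_code_inj : injective seq_code.
Proof.
elim=> [|x s IH] [|y t] //= [] /pair_code_inj [-> /IH ->]; by [].
Qed.

Lemma code_nats (s : seq nat) : code s = seq_code s.
Proof. by congr seq_code; exact: map_id. Qed.

(** A simulated machine is given by its code, so its number of tapes is not
  known in advance. Instructions and configurations are therefore copied to
  types that do not depend on it. *)
Inductive raw_instr :=
| RawAct of nat & seq nat & nat & seq (nat * nat)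
| RawAsk of nat & nat.

Definition instr_seq (i : raw_instr) : seq nat :=
  match i with
  | RawAct q r q' w => [:: 0; q; code r; q'; code w]
  | RawAsk q q' => [:: 1; q; q']
  end.

#[local] Instance coded_instr : coded raw_instr := fun i => code (instr_seq i).

Lemma code_instr i : code i = seq_code (instr_seq i).
Proof. exact: code_nats. Qed.

Definition act_of (i : raw_instr) : bool := if i is RawAct _ _ _ _ then true else false.
Definition from_state i := match i with RawAct q _ _ _ | RawAsk q _ => q end.
Definition to_state i := match i with RawAct _ _ q _ | RawAsk _ q => q end.
Definition scanned i : seq nat := if i is RawAct _ r _ _ then r else [::].
Definition written i : seq (nat * nat) := if i is RawAct _ _ _ w then w else [::].

Local Notation raw_config := (nat * seq (seq nat * nat))%type.

Definition raw_write (T : seq nat * nat) (p : nat * nat) : seq nat * nat :=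
  (set_nth 0 T.1 T.2 p.1,
   if p.2 == 0 then T.2.-1 else if p.2 == 1 then T.2 else T.2.+1).

Definition raw_tape (c : raw_config) (j : nat) := nth ([::], 0) c.2 j.

Section Simulation.

Variable g : nat -> nat.
Local Notation cpt := (effective g).

Definition raw_act (i : raw_instr) (c : raw_config) : raw_config :=
  (to_state i, [seq raw_write (raw_tape c j) (nth (0, 0) (written i) j)
               | j <- iota 0 (size c.2)]).

Definition raw_ask (i : raw_instr) (c : raw_config) : raw_config :=
  (to_state i, [seq (if j == 1 then (nseq (g (tape_num (raw_tape c j))) 1, 0)
                     else raw_tape c j) | j : nat <- iota 0 (size c.2)]).

Definition raw_exec (i : raw_instr) (c : raw_config) : seq raw_config :=
  if c.1 == from_state i then
    if act_of i then
      if [seq nth 0 T.1 T.2 | T <- c.2] == scanned i then [:: raw_act i c] else [::]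
    else [:: raw_ask i c]
  else [::].

(** A list of at most one configuration stands for an option. *)
Definition raw_step (l : seq raw_instr) (c : raw_config) : seq raw_config :=
  flatten [seq raw_exec i c | i <- l].

Definition raw_halted l c : bool := size (raw_step l c) == 0.

Definition raw_next l c : raw_config := head c (raw_step l c).

Definition raw_init (t x : nat) : raw_config :=
  (0, [seq (nseq (if j == 0 then x else 0) 1, 0) | j : nat <- iota 0 t.+2]).

Definition raw_run (W : nat * seq raw_instr) (x n : nat) : raw_config :=
  iter n (raw_next W.2) (raw_init W.1 x).

Definition raw_output (c : raw_config) : nat := tape_num (raw_tape c 0).

Definition raw_of_instr t (i : instr t) : raw_instr :=
  match i with
  | Act q r q' w => RawAct q r q' [seq (p.1, move_code p.2) | p <- w]
  | Ask q q' => RawAsk q q'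
  end.

Definition raw_of_machine (M : oracle_machine) : nat * seq raw_instr :=
  (extra_tapes M, [seq raw_of_instr i | i <- table M]).

Lemma code_raw_machine M : code (raw_of_machine M) = machine_code M.
Proof.
rewrite /machine_code; congr (pair_code _ (seq_code _)).
rewrite -map_comp; apply: eq_map => -[q r q' w|q q'] /=.
  have er : code (val r) = seq_code r := code_nats _.
  have ew : code [seq (p.1, move_code p.2) | p <- w] =
    seq_code [seq pair_code p.1 (move_code p.2) | p <- w].
    by congr seq_code; rewrite -map_comp.
  by rewrite code_instr /= er ew.
exact: code_instr.
Qed.

Definition raw_of_config t (c : config t) : raw_config := (c.1, val c.2).

Lemma raw_exec_instr t (i : instr t.+2) (c : config t) :
  raw_exec (raw_of_instr i) (raw_of_config c) =
  if exec g i c is Some c' then [:: raw_of_config c'] else [::].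
Proof.
case: c => q0 T; rewrite /raw_of_config /=.
have hT j : raw_tape (q0, val T) (val (j : 'I_t.+2)) = tnth T j.
  by rewrite /raw_tape (tnth_nth ([::], 0)).
have iotaE B (F : 'I_t.+2 -> B) (F' : nat -> B) : (forall j, F' (val j) = F j) ->
    [seq F' j | j <- iota 0 (size (val T))] = val [tuple F j | j < t.+2].
  move=> hF; rewrite size_tuple -val_enum_ord -map_comp /=.
  exact: eq_map.
case: i => [q r q' w|q q'] /=; rewrite /raw_exec /=; case: eqP => // _ /=; last first.
  congr [:: (_, _)]; rewrite (iotaE _ (fun j => if val j == 1
                         then num_tape (g (tape_num (tnth T j)))
                         else tnth T j)) // => j.
  by rewrite hT.
have -> : ([seq nth 0 p.1 p.2 | p <- val T] == val r) =
    ([tuple scan (tnth T j) | j < t.+2] == r).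
  rewrite -val_eqE; congr (_ == _).
  have -> : val T = [seq tnth T j | j <- enum 'I_t.+2] by rewrite map_tnth_enum.
  by rewrite -map_comp.
case: eqP => // _; congr [:: (_, _)].
rewrite (iotaE _ (fun j => write_move (tnth T j) (tnth w j))) // => j.
rewrite hT (nth_map (0, MStay)) ?size_tuple; last exact: ltn_ord.
rewrite /raw_write /write_move /= (tnth_nth (0, MStay)).
by case: (nth _ _ _).2.
Qed.

Lemma raw_step_table t (l : seq (instr t.+2)) (c : config t) :
  ohead (raw_step (map (@raw_of_instr _) l) (raw_of_config c)) =
  omap (@raw_of_config t) (step g l c).
Proof.
elim: l => //= i l IH; rewrite /raw_step /= raw_exec_instr.
by case: (exec g i c).
Qed.

Lemma raw_runP M x y : computes g M x y ->
  (exists n0, forall n, n0 <= n ->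
     raw_halted (raw_of_machine M).2 (raw_run (raw_of_machine M) x n)) /\
  (forall n, raw_halted (raw_of_machine M).2 (raw_run (raw_of_machine M) x n) ->
     raw_output (raw_run (raw_of_machine M) x n) = y).
Proof.
move=> [n0 [c [run_c halt_c out_c]]].
set tbl := (raw_of_machine M).2; set run := raw_run _ _.
pose next := obind (step g (table M)).
have haltE c1 : raw_halted tbl (raw_of_config c1) = ~~ isSome (step g (table M) c1).
  have := raw_step_table (table M) c1; rewrite /raw_halted -/tbl.
  by case: raw_step => [|? ?]; case: (step _ _ _).
have nextE c1 : raw_next tbl (raw_of_config c1) =
    if step g (table M) c1 is Some c2 then raw_of_config c2 else raw_of_config c1.
  have := raw_step_table (table M) c1; rewrite /raw_next -/tbl.
  by case: raw_step => [|? ?]; case: (step _ _ _) => //= ? [->].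
have runS n : run n.+1 = raw_next tbl (run n) by [].
have run0 : run 0 = raw_of_config (init_config M x).
  congr (_, _); rewrite -val_enum_ord -map_comp.
  transitivity [seq (if val j == 0 then num_tape x else num_tape 0)
    | j <- enum 'I_(extra_tapes M).+2]; last by [].
  by apply: eq_map => j /=; case: eqP.
clearbody run.
have runE n c1 : iter n next (Some (init_config M x)) = Some c1 -> run n = raw_of_config c1.
  elim: n c1 => [|n IH] c1; first by rewrite run0 => -[<-].
  rewrite iterS; case E: (iter n _ _) => [c2|] //= E2.
  by rewrite runS (IH _ E) nextE E2.
have run_late n : n0 <= n -> run n = raw_of_config c.
  elim: n => [|n IH]; first by rewrite leqn0 => /eqP n00; apply: runE; rewrite -n00.
  rewrite leq_eqVlt => /orP[/eqP <-|/IH E]; first exact: runE.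
  by rewrite runS E nextE halt_c.
have out_late n : n0 <= n -> raw_output (run n) = y.
  by move=> /run_late ->; rewrite -out_c /raw_output /output /raw_tape (tnth_nth ([::], 0)).
split; first by exists n0 => n /run_late ->; rewrite haltE halt_c.
move=> n; have [/out_late //|nn] := leqP n0 n.
have none k : iter k next None = None by elim: k => //= k ->.
move: run_c; rewrite -/next -(subnK (ltnW nn)) iterD.
case E: (iter n next _) => [c1|]; last by rewrite none.
rewrite (runE _ _ E) haltE -(subnSK nn) iterSr {2}/next /=.
by case: (step _ _ _) => [//|]; rewrite none.
Qed.

Lemma cpt_eqseq X (cX : coded X) (s t : X -> seq nat) : cpt s -> cpt t ->
  cpt (fun x => s x == t x).
Proof.
move=> hs ht; have e : cpt (fun x => code (s x) == code (t x)) by cpt.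
apply: cpt_ext e _ => x; rewrite !code_nats.
by apply/eqP/eqP => [/seq_code_inj|->].
Qed.
Hint Resolve cpt_eqseq : cpt.

Lemma cpt_oracle X (cX : coded X) (f : X -> nat) : cpt f -> cpt (fun x => g (f x)).
Proof.
move=> [r hr er]; exists (fun x => g (r x)); first exact: rec_comp (rec_oracle g) hr.
by move=> x; rewrite er.
Qed.
Hint Resolve cpt_oracle : cpt.

Lemma cpt_instr_seq X (cX : coded X) (i : X -> raw_instr) :
  cpt i -> cpt (fun x => instr_seq (i x)).
Proof. by move=> hi; apply: cpt_code hi _. Qed.
Hint Resolve cpt_instr_seq : cpt.

Lemma cpt_act_of X (cX : coded X) (i : X -> raw_instr) :
  cpt i -> cpt (fun x => act_of (i x)).
Proof.
move=> hi; have e : cpt (fun x => nth 0 (instr_seq (i x)) 0 == 0) by cpt.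
by apply: cpt_ext e _ => x; case: (i x).
Qed.
Hint Resolve cpt_act_of : cpt.

Lemma cpt_from_state X (cX : coded X) (i : X -> raw_instr) :
  cpt i -> cpt (fun x => from_state (i x)).
Proof.
move=> hi; have e : cpt (fun x => nth 0 (instr_seq (i x)) 1) by cpt.
by apply: cpt_ext e _ => x; case: (i x).
Qed.
Hint Resolve cpt_from_state : cpt.

Lemma cpt_to_state X (cX : coded X) (i : X -> raw_instr) :
  cpt i -> cpt (fun x => to_state (i x)).
Proof.
move=> hi; have e : cpt (fun x => nth 0 (instr_seq (i x)) (if act_of (i x) then 3 else 2)).
  by cpt.
by apply: cpt_ext e _ => x; case: (i x).
Qed.
Hint Resolve cpt_to_state : cpt.

Lemma cpt_scanned X (cX : coded X) (i : X -> raw_instr) :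
  cpt i -> cpt (fun x => scanned (i x)).
Proof.
move=> hi; have e : cpt (fun x => if act_of (i x) then nth 0 (instr_seq (i x)) 2 else 0).
  by cpt.
by apply: cpt_code e _ => x; case: (i x).
Qed.
Hint Resolve cpt_scanned : cpt.

Lemma cpt_written X (cX : coded X) (i : X -> raw_instr) :
  cpt i -> cpt (fun x => written (i x)).
Proof.
move=> hi; have e : cpt (fun x => if act_of (i x) then nth 0 (instr_seq (i x)) 4 else 0).
  by cpt.
by apply: cpt_code e _ => x; case: (i x).
Qed.
Hint Resolve cpt_written : cpt.

Lemma cpt_raw_write X (cX : coded X) (T : X -> seq nat * nat) (p : X -> nat * nat) :
  cpt T -> cpt p -> cpt (fun x => raw_write (T x) (p x)).
Proof. by move=> hT hp; rewrite /raw_write; cpt. Qed.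
Hint Resolve cpt_raw_write : cpt.

Lemma cpt_raw_tape X (cX : coded X) (c : X -> raw_config) (j : X -> nat) :
  cpt c -> cpt j -> cpt (fun x => raw_tape (c x) (j x)).
Proof. by move=> hc hj; rewrite /raw_tape; cpt. Qed.
Hint Resolve cpt_raw_tape : cpt.

Lemma cpt_tape_num X (cX : coded X) (T : X -> seq nat * nat) :
  cpt T -> cpt (fun x => tape_num (T x)).
Proof. by move=> hT; have e : cpt (fun x => find (fun s : nat => s != 1) (T x).1) by cpt. Qed.
Hint Resolve cpt_tape_num : cpt.

Lemma cpt_raw_exec X (cX : coded X) (i : X -> raw_instr) (c : X -> raw_config) :
  cpt i -> cpt c -> cpt (fun x => raw_exec (i x) (c x)).
Proof. by move=> hi hc; rewrite /raw_exec /raw_act /raw_ask; cpt. Qed.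
Hint Resolve cpt_raw_exec : cpt.

Lemma cpt_raw_step X (cX : coded X) (l : X -> seq raw_instr) (c : X -> raw_config) :
  cpt l -> cpt c -> cpt (fun x => raw_step (l x) (c x)).
Proof. by move=> hi hc; rewrite /raw_step; cpt. Qed.
Hint Resolve cpt_raw_step : cpt.

Lemma cpt_raw_run X (cX : coded X) (W : X -> nat * seq raw_instr) (x n : X -> nat) :
  cpt W -> cpt x -> cpt n -> cpt (fun y => raw_run (W y) (x y) (n y)).
Proof. by move=> hW hx hn; rewrite /raw_run /raw_next /raw_init; cpt. Qed.
Hint Resolve cpt_raw_run : cpt.

Lemma cpt_raw_halted X (cX : coded X) (l : X -> seq raw_instr) (c : X -> raw_config) :
  cpt l -> cpt c -> cpt (fun x => raw_halted (l x) (c x)).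
Proof. by move=> hi hc; rewrite /raw_halted; cpt. Qed.
Hint Resolve cpt_raw_halted : cpt.

Lemma cpt_raw_output X (cX : coded X) (c : X -> raw_config) :
  cpt c -> cpt (fun x => raw_output (c x)).
Proof. by move=> hc; rewrite /raw_output; cpt. Qed.
Hint Resolve cpt_raw_output : cpt.

(** Halting within a given time is decidable, so the running time is found by
  an unbounded search. *)
Lemma computes_rec M (e f : nat -> nat) : rec g e ->
  (forall x, computes g M (e x) (f x)) -> rec g f.
Proof.
move=> he hM; set W := raw_of_machine M.
have ce : cpt e by exists e.
have [p hp ep] : cpt (fun y : nat * nat => if raw_halted W.2 (raw_run W (e y.1) y.2) then 0 else 1).
  by cpt.
have [h hh eh] : cpt (fun y : nat * nat => raw_output (raw_run W (e y.1) y.2)).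
  by cpt.
have ex x : exists n, raw_halted W.2 (raw_run W (e x) n) /\
    forall k, k < n -> ~~ raw_halted W.2 (raw_run W (e x) k).
  have [[n0 h0] _] := raw_runP (hM x).
  have ex : exists n, raw_halted W.2 (raw_run W (e x) n) by exists n0; apply: h0.
  case: (ex_minnP ex) => n hn min_n; exists n; split=> // k kn.
  by apply/negP => /min_n; rewrite leqNgt kn.
have [m hm] := choice ex.
have hm' : rec g m.
  apply: rec_mu hp _ _ => [x|x y ym].
    by have := ep (x, m x); rewrite /= (hm x).1.
  by have := ep (x, y); rewrite /= (negPf ((hm x).2 _ ym)) => ->.
apply: rec_ext (rec_comp hh (rec_pair (rec_id g) hm')) _ => x.
by rewrite [LHS](eh (x, m x)); apply: (raw_runP (hM x)).2; apply: (hm x).1.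
Qed.

End Simulation.

#[local] Hint Resolve cpt_eqseq cpt_oracle cpt_raw_run cpt_raw_halted cpt_raw_output : cpt.

(** * Traces of powers of matrices over words *)

(** Integer coefficients are given as differences of numbers, so that only sums
  and products of numbers have to be computed. *)
Local Notation comb L := (seq ((nat * nat) * seq L)).

Section Words.

Variable L : Type.
Implicit Types (a b c : comb L) (B : seq (seq (comb L))) (u : seq (comb L)).

Definition comb_one : comb L := [:: ((1, 0), [::])].

Definition comb_opp a : comb L := [seq ((t.1.2, t.1.1), t.2) | t <- a].

Definition comb_mul a b : comb L :=
  flatten [seq [seq ((t.1.1 * v.1.1 + t.1.2 * v.1.2, t.1.1 * v.1.2 + t.1.2 * v.1.1),
                     t.2 ++ v.2) | v <- b] | t <- a].

Definition entry B (i j : nat) : comb L := nth [::] (nth [::] B i) j.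

Definition vec_mul n u B : seq (comb L) :=
  [seq flatten [seq comb_mul (nth [::] u i) (entry B i j) | i <- iota 0 n]
  | j <- iota 0 n].

Definition unit_vec n (i : nat) : seq (comb L) :=
  [seq (if j == i then comb_one else [::]) | j : nat <- iota 0 n].

Definition power_row n B (d i : nat) : seq (comb L) :=
  iter d (fun u => vec_mul n u B) (unit_vec n i).

Definition power_trace n B (d : nat) : comb L :=
  flatten [seq nth [::] (power_row n B d i) i | i <- iota 0 n].

(** The code of a nonnegative [z] is [2 z], that of a negative one is
  [2 (- z) - 1]. *)
Definition int_parts (z : nat) : nat * nat :=
  (if odd z then 0 else z./2, if odd z then z./2.+1 else 0).

Definition comb_of (a : seq (nat * seq L)) : comb L :=
  [seq (int_parts t.1, t.2) | t <- a].

Definition mx_of n (A : seq (seq (seq (nat * seq L)))) : seq (seq (comb L)) :=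
  [seq [seq comb_of (nth [::] (nth [::] A i) j) | j <- iota 0 n] | i <- iota 0 n].

Definition scalar_sub n (K : nat) B : seq (seq (comb L)) :=
  [seq [seq (if i == j then [:: ((K, 0), [::])] else [::]) ++ comb_opp (entry B i j)
       | j : nat <- iota 0 n] | i : nat <- iota 0 n].

Definition weight a : nat := sumn [seq t.1.1 + t.1.2 | t <- a].

Lemma weight_cat a b : weight (a ++ b) = weight a + weight b.
Proof. by rewrite /weight map_cat sumn_cat. Qed.

Lemma weight_flatten (s : seq (comb L)) : weight (flatten s) = sumn (map weight s).
Proof. by elim: s => //= a s IH; rewrite weight_cat IH. Qed.

Lemma weight_mul a b : weight (comb_mul a b) = weight a * weight b.
Proof.
rewrite /comb_mul; elim: a => //= t a IH.
rewrite weight_cat {}IH -/(weight a) [weight (t :: a)]/= mulnDl; congr (_ + _).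
elim: b => [|v b IH]; first by rewrite muln0.
by rewrite /weight /= -!/(weight _) IH; lia.
Qed.

Lemma sumn_iota n (F : nat -> nat) : sumn [seq F i | i <- iota 0 n] = \sum_(i < n) F i.
Proof. by rewrite sumnE big_map -[n in iota 0 n]subn0 -/(index_iota 0 n) big_mkord. Qed.

Lemma nth_mkiota T (x : T) n (F : nat -> T) (i : nat) : i < n ->
  nth x [seq F i | i <- iota 0 n] i = F i.
Proof. by move=> h; rewrite (nth_map 0) ?size_iota // nth_iota. Qed.

(** Weights are multiplicative, so multiplying a row by [B] multiplies its total
  weight by at most the largest weight of a row of [B]. *)
Lemma weight_power_trace n B d K :
  (forall i, i < n -> \sum_(j < n) weight (entry B i j) <= K) ->
  weight (power_trace n B d) <= n * K ^ d.
Proof.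
move=> hB.
have row i : i < n -> \sum_(j < n) weight (nth [::] (power_row n B d i) j) <= K ^ d.
  move=> hi; rewrite /power_row; elim: d => [|d IH].
    rewrite /= (bigD1 (Ordinal hi)) //= nth_mkiota // eqxx big1 // => j /eqP ji.
    rewrite nth_mkiota ?ltn_ord //; case: eqP => // e.
    by case: ji; apply: val_inj.
  rewrite iterS; set u := iter _ _ _ in IH *.
  apply: (@leq_trans (\sum_(j < n) \sum_(i < n)
      weight (nth [::] u i) * weight (entry B i j))).
    apply: leq_sum => j _; rewrite nth_mkiota ?ltn_ord // weight_flatten -map_comp.
    rewrite sumn_iota; apply: leq_sum => k _ /=; by rewrite weight_mul.
  rewrite exchange_big /= expnSr.
  apply: (@leq_trans (\sum_(i < n) weight (nth [::] u i) * K)).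
    by apply: leq_sum => k _; rewrite -big_distrr leq_mul2l hB ?orbT.
  by rewrite -big_distrl leq_mul2r IH orbT.
rewrite /power_trace weight_flatten -map_comp sumn_iota /=.
apply: (@leq_trans (\sum_(i < n) K ^ d)); last by rewrite sum_nat_const card_ord.
apply: leq_sum => i _; apply: leq_trans (row i (ltn_ord i)).
by rewrite (bigD1 i) //= leq_addr.
Qed.

End Words.

(** Products never inspect letters. So the result of computing with codes of
  letters is the code of the result, although letters are taken from a type that
  depends on the number of generators. *)
Section Relabel.

Variables (L L' : Type) (f : L -> L').

Definition relabel T (a : seq (T * seq L)) : seq (T * seq L') :=
  [seq (t.1, map f t.2) | t <- a].

Lemma relabel_flatten T (s : seq (seq (T * seq L))) :
  relabel (flatten s) = flatten (map (@relabel T) s).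
Proof. exact: map_flatten. Qed.

Lemma relabel_mul (a b : comb L) :
  relabel (comb_mul a b) = comb_mul (relabel a) (relabel b).
Proof.
rewrite /relabel /comb_mul map_flatten -!map_comp; congr flatten.
apply: eq_map => t /=; rewrite -!map_comp; apply: eq_map => v /=.
by rewrite map_cat.
Qed.

Lemma nth_relabel T (u : seq (seq (T * seq L))) i :
  nth [::] (map (@relabel T) u) i = relabel (nth [::] u i).
Proof.
have [h|h] := ltnP i (size u); first by rewrite (nth_map [::]).
by rewrite !nth_default ?size_map.
Qed.

Lemma nth2_relabel T (B : seq (seq (seq (T * seq L)))) i j :
  nth [::] (nth [::] (map (map (@relabel T)) B) i) j = relabel (nth [::] (nth [::] B i) j).
Proof.
rewrite -nth_relabel; congr (nth _ _ j).
have [h|h] := ltnP i (size B); first by rewrite (nth_map [::]).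
by rewrite !nth_default ?size_map.
Qed.

Lemma relabel_power_trace n (B : seq (seq (comb L))) d :
  power_trace n (map (map (@relabel _)) B) d = relabel (power_trace n B d).
Proof.
have row i : power_row n (map (map (@relabel _)) B) d i =
    map (@relabel _) (power_row n B d i).
  rewrite /power_row; elim: d => [|d IH].
    by rewrite /= -map_comp; apply: eq_map => j /=; case: ifP.
  rewrite !iterS IH /vec_mul -map_comp; apply: eq_map => j /=.
  rewrite relabel_flatten -map_comp; congr flatten; apply: eq_map => k /=.
  by rewrite relabel_mul nth_relabel /entry nth2_relabel.
rewrite /power_trace relabel_flatten -map_comp; congr flatten.
by apply: eq_map => i; rewrite row nth_relabel.
Qed.

Lemma relabel_mx_of n (A : seq (seq (seq (nat * seq L)))) :
  mx_of n (map (map (@relabel _)) A) = map (map (@relabel _)) (mx_of n A).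
Proof.
rewrite /mx_of -map_comp; apply: eq_map => i /=; rewrite -map_comp; apply: eq_map => j /=.
by rewrite nth2_relabel /comb_of /relabel -!map_comp.
Qed.

Lemma relabel_scalar_sub n K (B : seq (seq (comb L))) :
  scalar_sub n K (map (map (@relabel _)) B) = map (map (@relabel _)) (scalar_sub n K B).
Proof.
rewrite /scalar_sub -map_comp; apply: eq_map => i /=; rewrite -map_comp; apply: eq_map => j /=.
rewrite /entry nth2_relabel [RHS]map_cat; congr (_ ++ _); first by case: ifP.
by rewrite /comb_opp /relabel -!map_comp.
Qed.

End Relabel.

Section Images.

Variables (G : groupType) (m : nat) (S : m.-tuple G).
Local Notation L := ('I_m * bool)%type.
Local Notation ZG := (group_ring int G).
Local Open Scope ring_scope.

Lemma word_eval_cat (v w : word m) : word_eval S (v ++ w) = (word_eval S v * word_eval S w)%g.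
Proof. by rewrite /word_eval big_cat. Qed.

Lemma gr_single_mul (K : nzRingType) (x y : K) (h k : G) :
  gr_single x h * gr_single y k = gr_single (x * y) (h * k)%g :> group_ring K G.
Proof.
apply: gr_ext => g; rewrite [LHS]gr_mulE gr_singleE.
rewrite (@gr_sum_supp _ _ _ [fset h]%fset (fun l => gr_coef (gr_single y k) (l^-1 * g)%g)).
  have e : (h^-1 * g == k)%g = (g == h * k)%g by exact: (can2_eq (mulVKg h) (mulKg h)).
  rewrite big_seq_fset1 !gr_singleE eqxx e.
  by case: ifP; rewrite ?mulr0.
by apply/fsubsetP => z; apply: contraLR => zN; rewrite memNfinsupp fsfunE (negPf zN).
Qed.

Lemma gr_coefD (K : nzRingType) (a b : group_ring K G) g :
  gr_coef (a + b) g = gr_coef a g + gr_coef b g.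
Proof. exact: gr_addE. Qed.

Lemma gr_coef0 (K : nzRingType) g : gr_coef (0 : group_ring K G) g = 0.
Proof. exact: gr_zeroE. Qed.

Lemma gr_coefN (K : nzRingType) (a : group_ring K G) g : gr_coef (- a) g = - gr_coef a g.
Proof. exact: gr_oppE. Qed.

Lemma gr_coef_big (K : nzRingType) I (r : seq I) P (F : I -> group_ring K G) g :
  gr_coef (\sum_(i <- r | P i) F i) g = \sum_(i <- r | P i) gr_coef (F i) g.
Proof. exact: (big_morph (fun a => gr_coef a g) (fun a b => gr_coefD a b g) (gr_coef0 K g)). Qed.

Lemma gr_coef1 (K : nzRingType) g : gr_coef (1 : group_ring K G) g = (g == 1%g)%:R.
Proof. by rewrite [LHS]gr_singleE; case: eqP. Qed.

Definition coef_val (p : nat * nat) : int := p.1%:Z - p.2%:Z.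

Definition comb_val (c : comb L) : ZG :=
  \sum_(t <- c) gr_single (coef_val t.1) (word_eval S t.2).

Lemma comb_val_cat c c' : comb_val (c ++ c') = comb_val c + comb_val c'.
Proof. by rewrite /comb_val big_cat. Qed.

Lemma comb_val_flatten (s : seq (comb L)) : comb_val (flatten s) = \sum_(c <- s) comb_val c.
Proof.
elim: s => [|c s IH]; first by rewrite /comb_val !big_nil.
by rewrite big_cons -IH /= comb_val_cat.
Qed.

Lemma comb_val_mul c c' : comb_val (comb_mul c c') = comb_val c * comb_val c'.
Proof.
rewrite /comb_mul comb_val_flatten big_map {2}/comb_val mulr_suml.
apply: eq_bigr => t _; rewrite /comb_val big_map mulr_sumr; apply: eq_bigr => v _ /=.
rewrite gr_single_mul word_eval_cat; congr gr_single.
by rewrite /coef_val /= !PoszD !PoszM; ring.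
Qed.

Lemma comb_val_opp c : comb_val (comb_opp c) = - comb_val c.
Proof.
rewrite /comb_val big_map raddf_sum /=; apply: eq_bigr => t _.
by apply: gr_ext => g; rewrite gr_coefN !gr_singleE /coef_val /=; case: eqP; rewrite ?oppr0 ?opprB.
Qed.

Lemma comb_val_one : comb_val (comb_one _) = 1.
Proof.
rewrite /comb_val big_seq1 /=; apply: gr_ext => g.
by rewrite gr_singleE gr_coef1 /word_eval big_nil; case: eqP.
Qed.

Definition mx_val n (B : seq (seq (comb L))) : 'M[ZG]_n := \matrix_(i, j) comb_val (entry B i j).

Lemma power_rowP n B d (i j : 'I_n) :
  comb_val (nth [::] (power_row n B d i) j) = (mx_val n B ^+ d) i j.
Proof.
rewrite /power_row; elim: d i j => [|d IH] i j.
  rewrite /= expr0 nth_mkiota // mxE.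
  case: eqP => [/val_inj ->|h]; first by rewrite eqxx comb_val_one.
  by case: eqP => [e|_]; [case: h; rewrite e|rewrite /comb_val big_nil].
rewrite iterS exprSr; change (mx_val n B ^+ d * mx_val n B) with (mx_val n B ^+ d *m mx_val n B).
rewrite mxE nth_mkiota // comb_val_flatten big_map.
rewrite -[n in iota 0 n]subn0 -/(index_iota 0 n) big_mkord.
by apply: eq_bigr => k _; rewrite comb_val_mul IH [X in _ = _ * X]mxE.
Qed.

(** The coefficient of the neutral element collects the words that represent it. *)
Lemma power_traceP n B d :
  gr_trace (mx_val n B ^+ d) = \sum_(t <- power_trace n B d)
    coef_val t.1 * (word_eval S t.2 == 1%g)%:R.
Proof.
transitivity (gr_coef (comb_val (power_trace n B d)) 1%g).
  rewrite /gr_trace -gr_coef_big /power_trace comb_val_flatten big_map.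
  rewrite -[n in iota 0 n]subn0 -/(index_iota 0 n) big_mkord.
  by congr gr_coef; apply: eq_bigr => i _; rewrite power_rowP.
rewrite /comb_val gr_coef_big; apply: eq_bigr => t _; rewrite gr_singleE eq_sym.
by case: eqP; rewrite ?mulr1 ?mulr0.
Qed.

Lemma gr_trace_bound n B d K :
  (forall i, (i < n)%N -> (\sum_(j < n) weight (entry B i j) <= K)%N) ->
  `|gr_trace (mx_val n B ^+ d)| <= (n * K ^ d)%:Z.
Proof.
move=> hB; rewrite power_traceP; apply: (@le_trans _ _ (weight (power_trace n B d))%:Z).
  rewrite /weight sumnE big_map; elim: (power_trace _ _ _) => [|t c IH].
    by rewrite !big_nil normr0.
  rewrite !big_cons PoszD; apply: le_trans (ler_normD _ _) _; apply: lerD => //.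
  by rewrite /coef_val; case: eqP => _; rewrite ?mulr1 ?mulr0; lia.
by rewrite lez_nat; apply: weight_power_trace.
Qed.

Lemma mx_val_scalar_sub n K B : mx_val n (scalar_sub n K B) = (K%:R)%:M - mx_val n B.
Proof.
apply/matrixP => i j; rewrite !mxE /entry !nth_mkiota // comb_val_cat comb_val_opp.
congr (_ - _); rewrite -val_eqE /=; case: eqP => _; last by rewrite /comb_val big_nil.
rewrite /comb_val big_seq1 /= mulr1n; apply: gr_ext => g.
rewrite gr_singleE /coef_val subr0 /word_eval big_nil -[K%:R]mulr_natl mulr1.
elim: K => [|K IH]; first by rewrite gr_coef0; case: ifP.
rewrite -natr1 gr_coefD gr_coef1 -IH; case: eqP => _ /=; last by rewrite addr0.
by rewrite -PoszD addn1.
Qed.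

Lemma int_partsE (z : int) : coef_val (int_parts (int_code z)) = z.
Proof.
case: z => k; rewrite /coef_val /int_parts /= ?odd_double ?doubleK /=; first by rewrite subr0.
by rewrite uphalf_double NegzE sub0r.
Qed.

End Images.

(** * The algorithm *)

Record input := Input {
  in_gens : nat;
  in_machine : nat * seq raw_instr;
  in_size : nat;
  in_mx : seq (seq (seq (nat * seq nat)));
  in_bound : nat * nat;
  in_prec : nat }.

Definition input_seq (x : input) : seq nat :=
  [:: in_gens x; code (in_machine x); in_size x; code (in_mx x); code (in_bound x); in_prec x].

#[local] Instance coded_input : coded input := fun x => code (input_seq x).

Lemma code_input x : code x = seq_code (input_seq x).
Proof. exact: code_nats. Qed.

(** The code of the matrix is at least the total weight of any of its rows, so
  that [n (code A) ^ p] bounds the moments ([trace_image_bound]). The factor 2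
  leaves only a null set of the spectrum above [radius], and the successor makes
  it positive. *)
Definition radius (x : input) : nat := (code (in_mx x)).+1.*2.

Definition depth (q k : nat) : nat := (q * 2 ^ (k + 3)).+1.

(** For [e = 2 ^ - depth q k] and [d = degree n K q k], both the mass of ]0, e]
  and [n (1 - e / K) ^ d] are at most [2 ^ - k.+2]. *)
Definition degree (n K q k : nat) : nat := n * K * 2 ^ (k + 2 + depth q k).

Definition in_degree x := degree (in_size x) (radius x) (in_bound x).1 (in_prec x).

Definition in_trace (x : input) : comb nat :=
  power_trace (in_size x) (scalar_sub (in_size x) (radius x) (mx_of (in_size x) (in_mx x)))
    (in_degree x).

Section Program.

Variable g : nat -> nat.
Local Notation cpt := (effective g).

Definition run_on (x : input) (t : nat) (w : seq nat) : raw_config :=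
  raw_run g (in_machine x) (code w) t.

Definition ready (x : input) (t : nat) : bool :=
  all (fun v => raw_halted g (in_machine x).2 (run_on x t v.2)) (in_trace x).

Definition total (x : input) (t : nat) : nat :=
  sumn [seq v.1.1 * raw_output (run_on x t v.2) | v <- in_trace x]
  - sumn [seq v.1.2 * raw_output (run_on x t v.2) | v <- in_trace x].

(** The quotient [T / D] is in a dyadic interval of length [2 ^ - k], whose
  midpoint is taken. Its numerator is odd, so that the fraction over [2 ^ k.+1]
  is reduced without computing a common divisor. *)
Definition rounded (T D k : nat) : nat := (T * 2 ^ k %/ D).*2.+1.

Definition result (x : input) (t : nat) : nat :=
  pair_code (rounded (total x t) (radius x ^ in_degree x) (in_prec x)).*2 (2 ^ (in_prec x).+1).

Section Words.

Context X (cX : coded X).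

Lemma cpt_comb_mul (a b : X -> comb nat) : cpt a -> cpt b ->
  cpt (fun x => comb_mul (a x) (b x)).
Proof. by move=> ha hb; rewrite /comb_mul; cpt. Qed.

Lemma cpt_comb_opp (a : X -> comb nat) : cpt a -> cpt (fun x => comb_opp (a x)).
Proof. by move=> ha; rewrite /comb_opp; cpt. Qed.

Lemma cpt_entry (B : X -> seq (seq (comb nat))) (i j : X -> nat) : cpt B -> cpt i -> cpt j ->
  cpt (fun x => entry (B x) (i x) (j x)).
Proof. by move=> hB hi hj; rewrite /entry; cpt. Qed.

Lemma cpt_comb_of (a : X -> seq (nat * seq nat)) : cpt a -> cpt (fun x => comb_of (a x)).
Proof. by move=> ha; rewrite /comb_of /int_parts; cpt. Qed.

End Words.

Hint Resolve cpt_comb_mul cpt_comb_opp cpt_entry cpt_comb_of : cpt.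

Lemma cpt_vec_mul X (cX : coded X) (n : X -> nat) u B : cpt n -> cpt u -> cpt B ->
  cpt (fun x => @vec_mul nat (n x) (u x) (B x)).
Proof. by move=> hn hu hB; rewrite /vec_mul; cpt. Qed.
Hint Resolve cpt_vec_mul : cpt.

Lemma cpt_power_trace X (cX : coded X) (n d : X -> nat) B : cpt n -> cpt d -> cpt B ->
  cpt (fun x => @power_trace nat (n x) (B x) (d x)).
Proof.
by move=> hn hd hB; rewrite /power_trace /power_row /unit_vec /comb_one; cpt.
Qed.
Hint Resolve cpt_power_trace : cpt.

Lemma cpt_scalar_sub X (cX : coded X) (n K : X -> nat) B : cpt n -> cpt K -> cpt B ->
  cpt (fun x => @scalar_sub nat (n x) (K x) (B x)).
Proof. by move=> hn hK hB; rewrite /scalar_sub; cpt. Qed.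
Hint Resolve cpt_scalar_sub : cpt.

Lemma cpt_mx_of X (cX : coded X) (n : X -> nat) A : cpt n -> cpt A ->
  cpt (fun x => @mx_of nat (n x) (A x)).
Proof. by move=> hn hK; rewrite /mx_of; cpt. Qed.
Hint Resolve cpt_mx_of : cpt.

Section Fields.

Context X (cX : coded X) (x : X -> input) (hx : cpt x).

Let hs : cpt (fun y => input_seq (x y)).
Proof. by apply: cpt_code hx _. Qed.

Lemma cpt_in_machine : cpt (fun y => in_machine (x y)).
Proof.
have e : cpt (fun y => nth 0 (input_seq (x y)) 1) by cpt.
exact: cpt_code e _.
Qed.

Lemma cpt_in_size : cpt (fun y => in_size (x y)).
Proof.
have e : cpt (fun y => nth 0 (input_seq (x y)) 2) by cpt.
exact: cpt_code e _.
Qed.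

Lemma cpt_in_mx : cpt (fun y => in_mx (x y)).
Proof.
have e : cpt (fun y => nth 0 (input_seq (x y)) 3) by cpt.
exact: cpt_code e _.
Qed.

Lemma cpt_in_bound : cpt (fun y => in_bound (x y)).
Proof.
have e : cpt (fun y => nth 0 (input_seq (x y)) 4) by cpt.
exact: cpt_code e _.
Qed.

Lemma cpt_in_prec : cpt (fun y => in_prec (x y)).
Proof.
have e : cpt (fun y => nth 0 (input_seq (x y)) 5) by cpt.
exact: cpt_code e _.
Qed.

End Fields.
Hint Resolve cpt_in_machine cpt_in_size cpt_in_mx cpt_in_bound cpt_in_prec : cpt.

Lemma cpt_radius X (cX : coded X) (x : X -> input) : cpt x -> cpt (fun y => radius (x y)).
Proof. by move=> hx; rewrite /radius; cpt. Qed.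
Hint Resolve cpt_radius : cpt.

Lemma cpt_in_degree X (cX : coded X) (x : X -> input) : cpt x -> cpt (fun y => in_degree (x y)).
Proof. by move=> hx; rewrite /in_degree /degree /depth; cpt. Qed.
Hint Resolve cpt_in_degree : cpt.

Lemma cpt_in_trace X (cX : coded X) (x : X -> input) : cpt x -> cpt (fun y => in_trace (x y)).
Proof. by move=> hx; rewrite /in_trace; cpt. Qed.
Hint Resolve cpt_in_trace : cpt.

Lemma cpt_ready : cpt (fun y => ready y.1 y.2).
Proof. by rewrite /ready /run_on; cpt. Qed.

Lemma cpt_result : cpt (fun y => result y.1 y.2).
Proof.
rewrite /result /rounded /total /run_on.
have e : cpt (fun y : input * nat => ((((sumn [seq v.1.1 * raw_output (raw_run g (in_machine y.1) (code v.2) y.2)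
           | v <- in_trace y.1] -
     sumn [seq v.1.2 * raw_output (raw_run g (in_machine y.1) (code v.2) y.2)
             | v <- in_trace y.1]) * 2 ^ in_prec y.1 %/ radius y.1 ^ in_degree y.1).*2.+1).*2,
     2 ^ (in_prec y.1).+1)) by cpt.
exact: cpt_code e _.
Qed.

End Program.

Section Inputs.

Variable m : nat.

Definition letter (l : 'I_m * bool) : nat := (nat_of_ord l.1).*2 + nat_of_bool l.2.

Definition words_mx n (A : 'M[word_comb m]_n) : seq (seq (seq (nat * word m))) :=
  [seq [seq [seq (int_code t.1, t.2) | t <- A i j] | j <- enum 'I_n] | i <- enum 'I_n].

Definition raw_mx n (A : 'M[word_comb m]_n) := map (map (@relabel _ _ letter nat)) (words_mx A).

Definition input_of W n (A : 'M[word_comb m]_n) (q : rat) (k : nat) : input :=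
  Input m (raw_of_machine W) n (raw_mx A) (int_code (numq q), absz (denq q)) k.

Lemma code_word (w : word m) : code (map letter w) = word_code w.
Proof. exact: code_nats. Qed.

Lemma code_raw_mx n (A : 'M[word_comb m]_n) : code (raw_mx A) = word_mx_code A.
Proof.
congr seq_code; rewrite /raw_mx /words_mx -!map_comp; apply: eq_map => i /=.
congr seq_code; rewrite -!map_comp; apply: eq_map => j /=.
congr seq_code; rewrite /relabel -!map_comp; apply: eq_map => t /=.
by congr pair_code; exact: code_word.
Qed.

Lemma code_input_of W n (A : 'M[word_comb m]_n) q k :
  code (input_of W A q k) = input_code W A q k.
Proof.
by rewrite code_input /input_seq /= code_raw_machine code_raw_mx.
Qed.

Lemma nth_words_mx n (A : 'M[word_comb m]_n) (i j : 'I_n) :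
  nth [::] (nth [::] (words_mx A) i) j = [seq (int_code t.1, t.2) | t <- A i j].
Proof.
rewrite /words_mx (nth_map i) ?size_enum_ord // nth_ord_enum.
by rewrite (nth_map j) ?size_enum_ord // nth_ord_enum.
Qed.

Lemma mx_val_words (G : groupType) (S : m.-tuple G) n (A : 'M[word_comb m]_n) :
  mx_val S n (mx_of n (words_mx A)) = word_mx_image S A.
Proof.
apply/matrixP => i j; rewrite !mxE /entry /mx_of !nth_mkiota // nth_words_mx.
by rewrite /comb_val /comb_of !big_map; apply: eq_bigr => t _; rewrite int_partsE.
Qed.

Lemma leq_pair_code x y : x + y <= pair_code x y.
Proof. by rewrite pair_codeE leq_add2r binS bin1 (leq_trans (leq_addr y x) (leq_addl _ _)). Qed.

Lemma sumn_seq_code (s : seq nat) : sumn s <= seq_code s.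
Proof.
elim: s => //= x s IH; apply: leqW; apply: leq_trans (leq_pair_code _ _).
by rewrite leq_add2l.
Qed.

Lemma leq_sumn_map T (F F' : T -> nat) s : (forall x, F x <= F' x) ->
  sumn (map F s) <= sumn (map F' s).
Proof. by move=> h; elim: s => //= x s IH; apply: leq_add. Qed.

Lemma weight_comb_of (a : seq (nat * word m)) : weight (comb_of a) <= sumn [seq t.1 | t <- a].
Proof.
rewrite /weight /comb_of -map_comp; apply: leq_sumn_map => t /=; rewrite /int_parts.
have := odd_double_half t.1; move: (half _) (odd _) => h [] <- /=; lia.
Qed.

Lemma weight_words_mx n (A : 'M[word_comb m]_n) i : i < n ->
  \sum_(j < n) weight (entry (mx_of n (words_mx A)) i j) <= code (raw_mx A).
Proof.
move=> hi; pose i' := Ordinal hi.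
pose row := [seq word_comb_code (A i' j) | j <- enum 'I_n].
apply: (@leq_trans (seq_code row)); last first.
  rewrite code_raw_mx; apply: leq_trans (sumn_seq_code _).
  rewrite sumnE big_map big_enum /=.
  by rewrite (bigD1 i') //= leq_addr.
apply: leq_trans (sumn_seq_code _); rewrite sumnE big_map big_enum /=.
apply: leq_sum => j _.
rewrite /entry /mx_of !nth_mkiota // (nth_words_mx A i' j).
apply: leq_trans (weight_comb_of _) _; apply: leq_trans (sumn_seq_code _).
rewrite -map_comp; apply: leq_sumn_map => t /=.
by apply: leq_trans (leq_pair_code _ _); rewrite leq_addr.
Qed.

Lemma trace_image_bound (G : groupType) (S : m.-tuple G) n (A : 'M[word_comb m]_n) d :
  (`|gr_trace (word_mx_image S A ^+ d)| <= (n * (code (raw_mx A)) ^ d)%:Z)%R.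
Proof. by rewrite -mx_val_words; apply: gr_trace_bound; exact: weight_words_mx. Qed.

Section Correct.

Variables (g : nat -> nat) (G : groupType) (S : m.-tuple G) (W : oracle_machine).
Variables (n : nat) (A : 'M[word_comb m]_n) (q : rat) (k : nat).
Hypothesis hW : solves_word_problem g W S.

Let x := input_of W A q k.

Let words_trace : comb ('I_m * bool) :=
  power_trace n (scalar_sub n (radius x) (mx_of n (words_mx A))) (in_degree x).

Let in_traceE : in_trace x = relabel letter words_trace.
Proof. by rewrite /in_trace /= relabel_mx_of relabel_scalar_sub relabel_power_trace. Qed.

Lemma ex_ready : exists t, ready g x t.
Proof.
(* For the induction all later times have to be good as well. *)
suff [t0 h0] : exists t0, forall t, t0 <= t -> ready g x t by exists t0; apply: h0.
rewrite /ready in_traceE; elim: words_trace => [|v c [t0 h0]]; first by exists 0.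
have [[t1 h1] _] := raw_runP (hW v.2); exists (maxn t0 t1) => t.
rewrite geq_max => /andP[l0 l1] /=; rewrite h0 // andbT.
by rewrite /run_on code_word h1.
Qed.

(** The truncated difference is the true one, as the trace is nonnegative. *)
Lemma total_trace t : ready g x t ->
  (0 <= gr_trace (((radius x)%:R%:M - word_mx_image S A) ^+ in_degree x))%R ->
  Posz (total g x t) = gr_trace (((radius x)%:R%:M - word_mx_image S A) ^+ in_degree x)%R.
Proof.
rewrite -mx_val_words -mx_val_scalar_sub power_traceP -/words_trace.
rewrite /total /ready in_traceE /relabel all_map -!map_comp => hr.
have outE v : raw_halted g (raw_of_machine W).2 (run_on g x t (map letter v.2)) ->
    raw_output (run_on g x t (map letter v.2)) = (word_eval S v.2 == 1%g).
  by rewrite /run_on code_word => /(raw_runP (hW v.2)).2.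
have h : (\sum_(v <- words_trace) coef_val v.1 * (word_eval S v.2 == 1%g)%:R
    = (sumn [seq v.1.1 * raw_output (run_on g x t (map letter v.2)) | v <- words_trace])%:Z
    - (sumn [seq v.1.2 * raw_output (run_on g x t (map letter v.2)) | v <- words_trace])%:Z)%R.
  elim: words_trace hr => [|v c IH] /=; first by rewrite big_nil.
  move=> /andP[/outE hv /IH hc]; rewrite big_cons hc hv /coef_val.
  by rewrite !PoszD !PoszM; case: eqP => _ /=; ring.
by rewrite h subr_ge0 lez_nat => h0; apply/esym; exact: subzn.
Qed.

End Correct.

End Inputs.

(** * Unconditional sums *)

Section Sums.

Local Open Scope classical_set_scope.
Local Open Scope ring_scope.
Variables (R : realType) (G : groupType).
Implicit Types (f h : G -> R) (Z : {fset G}).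

Local Notation esumT f := (\esum_(x in [set: G]) (f x)%:E)%E.

Lemma esumT_ge f Z : (forall x, 0 <= f x) -> ((\sum_(x <- Z) f x)%:E <= esumT f)%E.
Proof.
move=> f0; apply: esum_ge; exists [set` Z]; first by split.
by rewrite fsbig_finite //= set_fsetK -sumEFin.
Qed.

Lemma esumT_le f c : (forall Z, \sum_(x <- Z) f x <= c) -> (esumT f <= c%:E)%E.
Proof.
move=> h; apply: ge_ereal_sup => _ [A [finA _] <-].
by rewrite fsbig_finite //= sumEFin lee_fin.
Qed.

Definition summ f := (esumT (fun x => `|f x|) < +oo)%E.

Lemma esumT_fin f : (forall x, 0 <= f x) -> summ f -> esumT f \is a fin_num.
Proof.
move=> f0 sf; rewrite ge0_fin_numE; last by apply: esum_ge0 => x _; rewrite lee_fin.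
by apply: le_lt_trans sf; apply: le_esum => x _; rewrite lee_fin ler_norm.
Qed.

Lemma le_summ f h : (forall x, `|f x| <= `|h x|) -> summ h -> summ f.
Proof.
move=> fh; apply: le_lt_trans; apply: le_esum => x _.
by rewrite lee_fin.
Qed.

Lemma summD f h : summ f -> summ h -> summ (fun x => f x + h x).
Proof.
move=> sf sh; apply: le_lt_trans (lte_add_pinfty sf sh).
rewrite -esumD; [|by move=> *; rewrite lee_fin..].
by apply: le_esum => x _; rewrite -EFinD lee_fin ler_normD.
Qed.

Lemma summN f : summ f -> summ (fun x => - f x).
Proof. by apply: le_summ => x; rewrite normrN. Qed.

Definition pos_part f x := Num.max (f x) 0.

Lemma pos_part_ge0 f x : 0 <= pos_part f x.
Proof. by rewrite /pos_part le_max lexx orbT. Qed.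

Lemma pos_partB f x : pos_part f x - pos_part (fun y => - f y) x = f x.
Proof. by rewrite /pos_part; case: (leP (f x) 0); case: (leP (- f x) 0); lra. Qed.

Lemma summ_pos_part f : summ f -> summ (pos_part f).
Proof.
apply: le_summ => x; rewrite ger0_norm ?pos_part_ge0 // /pos_part ge_max normr_ge0.
by rewrite ler_norm.
Qed.

Lemma real_sumE f : real_sum f = fine (esumT (pos_part f)) - fine (esumT (pos_part (fun x => - f x))).
Proof. by []. Qed.

(** Any decomposition into nonnegative summable parts will do, not just the one
  into positive and negative part; this makes the sum additive. *)
Lemma real_sum_decomp f h : (forall x, 0 <= f x) -> (forall x, 0 <= h x) ->
  summ f -> summ h ->
  real_sum (fun x => f x - h x) = fine (esumT f) - fine (esumT h).
Proof.
move=> f0 h0 sf sh; rewrite -fineB ?esumT_fin //.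
rewrite -(@esumB R G [set: G] (fun x => (f x)%:E) (fun x => (h x)%:E)) //;
  try by move=> *; rewrite lee_fin.
have sb : summ (fun x => f x - h x) by apply: summD => //; apply: summN.
rewrite real_sumE -fineB ?esumT_fin //; try exact: pos_part_ge0;
  try by apply: summ_pos_part => //; apply: summN.
by congr fine; congr (_ - _)%E; apply: eq_esum => x _;
  rewrite ?funeposE ?funenegE /pos_part EFin_max.
Qed.

Lemma real_sumB f h : summ f -> summ h ->
  real_sum (fun x => f x - h x) = real_sum f - real_sum h.
Proof.
move=> sf sh; pose nf x := - f x; pose nh x := - h x.
have [snf snh] : summ nf /\ summ nh by split; apply: summN.
have -> : (fun x => f x - h x) = (fun x => (pos_part f x + pos_part nh x) -
    (pos_part nf x + pos_part h x)).
  by apply/funext => x; rewrite -(pos_partB f) -(pos_partB h) /nf /nh; ring.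
rewrite real_sum_decomp; try by [move=> x; rewrite addr_ge0 ?pos_part_ge0
  | apply: summD; apply: summ_pos_part].
have D u v : summ u -> summ v -> fine (esumT (fun x => pos_part u x + pos_part v x)) =
    fine (esumT (pos_part u)) + fine (esumT (pos_part v)).
  move=> su sv; rewrite -fineD ?esumT_fin //; try exact: pos_part_ge0; try exact: summ_pos_part.
  by rewrite -esumD // => x _; rewrite lee_fin pos_part_ge0.
by rewrite (D f nh) // (D nf h) // opprD addrACA (real_sumE h) opprB.
Qed.

Lemma real_sumN f : real_sum (fun x => - f x) = - real_sum f.
Proof.
rewrite !real_sumE opprB; congr (_ - fine (esum _ _)).
by apply/funext => x; rewrite /pos_part opprK.
Qed.

Lemma real_sum_bound f c : (forall Z, \sum_(x <- Z) `|f x| <= c) -> summ f /\ `|real_sum f| <= c.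
Proof.
move=> h; have hc := esumT_le h.
have sf : summ f by apply: le_lt_trans hc (ltry _).
split=> //; rewrite real_sumE.
have bd (u : G -> R) : (forall x, `|u x| = `|f x|) -> 0 <= fine (esumT (pos_part u)) <= c.
  move=> uf; rewrite fine_ge0 /=; last by apply: esum_ge0 => x _; rewrite lee_fin pos_part_ge0.
  rewrite -lee_fin fineK; last first.
    apply: esumT_fin; first exact: pos_part_ge0.
    by apply: summ_pos_part; apply: le_summ sf => x; rewrite uf.
  apply: le_trans hc; apply: le_esum => x _; rewrite lee_fin -uf /pos_part ge_max normr_ge0.
  by rewrite ler_norm.
have := bd f (fun=> erefl); have := bd (fun x => - f x) (fun x => normrN _).
by rewrite ler_norml => /andP[? ?] /andP[? ?]; apply/andP; split; lra.
Qed.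

Lemma real_sum_fin f Z : (forall x, x \notin Z -> f x = 0) ->
  summ f /\ real_sum f = \sum_(x <- Z) f x.
Proof.
move=> f0.
have fin (u : G -> R) : (forall x, 0 <= u x) -> (forall x, x \notin Z -> u x = 0) ->
    esumT u = (\sum_(x <- Z) u x)%:E.
  move=> u0 uZ; apply/eqP; rewrite eq_le (esumT_ge Z u0) andbT; apply: esumT_le => Z'.
  apply: (@le_trans _ _ (\sum_(x <- (Z `|` Z')%fset) u x)).
    rewrite [leRHS](big_fsetID _ (mem Z')) /=.
    have -> : [fset x in (Z `|` Z')%fset | x \in Z']%fset = Z'.
      by apply/fsetP => x; rewrite !inE; case: (x \in Z'); rewrite ?orbT ?andbF.
    by rewrite lerDl sumr_ge0.
  by rewrite -(big_fset_incl _ (fsubsetUl Z Z')) // => x _ /uZ.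
have z (u : G -> R) : (forall x, `|u x| = `|f x|) -> forall x, x \notin Z -> pos_part u x = 0.
  by move=> uf x /f0 fx; rewrite /pos_part (_ : u x = 0) ?maxxx //; apply/eqP; rewrite -normr_eq0 uf fx normr0.
split.
  by rewrite /summ fin // ?ltry // => x /f0 ->; rewrite normr0.
rewrite real_sumE !fin /=; try exact: pos_part_ge0; try by apply: z => // x; rewrite normrN.
by rewrite -sumrB; apply: eq_bigr => x _; rewrite pos_partB.
Qed.

End Sums.

(** * The projection onto the kernel *)

Section Adjoint.

Local Open Scope ring_scope.
Variable (G : groupType).
Local Notation ZG := (group_ring int G).

Lemma gr_decomp (a : ZG) : a = \sum_(h <- gr_supp a) gr_single (gr_coef a h) h.
Proof.
apply: gr_ext => g; rewrite gr_coef_big [LHS]gr_coef_sum.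
by apply: eq_bigr => h _; rewrite gr_singleE eq_sym.
Qed.

Lemma gr_star_sum I (r : seq I) (F : I -> ZG) :
  gr_star (\sum_(i <- r) F i) = \sum_(i <- r) gr_star (F i).
Proof.
apply: gr_ext => g; rewrite gr_starE !gr_coef_big.
by apply: eq_bigr => i _; rewrite gr_starE.
Qed.

Lemma gr_star_single (x : int) h : gr_star (gr_single x h) = gr_single x h^-1%g :> ZG.
Proof. by apply: gr_ext => g; rewrite gr_starE !gr_singleE (can2_eq invgK invgK). Qed.

(** Both sides are biadditive, so it is enough to compare them on single terms. *)
Lemma gr_starM (a b : ZG) : gr_star (a * b) = gr_star b * gr_star a.
Proof.
rewrite (gr_decomp a) (gr_decomp b) !gr_star_sum mulr_suml gr_star_sum mulr_sumr.
apply: eq_bigr => h _; rewrite mulr_sumr gr_star_sum mulr_suml; apply: eq_bigr => k _.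
by rewrite gr_single_mul !gr_star_single gr_single_mul mulrC invgM.
Qed.

Lemma gr_star1 : gr_star (1 : ZG) = 1.
Proof. by rewrite [LHS]gr_star_single invg1. Qed.

Lemma mx_star_pow n (A : 'M[ZG]_n) d : mx_star A = A -> mx_star (A ^+ d) = A ^+ d.
Proof.
move=> hA; have hA' i j : gr_star (A i j) = A j i by rewrite -[in RHS]hA !mxE.
suff h d' i j : gr_star ((A ^+ d') i j) = (A ^+ d') j i.
  by apply/matrixP => i j; rewrite !mxE h.
elim: d' i j => [|d' IH] i j.
  rewrite !expr0 !mxE eq_sym; case: (j == i); first exact: gr_star1.
  by apply: gr_ext => g; rewrite gr_starE !gr_coef0.
rewrite [in LHS]exprSr [in RHS]exprS.
change (gr_star ((A ^+ d' *m A) i j) = (A *m A ^+ d') j i).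
rewrite !mxE gr_star_sum; apply: eq_bigr => k _.
by rewrite gr_starM hA' IH.
Qed.

Lemma gr_mul_star (a b : ZG) (Z : {fset G}) : (gr_supp a `<=` Z)%fset ->
  gr_coef (a * gr_star b) 1%g = \sum_(g <- Z) gr_coef a g * gr_coef b g.
Proof.
move=> aZ; rewrite [LHS]gr_mulE (gr_sum_supp (fun h => gr_coef (gr_star b) (h^-1 * 1)%g) aZ).
by apply: eq_bigr => h _; rewrite gr_starE mulg1 invgK.
Qed.

End Adjoint.

Section Translation.

Local Open Scope ring_scope.
Variables (R : realType) (G : groupType).
Local Notation ZG := (group_ring int G).
Implicit Types (x y : ZG) (f : G -> R).

Lemma gr_mulE_right (x y : ZG) g : gr_coef (x * y) g =
  \sum_(h <- gr_supp y) gr_coef x (g * h^-1)%g * gr_coef y h.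
Proof.
rewrite {1}(gr_decomp y) mulr_sumr gr_coef_big; apply: eq_bigr => h _.
rewrite [LHS]gr_mulE [in RHS]gr_coef_sum mulr_suml; apply: eq_bigr => k _.
rewrite gr_singleE.
have -> : (k^-1 * g == h)%g = (k == g * h^-1)%g.
  by rewrite (can2_eq (mulVKg k) (mulKg k)) eq_sym (can2_eq (mulgK h) (mulgVK h)).
by case: ifP; rewrite ?mulr0 ?mul0r.
Qed.

(** Translating by [h], where [right_mul] translates by its inverse, makes this
  an action of the ring from the left ([translate_sumM]). *)
Definition translate_sum x f g : R := \sum_(h <- gr_supp x) (gr_coef x h)%:~R * f (g * h)%g.

Lemma translate_sum_fset x f g (Z : {fset G}) : (gr_supp x `<=` Z)%fset ->
  translate_sum x f g = \sum_(h <- Z) (gr_coef x h)%:~R * f (g * h)%g.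
Proof.
by move=> xZ; apply: big_fset_incl => // h _ /gr_coef_out ->; rewrite mul0r.
Qed.

Lemma translate_sum0 f g : translate_sum 0 f g = 0.
Proof. by rewrite /translate_sum big1 // => h _; rewrite gr_coef0 mul0r. Qed.

Lemma translate_sumD x y f g : translate_sum (x + y) f g = translate_sum x f g + translate_sum y f g.
Proof.
pose Z := (gr_supp (x + y)%R `|` (gr_supp x `|` gr_supp y))%fset.
rewrite !(@translate_sum_fset _ _ _ Z) /Z ?fsubsetUl //.
- by rewrite -big_split /=; apply: eq_bigr => h _; rewrite gr_coefD rmorphD mulrDl.
- by rewrite fsetUA; exact: fsubsetUr.
- by rewrite fsetUCA; exact: fsubsetUl.
Qed.

Lemma translate_sumN x f g : translate_sum (- x) f g = - translate_sum x f g.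
Proof.
by apply/eqP; rewrite -addr_eq0 -translate_sumD addNr translate_sum0.
Qed.

Lemma translate_sum_big I (r : seq I) (F : I -> ZG) f g :
  translate_sum (\sum_(i <- r) F i) f g = \sum_(i <- r) translate_sum (F i) f g.
Proof.
exact: (big_morph (fun x => translate_sum x f g) (fun x y => translate_sumD x y f g)
  (translate_sum0 f g)).
Qed.

Lemma translate_sum_single z h f g : translate_sum (gr_single z h) f g = z%:~R * f (g * h)%g.
Proof.
rewrite (@translate_sum_fset _ _ _ [fset h]%fset) ?big_seq_fset1 ?gr_singleE ?eqxx //.
by apply/fsubsetP => k; apply: contraLR => kN; rewrite memNfinsupp fsfunE (negPf kN).
Qed.

Lemma translate_sumM x y f g :
  translate_sum (x * y) f g = translate_sum x (translate_sum y f) g.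
Proof.
rewrite {1}(gr_decomp x) {1}(gr_decomp y) mulr_suml translate_sum_big.
apply: eq_bigr => h _; rewrite mulr_sumr translate_sum_big mulr_sumr.
apply: eq_bigr => k _; rewrite gr_single_mul translate_sum_single rmorphM mulgA.
by rewrite mulrA.
Qed.

Lemma translate_sum_star x f g :
  translate_sum (gr_star x) f g = \sum_(h <- gr_supp x) f (g * h^-1)%g * (gr_coef x h)%:~R.
Proof.
rewrite {1}(gr_decomp x) gr_star_sum translate_sum_big; apply: eq_bigr => h _.
by rewrite gr_star_single translate_sum_single mulrC.
Qed.

Lemma translate_sumZ x f g (b : R) : translate_sum x (fun h => b * f h) g = b * translate_sum x f g.
Proof. by rewrite /translate_sum mulr_sumr; apply: eq_bigr => h _; rewrite mulrCA. Qed.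

Lemma translate_sum_natr k f g : translate_sum k%:R f g = k%:R * f g.
Proof.
elim: k => [|k IH]; first by rewrite translate_sum0 mul0r.
rewrite -natr1 translate_sumD IH -[k.+1%:R]natr1 mulrDl mul1r; congr (_ + _).
by rewrite [LHS]translate_sum_single mul1r mulg1.
Qed.

End Translation.

Section Projection.

Local Open Scope classical_set_scope.
Local Open Scope ring_scope.
Variables (R : realType) (G : groupType) (n : nat).
Local Notation ZG := (group_ring int G).
Variables (X : 'M[ZG]_n) (K : nat).
Hypotheses (K_gt0 : (0 < K)%N) (X_star : self_adjoint X).

Let B : 'M[ZG]_n := (K%:R)%:M - X.

Let B_star : mx_star B = B.
Proof.
apply/matrixP => i j; have := congr1 (fun M : 'M[ZG]_n => M i j) X_star; rewrite !mxE => e.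
rewrite -e; apply: gr_ext => g; rewrite gr_starE !gr_coefD !gr_coefN gr_starE; congr (_ - _).
rewrite eq_sym; case: eqP => _; last by rewrite !gr_coef0.
rewrite !mulr1n; elim: K => [|k IH]; first by rewrite !gr_coef0.
by rewrite -natr1 !gr_coefD IH !gr_coef1 (can2_eq invgK invgK) invg1.
Qed.

Let C d : 'M[ZG]_n := B ^+ d.

Let C_star d i j : gr_star (C d i j) = C d j i.
Proof.
have := congr1 (fun M : 'M[ZG]_n => M j i) (mx_star_pow d B_star).
by rewrite !mxE.
Qed.

Let c d i j g : R := (gr_coef (C d i j) g)%:~R / K%:R ^+ d.

(** The integral of [(1 - x / K) ^ d] against the spectral measure, whenever the
  latter exists. *)
Definition scaled_trace d : R := (gr_trace (B ^+ d))%:~R / K%:R ^+ d.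
Local Notation a := scaled_trace.

Let a_sum d : a d = \sum_i c d i i 1%g.
Proof. by rewrite /a /gr_trace rmorph_sum mulr_suml. Qed.

Let supp d : {fset G} :=
  (\bigcup_(ij in predT : pred ('I_n * 'I_n)) gr_supp (C d ij.1 ij.2))%fset.

Let supp_sub d i j : (gr_supp (C d i j) `<=` supp d)%fset.
Proof. by apply: (@bigfcup_sup _ _ _ (i, j) _ (fun ij => gr_supp (C d ij.1 ij.2))); rewrite ?mem_index_enum. Qed.

Let KR_neq0 : K%:R != 0 :> R.
Proof. by rewrite pnatr_eq0 -lt0n. Qed.

(** The function [c d i] is the vector [(1 - X / K) ^ d e_i]. Inner products of
  such vectors sum to traces because [1 - X / K] is self-adjoint. *)
Let pairing d d' (Z : {fset G}) : (supp d `<=` Z)%fset ->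
  \sum_i \sum_j \sum_(g <- Z) c d i j g * c d' i j g = a (d + d').
Proof.
move=> dZ; rewrite /a exprD /gr_trace rmorph_sum mulr_suml; apply: eq_bigr => i _.
change (B ^+ d * B ^+ d') with (C d *m C d').
rewrite mxE gr_coef_big rmorph_sum mulr_suml; apply: eq_bigr => j _ /=.
rewrite -[C d' j i]C_star (gr_mul_star _ (fsubset_trans (supp_sub d i j) dZ)) rmorph_sum mulr_suml.
apply: eq_bigr => g _; rewrite /c rmorphM exprD invfM; ring.
Qed.

Hypotheses (a_ge0 : forall d, 0 <= a d) (a_dec : forall d, a d.+1 <= a d).

Let a_mono d d' : (d <= d')%N -> a d' <= a d.
Proof.
move=> h; rewrite -(subnKC h); elim: (d' - d)%N => [|e IH]; first by rewrite addn0.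
by apply: le_trans IH; rewrite addnS.
Qed.

Let sq (Z : {fset G}) (u : 'I_n -> 'I_n -> G -> R) := \sum_i \sum_j \sum_(g <- Z) u i j g ^+ 2.

Let sq_sub (Z Z' : {fset G}) u : (Z `<=` Z')%fset -> sq Z u <= sq Z' u.
Proof.
move=> ZZ; apply: ler_sum => i _; apply: ler_sum => j _.
rewrite (big_fsetID _ (mem Z) Z') /=.
have -> : [fset x in Z' | x \in Z]%fset = Z.
  by apply/fsetP => x; rewrite !inE andbC; case: (boolP (x \in Z)) => //= /(fsubsetP ZZ).
by rewrite lerDl sumr_ge0 // => *; exact: sqr_ge0.
Qed.

Let c_sq Z d : sq Z (c d) <= a (d + d).
Proof.
apply: le_trans (sq_sub _ (fsubsetUr (supp d) Z)) _.
by rewrite -(@pairing d d _ (fsubsetUl (supp d) Z)).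
Qed.

(** The square expands to [a (2 d) - 2 a (d + d') + a (2 d')], and [a] is
  nonincreasing. *)
Let c_dist Z d d' : (d <= d')%N ->
  sq Z (fun i j g => c d i j g - c d' i j g) <= a (d + d) - a (d' + d').
Proof.
move=> dd; apply: (@le_trans _ _ (a (d + d) - a (d + d') *+ 2 + a (d' + d'))); last first.
  have := @a_mono (d + d') (d' + d'); rewrite leq_add2r dd => /(_ isT); lra.
pose Z1 := (supp d `|` supp d' `|` Z)%fset.
apply: le_trans (sq_sub _ (fsubsetUr (supp d `|` supp d')%fset Z)) _.
have h : (supp d `<=` Z1)%fset by rewrite /Z1 -fsetUA fsubsetUl.
have h' : (supp d' `<=` Z1)%fset.
  by rewrite /Z1 -fsetUA; apply: fsubset_trans (fsubsetUr _ _); exact: fsubsetUl.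
rewrite -(pairing d h) -(pairing d' h) -(pairing d' h') -/Z1 -sumrMnl -sumrB -big_split /=.
apply: ler_sum => i _; rewrite -sumrMnl -sumrB -big_split /=.
apply: ler_sum => j _; rewrite -sumrMnl -sumrB -big_split /=.
apply: ler_sum => g _; rewrite le_eqVlt; apply/orP; left; apply/eqP; ring.
Qed.

Let le_sq Z u i j g : g \in Z -> u i j g ^+ 2 <= sq Z u.
Proof.
move=> gZ; rewrite /sq (bigD1 i) //= (bigD1 j) //= (bigD1_seq g) ?fset_uniq //=.
rewrite -!addrA lerDl !addr_ge0 ?sumr_ge0 // => *; rewrite ?sumr_ge0 // => *;
  rewrite ?sumr_ge0 // => *; exact: sqr_ge0.
Qed.

Lemma scaled_trace_cvg : cvgn a.
Proof.
apply: nonincreasing_is_cvgn; first exact/nonincreasing_seqP.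
by exists 0 => _ [d _ <-].
Qed.

Let l := limn a.

Let l_le d : l <= a d.
Proof. apply: nonincreasing_cvgn_ge scaled_trace_cvg d; exact/nonincreasing_seqP. Qed.

Let a_small e : 0 < e -> exists N, forall d, (N <= d)%N -> a d - l < e.
Proof.
move=> e0; have /cvgrPdist_lt /(_ e e0) [N _ hN] := scaled_trace_cvg.
by exists N => d /hN /=; rewrite distrC ger0_norm // subr_ge0.
Qed.

Let c_cvg i j g : cvgn (fun d => c d i j g).
Proof.
apply: cauchy_cvg; apply: cauchy_exP => e e0.
have [N hN] := a_small (exprn_gt0 2 e0).
exists (c N i j g); exists N => // d /= Nd; rewrite /ball /=.
rewrite -(@ltr_pXn2r _ 2) ?nnegrE ?normr_ge0 ?ltW // real_normK ?num_real //.
apply: le_lt_trans (hN (N + N)%N (leq_addr _ _)).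
apply: le_trans (@le_sq [fset g]%fset (fun i j g => c N i j g - c d i j g) i j g _) _.
  by rewrite inE.
apply: le_trans (c_dist _ Nd) _.
by rewrite lerD2l lerN2.
Qed.

Let p i j g : R := limn (fun d => c d i j g).

Let cvg_fset (I : Type) (r : seq I) (u : I -> nat -> R) (v : I -> R) :
  (forall i, u i @ \oo --> v i) ->
  (fun d => \sum_(i <- r) u i d) @ \oo --> \sum_(i <- r) v i.
Proof.
move=> h; elim: r => [|i r IH].
  by rewrite big_nil; under eq_fun do rewrite big_nil; apply: cvg_cst.
rewrite big_cons; under eq_fun do rewrite big_cons.
exact: cvgD.
Qed.

Let p_sq Z : sq Z p <= a 0%N.
Proof.
have h : (fun d => sq Z (c d)) @ \oo --> sq Z p.
  by do 3! (apply: cvg_fset => ?); apply: cvgM; exact: c_cvg.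
apply: cvgr_to_le h _; apply: nearW => d.
by apply: le_trans (c_sq _ _) _; exact: a_mono.
Qed.

Let p_dist Z d : sq Z (fun i j g => c d i j g - p i j g) <= a (d + d) - l.
Proof.
have h : (fun d' => sq Z (fun i j g => c d i j g - c d' i j g)) @ \oo -->
    sq Z (fun i j g => c d i j g - p i j g).
  do 3! (apply: cvg_fset => ?).
  by apply: cvgM; (apply: cvgB; [exact: cvg_cst|exact: c_cvg]).
apply: cvgr_to_le h _; exists d => // d' /= dd.
by apply: le_trans (c_dist _ dd) _; rewrite lerD2l lerN2.
Qed.

Let l_sum : l = \sum_i p i i 1%g.
Proof.
apply/cvg_lim => //; rewrite (_ : a = fun d => \sum_i c d i i 1%g); last exact/funext.
by apply: cvg_fset => i; exact: c_cvg.
Qed.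

Let real_mul (u : 'I_n -> G -> R) j g : R :=
  \sum_i \sum_(h <- gr_supp (X i j)) u i (g * h^-1)%g * (gr_coef (X i j) h)%:~R.

(** With [T = 1 - X / K], multiplying [T ^ d e_i] by [X] gives
  [K (T ^ d e_i - T ^ d.+1 e_i)], and both terms have the same limit. *)
Let p_ker i j g : real_mul (p i) j g = 0.
Proof.
have e d : real_mul (c d i) j g = K%:R * (c d i j g - c d.+1 i j g).
  have XE : X = (K%:R)%:M - B by rewrite /B opprB addrC subrK.
  have CX : gr_coef ((C d *m X) i j) g = K%:R * gr_coef (C d i j) g - gr_coef (C d.+1 i j) g.
    have -> : C d *m X = C d *m (K%:R)%:M - C d.+1 by rewrite XE mulmxBr /C exprSr.
    have mxB (P Q : 'M[ZG]_n) : (P - Q) i j = P i j - Q i j by rewrite !mxE.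
    rewrite mxB gr_coefD gr_coefN; congr (_ - _).
    rewrite mxE (bigD1 j) //= mxE eqxx mulr1n big1 ?addr0 => [|k /negPf kj].
      elim: K => [|k IH]; first by rewrite mulr0 mul0r gr_coef0.
      by rewrite -!natr1 mulrDr mulrDl gr_coefD IH mulr1 mul1r.
    by rewrite mxE kj mulr0n mulr0.
  rewrite /real_mul; transitivity ((gr_coef ((C d *m X) i j) g)%:~R / K%:R ^+ d : R).
    rewrite mxE gr_coef_big rmorph_sum mulr_suml; apply: eq_bigr => k _ /=.
    rewrite gr_mulE_right rmorph_sum mulr_suml; apply: eq_bigr => h _.
    by rewrite /c rmorphM mulrAC.
  rewrite CX rmorphB rmorphM /= /c exprS invfM rmorph_nat; field.
  by rewrite KR_neq0 expf_neq0.
have lim1 : (fun d => real_mul (c d i) j g) @ \oo --> real_mul (p i) j g.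
  apply: cvg_fset => k; apply: cvg_fset => h; apply: cvgM; [exact: c_cvg|exact: cvg_cst].
apply: (cvg_unique _ lim1) => //.
have -> : (fun d => real_mul (c d i) j g) = (fun d => K%:R * (c d i j g - c d.+1 i j g)).
  exact/funext.
have -> : 0 = K%:R * (p i j g - p i j g) by rewrite subrr mulr0.
apply: cvgM; first exact: cvg_cst.
apply: cvgB; first exact: c_cvg.
have := c_cvg (i:=i) (j:=j) (g:=g); rewrite -(cvg_shiftS (fun d => c d i j g)); exact.
Qed.

Let mx_translate (M : 'M[ZG]_n) (r : 'I_n -> G -> R) i g : R :=
  \sum_j translate_sum (M i j) (r j) g.

Let mx_translateM M N r i g :
  mx_translate (M *m N) r i g = mx_translate M (mx_translate N r) i g.
Proof.
rewrite /mx_translate; under eq_bigr do rewrite mxE translate_sum_big.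
rewrite exchange_big; apply: eq_bigr => k _ /=.
under eq_bigr do rewrite translate_sumM.
by rewrite /translate_sum exchange_big; apply: eq_bigr => h _; rewrite mulr_sumr.
Qed.

(** As [X] is self-adjoint, the action of [X] from the left is [real_mul]. It
  vanishes on the kernel, so [K - X] acts there as [K]. *)
Let translate_pow r d i g : (forall j g, real_mul r j g = 0) ->
  mx_translate (C d) r i g = K%:R ^+ d * r i g.
Proof.
move=> r0.
have rB j h : mx_translate B r j h = K%:R * r j h.
  transitivity (\sum_k translate_sum ((K%:R)%:M j k) (r k) h - real_mul r j h).
    rewrite /mx_translate /real_mul -sumrB; apply: eq_bigr => k _.
    have -> : B j k = (K%:R)%:M j k - gr_star (X k j).
      have := congr1 (fun M : 'M[ZG]_n => M j k) X_star; rewrite !mxE => -> //.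
    by rewrite translate_sumD translate_sumN translate_sum_star.
  rewrite r0 subr0 (bigD1 j) //= mxE eqxx mulr1n translate_sum_natr big1 ?addr0 // => k kj.
  by rewrite mxE eq_sym (negPf kj) mulr0n translate_sum0.
elim: d i g => [|d IH] i g.
  rewrite /mx_translate /C expr0 (bigD1 i) //= mxE eqxx big1 ?addr0 => [|k kj].
    by rewrite (translate_sum_natr 1) mul1r.
  by rewrite mxE eq_sym (negPf kj) translate_sum0.
rewrite /C exprSr; change (B ^+ d * B) with (C d *m B).
rewrite mx_translateM (_ : mx_translate B r = fun j h => K%:R * r j h); last first.
  by apply/funext => j; apply/funext => h; exact: rB.
transitivity (K%:R * mx_translate (C d) r i g); last by rewrite IH exprS mulrA.
by rewrite /mx_translate mulr_sumr; apply: eq_bigr => j _; rewrite translate_sumZ.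
Qed.

Let bounded_sq (u : 'I_n -> G -> R) := exists M, forall Z : {fset G},
  \sum_j \sum_(g <- Z) u j g ^+ 2 <= M.

Let le_sum_I (F : 'I_n -> R) j : (forall k, 0 <= F k) -> F j <= \sum_k F k.
Proof. by move=> F0; rewrite (bigD1 j) //= lerDl sumr_ge0. Qed.

(** This follows from [x y <= t x ^ 2 + y ^ 2 / t], which avoids square roots of
  infinite sums. *)
Let prod_bound (u v : 'I_n -> G -> R) t E M j : 0 < t ->
  (forall Z : {fset G}, \sum_j \sum_(g <- Z) u j g ^+ 2 <= E) ->
  (forall Z : {fset G}, \sum_j \sum_(g <- Z) v j g ^+ 2 <= M) ->
  summ (fun g => u j g * v j g) /\ `|real_sum (fun g => u j g * v j g)| <= t * E + M / t.
Proof.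
move=> t0 hu hv; apply: real_sum_bound => Z.
have uj := le_trans (@le_sum_I (fun j => \sum_(g <- Z) u j g ^+ 2) j
  (fun k => sumr_ge0 _ (fun g _ => sqr_ge0 _))) (hu Z).
have vj := le_trans (@le_sum_I (fun j => \sum_(g <- Z) v j g ^+ 2) j
  (fun k => sumr_ge0 _ (fun g _ => sqr_ge0 _))) (hv Z).
apply: (@le_trans _ _ (t * (\sum_(g <- Z) u j g ^+ 2) + (\sum_(g <- Z) v j g ^+ 2) / t)); last first.
  by apply: lerD; [rewrite ler_pM2l|rewrite ler_pM2r ?invr_gt0].
rewrite mulr_sumr mulr_suml -big_split /=; apply: ler_sum => g _.
rewrite normrM -[u j g ^+ 2]real_normK ?num_real // -[v j g ^+ 2]real_normK ?num_real //.
move: `|u j g| `|v j g| (normr_ge0 (u j g)) (normr_ge0 (v j g)) => x y x0 y0.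
rewrite -subr_ge0.
have -> : t * x ^+ 2 + y ^+ 2 / t - x * y = t^-1 * ((t * x - y / 2) ^+ 2 + 3 / 4 * y ^+ 2).
  by field; rewrite gt_eqF.
apply: mulr_ge0; first by rewrite invr_ge0 ltW.
by apply: addr_ge0; [exact: sqr_ge0|apply: mulr_ge0; [lra|exact: sqr_ge0]].
Qed.

Let p_bounded i : forall Z : {fset G}, \sum_j \sum_(g <- Z) p i j g ^+ 2 <= a 0%N.
Proof.
move=> Z; apply: le_trans (p_sq Z); rewrite /sq [leRHS](bigD1 i) //= lerDl.
by rewrite sumr_ge0 // => k _; rewrite sumr_ge0 // => j _; rewrite sumr_ge0 // => *; exact: sqr_ge0.
Qed.

Let p_near i d : forall Z : {fset G},
  \sum_j \sum_(g <- Z) (p i j g - c d i j g) ^+ 2 <= a (d + d) - l.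
Proof.
move=> Z; apply: le_trans (p_dist Z d); rewrite /sq [leRHS](bigD1 i) //=.
rewrite -[leLHS]addr0; apply: lerD.
  apply: ler_sum => j _; apply: ler_sum => g _.
  by rewrite -sqrrN opprB.
by rewrite sumr_ge0 // => k _; rewrite sumr_ge0 // => j _; rewrite sumr_ge0 // => *; exact: sqr_ge0.
Qed.

Let summ_pr i r : bounded_sq r -> forall j, summ (fun g => p i j g * r j g).
Proof. by move=> [M hM] j; apply: (prod_bound j ltr01 (p_bounded i) hM).1. Qed.

(** The inner product of [r] with [c d i] is [r i 1] for all [d], and [c d i]
  converges to [p i] in norm. *)
Let p_pairing i r : bounded_sq r -> (forall j g, real_mul r j g = 0) ->
  \sum_j real_sum (fun g => p i j g * r j g) = r i 1%g.
Proof.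
move=> hr r0; have [M0 hM0] := hr; pose M := `|M0| + 1.
have M_gt0 : 0 < M by rewrite ltr_wpDl.
have hM (Z : {fset G}) : \sum_j \sum_(g <- Z) r j g ^+ 2 <= M.
  by apply: le_trans (hM0 Z) _; rewrite /M; have := ler_norm M0; lra.
have cfin d j : summ (fun g => c d i j g * r j g) /\ real_sum (fun g => c d i j g * r j g) =
    \sum_(g <- gr_supp (C d i j)) c d i j g * r j g.
  by apply: real_sum_fin => g /gr_coef_out h; rewrite /c h !mul0r.
have cr d : \sum_j real_sum (fun g => c d i j g * r j g) = r i 1%g.
  transitivity (mx_translate (C d) r i 1%g / K%:R ^+ d); last first.
    by rewrite translate_pow // mulrAC mulfV ?mul1r // expf_neq0.
  rewrite /mx_translate mulr_suml; apply: eq_bigr => j _.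
  rewrite (cfin d j).2.
  rewrite /translate_sum mulr_suml; apply: eq_bigr => g _.
  by rewrite /c mul1g mulrAC.
set S := \sum_j _; apply/eqP; rewrite -subr_eq0 -normr_eq0 eq_le normr_ge0 andbT.
have est d t : 0 < t -> `|S - r i 1%g| <= n%:R * (t * (a (d + d) - l) + M / t).
  move=> t0; rewrite -(cr d) /S -sumrB.
  apply: le_trans (ler_norm_sum _ _ _) _.
  have -> : n%:R * (t * (a (d + d) - l) + M / t) = \sum_(j < n) (t * (a (d + d) - l) + M / t).
    by rewrite sumr_const card_ord mulr_natl.
  apply: ler_sum => j _.
  have [_ h] := prod_bound j t0 (p_near i d) hM.
  rewrite -real_sumB; [|exact: summ_pr|exact: (cfin d j).1].
  apply: le_trans h; rewrite le_eqVlt; apply/orP; left; apply/eqP; congr (`| real_sum _ |).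
  by apply/funext => g; rewrite mulrBl.
rewrite leNgt; apply/negP => x0; set x := `|_| in x0 est.
have n0 : (0 < n)%N by apply: leq_ltn_trans (ltn_ord i).
have nR : 0 < n%:R :> R by rewrite ltr0n.
(* A large [t] makes [M / t] small, and then a large [d] the other term. *)
pose t := 4 * n%:R * M / x.
have t0 : 0 < t by rewrite !mulr_gt0 ?invr_gt0.
have [|d hd] := @a_small (x / (4 * n%:R * t)); first by apply: divr_gt0 => //; apply: mulr_gt0 => //; apply: mulr_gt0.
have := est d t t0; apply/negP; rewrite -ltNge.
have h1 : n%:R * (t * (a (d + d) - l)) < x / 4.
  have := hd (d + d)%N (leq_addr _ _).
  rewrite -(ltr_pM2l (mulr_gt0 nR t0)) => h; rewrite mulrA; apply: lt_le_trans h _.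
  rewrite le_eqVlt; apply/orP; left; apply/eqP; field; rewrite !gt_eqF //.
have h2 : n%:R * (M / t) = x / 4.
  by rewrite /t; field; rewrite !gt_eqF.
by rewrite mulrDr h2; lra.
Qed.

Local Open Scope complex_scope.

Let ReM_real (x : R[i]) (y : R) : complex.Re (x * y%:C) = complex.Re x * y.
Proof. by case: x => x1 x2 /=; rewrite mulr0 subr0. Qed.

Let ImM_real (x : R[i]) (y : R) : complex.Im (x * y%:C) = complex.Im x * y.
Proof. by case: x => x1 x2 /=; rewrite mulr0 add0r. Qed.

Let Re_sum I (s : seq I) (F : I -> R[i]) :
  complex.Re (\sum_(i <- s) F i) = \sum_(i <- s) complex.Re (F i).
Proof. by apply: (big_morph _ _ (erefl : complex.Re (0 : R[i]) = 0)) => -[x1 x2] [y1 y2]. Qed.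

Let Im_sum I (s : seq I) (F : I -> R[i]) :
  complex.Im (\sum_(i <- s) F i) = \sum_(i <- s) complex.Im (F i).
Proof. by apply: (big_morph _ _ (erefl : complex.Im (0 : R[i]) = 0)) => -[x1 x2] [y1 y2]. Qed.

Let intC (z : int) : z%:~R = (z%:~R : R)%:C :> R[i].
Proof. by rewrite rmorph_int. Qed.

Let right_mul_Re v j g :
  complex.Re (right_mul X v j g) = real_mul (fun j g => complex.Re (v j g : R[i])) j g.
Proof.
rewrite Re_sum; apply: eq_bigr => k _; rewrite Re_sum; apply: eq_bigr => h _.
by rewrite intC ReM_real.
Qed.

Let right_mul_Im v j g :
  complex.Im (right_mul X v j g) = real_mul (fun j g => complex.Im (v j g : R[i])) j g.
Proof.
rewrite Im_sum; apply: eq_bigr => k _; rewrite Im_sum; apply: eq_bigr => h _.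
by rewrite intC ImM_real.
Qed.

Let l2n_bounded (v : 'I_n -> G -> R[i]) (r : 'I_n -> G -> R) : l2n v ->
  (forall j g, r j g ^+ 2 <= complex.Re (v j g) ^+ 2 + complex.Im (v j g) ^+ 2) -> bounded_sq r.
Proof.
move=> hv hr; pose f j g := complex.Re (v j g) ^+ 2 + complex.Im (v j g) ^+ 2.
have f0 j g : 0 <= f j g by rewrite addr_ge0 ?sqr_ge0.
exists (\sum_j fine (\esum_(g in [set: G]) (f j g)%:E)%E) => Z.
apply: ler_sum => j _; apply: (@le_trans _ _ (\sum_(g <- Z) f j g)).
  by apply: ler_sum => g _; exact: hr.
rewrite -lee_fin fineK; first exact: (esumT_ge Z (f0 j)).
rewrite ge0_fin_numE; first exact: hv.
by apply: esum_ge0 => x _; rewrite lee_fin.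
Qed.

Let ker_Re v : right_mul_ker R X v -> bounded_sq (fun j g => complex.Re (v j g)) /\
  forall j g, real_mul (fun j g => complex.Re (v j g)) j g = 0.
Proof.
move=> [hv v0]; split; first by apply: l2n_bounded hv _ => j g; rewrite lerDl sqr_ge0.
by move=> j g; rewrite -right_mul_Re v0.
Qed.

Let ker_Im v : right_mul_ker R X v -> bounded_sq (fun j g => complex.Im (v j g)) /\
  forall j g, real_mul (fun j g => complex.Im (v j g)) j g = 0.
Proof.
move=> [hv v0]; split; first by apply: l2n_bounded hv _ => j g; rewrite lerDr sqr_ge0.
by move=> j g; rewrite -right_mul_Im v0.
Qed.

Let Re_inner (u v : 'I_n -> G -> R[i]) :
  complex.Re (inner u v) = \sum_j real_sum (fun g => complex.Re (u j g * (v j g)^*)).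
Proof. by rewrite /inner Re_sum. Qed.

Let Im_inner (u v : 'I_n -> G -> R[i]) :
  complex.Im (inner u v) = \sum_j real_sum (fun g => complex.Im (u j g * (v j g)^*)).
Proof. by rewrite /inner Im_sum. Qed.

Let delta (i j : 'I_n) (g : G) : R := ((j == i) && (g == 1%g))%:R.

Let delta_fin i (r : 'I_n -> G -> R) j : summ (fun g => delta i j g * r j g) /\
  real_sum (fun g => delta i j g * r j g) = (j == i)%:R * r j 1%g.
Proof.
have [|s ->] := @real_sum_fin R G (fun g => delta i j g * r j g) [fset 1%g]%fset.
  by move=> g; rewrite inE /delta => /negPf ->; rewrite andbF mul0r.
by split=> //; rewrite big_seq_fset1 /delta eqxx andbT.
Qed.

Let delta_sum i (r : 'I_n -> G -> R) :
  \sum_j real_sum (fun g => delta i j g * r j g) = r i 1%g.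
Proof.
under eq_bigr do rewrite (delta_fin i r _).2.
rewrite (bigD1 i) //= eqxx mul1r big1 ?addr0 // => j /negPf ->.
by rewrite mul0r.
Qed.

Let deltaC (i j : 'I_n) (g : G) : delta_vec R i j g = (delta i j g)%:C :> R[i].
Proof. by rewrite rmorph_nat. Qed.

Let P i : 'I_n -> G -> R[i] := fun j g => (p i j g)%:C.

Let P_ker i : right_mul_ker R X (P i).
Proof.
split=> [j|j g].
  apply: (@le_lt_trans _ _ (a 0%N)%:E); last exact: ltry.
  apply: esumT_le => Z; apply: le_trans (p_bounded i Z).
  rewrite (bigD1 j) //=; set s := (X in _ <= _ + X); rewrite -[leLHS]addr0; apply: lerD.
    by apply: ler_sum => g _; rewrite expr0n addr0.
  by rewrite /s; do 2! (apply: sumr_ge0 => ? _); exact: sqr_ge0.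
apply/eqP; rewrite eq_complex; apply/andP; split; apply/eqP.
  by rewrite right_mul_Re; exact: p_ker.
rewrite right_mul_Im /real_mul big1 // => k _; rewrite big1 // => h _.
by rewrite mul0r.
Qed.

Let residual_sum i r : bounded_sq r -> (forall j g, real_mul r j g = 0) ->
  \sum_j real_sum (fun g => (delta i j g - p i j g) * r j g) = 0.
Proof.
move=> hr r0; transitivity (\sum_j (real_sum (fun g => delta i j g * r j g) -
    real_sum (fun g => p i j g * r j g))).
  apply: eq_bigr => j _; rewrite -real_sumB; [|exact: (delta_fin i r j).1|exact: summ_pr].
  by congr real_sum; apply/funext => g; rewrite mulrBl.
by rewrite sumrB delta_sum p_pairing // subrr.
Qed.

Let P_orth i v : right_mul_ker R X v ->
  inner (fun j g => delta_vec R i j g - P i j g) v = 0.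
Proof.
move=> hv; have [b1 k1] := ker_Re hv; have [b2 k2] := ker_Im hv.
apply/eqP; rewrite eq_complex Re_inner Im_inner; apply/andP; split; apply/eqP.
  rewrite -[RHS](residual_sum i b1 k1); apply: eq_bigr => j _; congr real_sum.
  apply/funext => g; rewrite deltaC /P; case: (v j g) => x y /=.
  by rewrite subr0 mul0r subr0.
rewrite -[RHS]oppr0 -[X in - X](residual_sum i b2 k2) -sumrN; apply: eq_bigr => j _.
rewrite -real_sumN; congr real_sum.
apply/funext => g; rewrite deltaC /P; case: (v j g) => x y /=.
by rewrite subr0 mul0r addr0 mulrN.
Qed.

(** Uniqueness of the projection is avoided. If [u] is any projection of the
  basis vector [e_i], then the residue of [u] is orthogonal to [P i] and that of
  [P i] is orthogonal to [u], so that [u] and [P i] have the same entry at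
  [e_i]. *)
Lemma vn_dim_kernel : vn_dim (right_mul_ker R X) = l.
Proof.
rewrite l_sum /vn_dim Re_sum; apply: eq_bigr => i _.
rewrite /orth_proj; case: xgetP => [u -> [hu orth]|/(_ (P i))]; last first.
  by case; split; [exact: P_ker|exact: P_orth].
move: (xget _ _) hu orth => {}u hu orth; have [b1 k1] := ker_Re hu.
have -> : complex.Re (inner u (delta_vec R i)) = complex.Re (u i 1%g).
  rewrite Re_inner -(delta_sum i (fun j g => complex.Re (u j g))); apply: eq_bigr => j _.
  congr real_sum; apply/funext => g; rewrite deltaC; case: (u j g) => x y /=.
  by rewrite oppr0 mulr0 subr0 mulrC.
have := congr1 (@complex.Re R) (orth _ (P_ker i)); rewrite Re_inner.
have -> : \sum_j real_sum (fun g => complex.Re ((delta_vec R i j g - u j g) * (P i j g)^*)) =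
    \sum_j (real_sum (fun g => delta i j g * p i j g) -
      real_sum (fun g => p i j g * complex.Re (u j g))).
  apply: eq_bigr => j _.
  rewrite -real_sumB; [|exact: (delta_fin i (p i) j).1|exact: (summ_pr i b1 j)].
  congr real_sum; apply/funext => g; rewrite deltaC /P; case: (u j g) => x y /=.
  by rewrite oppr0 mulr0 subr0 mulrBl [x * _]mulrC.
rewrite sumrB delta_sum p_pairing //= => /eqP.
by rewrite subr_eq0 => /eqP ->.
Qed.

End Projection.

(** * Moments of the spectral measure *)

Section Moments.

Local Open Scope ring_scope.
Variables (R : realType) (G : groupType) (n : nat).
Local Notation ZG := (group_ring int G).
Variable (X : 'M[ZG]_n).

Lemma gr_mapE (x : ZG) g : gr_coef (gr_map (intr : int -> R) x) g = (gr_coef x g)%:~R.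
Proof.
rewrite {1}/gr_coef fsfunE; case: ifPn => // /gr_coef_out ->.
by rewrite mulr0z.
Qed.

Lemma gr_coef_intrM (x y : ZG) (x' y' : group_ring R G) g :
  (forall h, gr_coef x' h = (gr_coef x h)%:~R) ->
  (forall h, gr_coef y' h = (gr_coef y h)%:~R) ->
  gr_coef (x' * y') g = (gr_coef (x * y) g)%:~R.
Proof.
move=> hx hy; rewrite [gr_coef (x * y) g]gr_mulE rmorph_sum /=.
rewrite [LHS]gr_mulE (@gr_sum_supp _ _ _ (gr_supp x) (fun h => gr_coef y' (h^-1 * g)%g)).
  by apply: eq_bigr => h _; rewrite hx hy rmorphM.
apply/fsubsetP => h; apply: contraLR => /gr_coef_out h0.
by rewrite memNfinsupp -/(gr_coef _ _) hx h0 mulr0z.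
Qed.

Definition moment k : R := (gr_trace (X ^+ k))%:~R.

Definition moment_functional (p : {poly R}) : R := \sum_(k < size p) p`_k * moment k.

Lemma moment_functional_wide N (p : {poly R}) : (size p <= N)%N ->
  moment_functional p = \sum_(k < N) p`_k * moment k.
Proof.
move=> pN; rewrite /moment_functional (big_ord_widen _ (fun k => p`_k * moment k) pN).
rewrite big_mkcond; apply: eq_bigr => k _; case: ltnP => // /(nth_default 0) ->.
by rewrite mul0r.
Qed.

Lemma moment_functional_lin b (p r : {poly R}) :
  moment_functional (b *: p - r) = b * moment_functional p - moment_functional r.
Proof.
pose N := maxn (size (b *: p - r)) (maxn (size p) (size r)).
rewrite !(@moment_functional_wide N) /N ?leq_max ?leqnn ?orbT //.
rewrite mulr_sumr -sumrB; apply: eq_bigr => k _.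
by rewrite coefB coefZ mulrBl mulrA.
Qed.

Lemma gr_trace_poly p :
  gr_trace (mx_poly_eval p (map_mx (gr_map (intr : int -> R)) X)) = moment_functional p.
Proof.
have pow k i j g : gr_coef ((map_mx (gr_map (intr : int -> R)) X ^+ k) i j) g =
    (gr_coef ((X ^+ k) i j) g)%:~R.
  elim: k i j g => [|k IH] i j g.
    rewrite !expr0 !mxE; case: (i == j); last by rewrite !gr_coef0.
    by rewrite !gr_coef1 rmorph_nat.
  rewrite [in LHS]exprS [in RHS]exprS; set Y := map_mx _ X in IH *.
  change (gr_coef ((Y *m Y ^+ k) i j) g = (gr_coef ((X *m X ^+ k) i j) g)%:~R).
  rewrite !mxE !gr_coef_big rmorph_sum; apply: eq_bigr => h _.
  by apply: gr_coef_intrM => // l; rewrite mxE gr_mapE.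
rewrite /gr_trace /mx_poly_eval /moment_functional.
under eq_bigr do rewrite summxE gr_coef_big.
rewrite exchange_big; apply: eq_bigr => k _ /=.
rewrite /moment /gr_trace rmorph_sum mulr_sumr; apply: eq_bigr => i _ /=.
rewrite mxE -pow [LHS]gr_mulE.
rewrite (@gr_sum_supp _ _ _ [fset 1%g]%fset
  (fun h => gr_coef ((map_mx (gr_map intr) X ^+ k) i i) (h^-1 * 1)%g)).
  by rewrite big_seq_fset1 gr_singleE eqxx invg1 mulg1.
by apply/fsubsetP => h; apply: contraLR => hN; rewrite memNfinsupp fsfunE (negPf hN).
Qed.

(** Expanding one factor [K - 'X] raises the exponent [j], hence the statement
  for all [j]. *)
Lemma moment_functional_shift K d j :
  moment_functional ((K%:R%:P - 'X) ^+ d * 'X^j) =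
  (gr_trace (((K%:R)%:M - X) ^+ d *m X ^+ j))%:~R.
Proof.
elim: d j => [|d IH] j.
  rewrite expr0 mul1r /moment_functional size_polyXn big_ord_recr /= big1 ?add0r => [|k _].
    by rewrite coefXn eqxx mul1r mul1mx.
  by rewrite coefXn ltn_eqF ?ltn_ord // mul0r.
set B := (K%:R)%:M - X in IH *; set q : {poly R} := K%:R%:P - 'X in IH *.
have -> : q ^+ d.+1 * 'X^j = K%:R *: ((q ^+ d) * 'X^j) - (q ^+ d) * 'X^(j.+1).
  by rewrite -mul_polyC exprSr exprS {2}/q; ring.
rewrite moment_functional_lin !IH.
have -> : B ^+ d.+1 *m X ^+ j = (B ^+ d *m X ^+ j) *+ K - B ^+ d *m X ^+ j.+1.
  rewrite [in LHS]exprSr [in RHS]exprS.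
  change ((B ^+ d *m B) *m X ^+ j = (B ^+ d *m X ^+ j) *+ K - B ^+ d *m (X *m X ^+ j)).
  rewrite -mulmxA {2}/B mulmxBl mulmxBr mul_scalar_mx scaler_nat.
  by rewrite (raddfMn (mulmx (B ^+ d))).
rewrite mulr_natl -rmorphMn -rmorphB /gr_trace -sumrMnl -sumrB; congr (_%:~R); apply: eq_bigr => i _.
have mxB (P Q : 'M[ZG]_n) : (P - Q) i i = P i i - Q i i by rewrite !mxE.
rewrite mxB gr_coefD gr_coefN mulmxnE; congr (_ - _).
by elim: (K) => [|k IHk]; rewrite ?gr_coef0 // !mulrS gr_coefD IHk.
Qed.

End Moments.

Section Spectrum.

Local Open Scope classical_set_scope.
Local Open Scope ring_scope.
Variables (R : realType) (G : groupType) (n : nat).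
Local Notation ZG := (group_ring int G).
Variables (X : 'M[ZG]_n) (mu : {measure set (measurableTypeR R) -> \bar R}) (K0 : nat).
Hypotheses (mu_spec : is_spectral_measure X mu) (K0_gt0 : (0 < K0)%N)
  (trace_bound : forall p, `|gr_trace (X ^+ p)| <= (n * K0 ^ p)%:Z).

Let K := K0.*2.
Let D : set R := `[0, right_mul_norm R X].

Let mD : measurable D.
Proof. exact: measurable_itv. Qed.

Let int_poly (p : {poly R}) : (\int[mu]_(x in D) (p.[x])%:E = (moment_functional X p)%:E)%E.
Proof. by rewrite mu_spec.2 gr_trace_poly. Qed.

Let KR_gt0 : 0 < K%:R :> R.
Proof. by rewrite ltr0n double_gt0. Qed.

Let muD : mu D = n%:R%:E.
Proof.
have := int_poly 1; rewrite (eq_integral (cst 1%E)) => [|x _]; last by rewrite hornerC.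
rewrite integral_cst // mul1e => ->; congr EFin.
rewrite (@moment_functional_wide _ _ _ _ 1) ?size_poly1 // big_ord1 coef1 mul1r.
rewrite /moment expr0 /gr_trace; under eq_bigr do rewrite mxE eqxx gr_coef1 eqxx.
by rewrite sumr_const card_ord rmorph_nat.
Qed.

Let F : set R := D `&` `]K%:R, +oo[.

Let mF : measurable F.
Proof. by apply: measurableI => //; exact: measurable_itv. Qed.

(** Mass above [K = 2 K0] would make the moments grow at least like [K ^ p],
  which contradicts the bound [n K0 ^ p]. *)
Let muF0 : mu F = 0%E.
Proof.
have muF_fin : mu F \is a fin_num.
  rewrite ge0_fin_numE //; apply: (@le_lt_trans _ _ (mu D)); last by rewrite muD ltry.
  by apply: le_measure; rewrite ?inE //; exact: subIsetl.
have h p : fine (mu F) * 2 ^+ p <= n%:R.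
  pose f (x : R) : \bar R := ((('X^p : {poly R}).[x])%:E)%E.
  have mX : measurable_fun D f.
    by apply/measurable_EFinP; exact: measurable_poly.
  have X0 x : D x -> (0 <= f x)%E.
    by rewrite /D /= in_itv /= => /andP[x0 _]; rewrite lee_fin hornerXn exprn_ge0.
  have : ((K%:R ^+ p)%:E * mu F <= (n%:R * K0%:R ^+ p)%:E)%E.
    rewrite -integral_cst //; apply: (@le_trans _ _ (\int[mu]_(x in F) f x)%E).
      apply: ge0_le_integral => //.
      - by move=> x _; rewrite lee_fin exprn_ge0 // ltW.
      - by apply: (measurable_funS mD _ mX); exact: subIsetl.
      - move=> x [_]; rewrite /= in_itv /= andbT => Kx; rewrite lee_fin hornerXn.
        apply: lerXn2r; rewrite ?nnegrE; [exact: ltW|exact: ltW (lt_trans KR_gt0 Kx)|exact: ltW].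
    apply: (@le_trans _ _ (\int[mu]_(x in D) f x)%E).
      by apply: ge0_subset_integral => //; exact: subIsetl.
    rewrite int_poly lee_fin (@moment_functional_wide _ _ _ _ p.+1) ?size_polyXn //.
    rewrite big_ord_recr /= big1 ?add0r => [|k _]; last by rewrite coefXn ltn_eqF ?ltn_ord // mul0r.
    rewrite coefXn eqxx mul1r /moment; apply: le_trans (ler_norm _) _.
    rewrite -intr_norm -natrX -natrM.
    have -> : (n * K0 ^ p)%:R = (Posz (n * K0 ^ p))%:~R :> R by [].
    by rewrite ler_int; exact: trace_bound.
  rewrite -(fineK muF_fin) -EFinM lee_fin /K -muln2 natrM exprMn => h.
  have K0p : 0 < K0%:R ^+ p :> R by rewrite exprn_gt0 ?ltr0n.
  rewrite -(ler_pM2l K0p) [leRHS]mulrC; apply: le_trans h.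
  by rewrite le_eqVlt; apply/orP; left; apply/eqP; ring.
have muF_ge0 : 0 <= fine (mu F) by exact: fine_ge0.
rewrite -(fineK muF_fin); congr EFin; apply/eqP; rewrite eq_le muF_ge0 andbT leNgt; apply/negP => F_gt0.
have := upper_nthrootP (leqnn (Num.bound (n%:R / fine (mu F)))).
by rewrite ltr_pdivrMr // mulrC ltNge h.
Qed.

Let E : set R := D `\` F.

Let mE : measurable E.
Proof. exact: measurableD. Qed.

Let E_itv x : E x -> 0 <= x <= K%:R.
Proof.
rewrite /E /F /D /= !in_itv /= andbT => -[/andP[x0 xN] h]; rewrite x0 leNgt.
by apply/negP => Kx; apply: h; rewrite x0 xN.
Qed.

Let muE : (mu E <= n%:R%:E)%E.
Proof. by rewrite -muD; apply: le_measure; rewrite ?inE //; exact: subDsetl. Qed.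

Let t (x : R) : R := 1 - x / K%:R.

Let t_itv x : E x -> 0 <= t x <= 1.
Proof.
move=> /E_itv /andP[x0 xK]; rewrite /t subr_ge0 ler_pdivrMr // mul1r xK /=.
by rewrite gerBl divr_ge0 // ltW.
Qed.

Let measurable_pow (A : set R) d : measurable_fun A (fun x => (t x ^+ d)%:E).
Proof.
apply/measurable_EFinP; apply: measurable_funX.
by apply: measurable_funB => //; apply: measurable_funM.
Qed.

Local Notation a := (scaled_trace R X K).

Let int_pow d : (\int[mu]_(x in E) (t x ^+ d)%:E = (a d)%:E)%E.
Proof.
pose q : {poly R} := (K%:R ^- d) *: ((K%:R%:P - 'X) ^+ d) - 0.
have qE x : q.[x] = t x ^+ d.
  rewrite /q subr0 hornerZ horner_exp !hornerE /t -exprVn -exprMn; congr (_ ^+ d).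
  by rewrite mulrBr mulVf ?gt_eqF // mulrC.
have qm : moment_functional X q = a d.
  rewrite /q moment_functional_lin {2}/moment_functional size_poly0 big_ord0 subr0.
  have := moment_functional_shift R X K d 0; rewrite expr0 mulr1 => ->.
  by rewrite mulmx1 /scaled_trace mulrC.
rewrite -qm -int_poly /E [RHS](@negligible_integral _ _ _ mu D F) //.
  by apply: eq_integral => x _; rewrite qE.
apply: (@measurable_bounded_integrable _ _ _ mu (horner q) D mD).
- by rewrite muD ltry.
- exact: measurable_poly.
- exists ((1 + right_mul_norm R X / K%:R) ^+ d); split; first exact: num_real.
  move=> M hM x; rewrite /D /= in_itv /= => /andP[x0 xN].
  apply: le_trans (ltW hM); rewrite qE normrX; apply: lerXn2r; rewrite ?nnegrE //.
    by rewrite addr_ge0 // divr_ge0 ?(le_trans x0 xN) ?(ltW KR_gt0).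
  rewrite /t; apply: le_trans (ler_normB _ _) _; rewrite normr1 lerD2l.
  by rewrite ger0_norm ?divr_ge0 ?(ltW KR_gt0) // ler_pM2r ?invr_gt0.
Qed.

Lemma scaled_trace_ge0 d : 0 <= a d.
Proof.
rewrite -lee_fin -int_pow; apply: integral_ge0 => x /t_itv /andP[t0 _].
by rewrite lee_fin exprn_ge0.
Qed.

Lemma scaled_trace_noninc d : a d.+1 <= a d.
Proof.
rewrite -lee_fin -!int_pow; apply: ge0_le_integral; rewrite //; try exact: measurable_pow.
- by move=> x /t_itv /andP[t0 _]; rewrite lee_fin exprn_ge0.
- by move=> x /t_itv /andP[t0 t1]; rewrite lee_fin exprSr ler_piMr // exprn_ge0.
Qed.

(** The integrand [t ^ d0] is at most 1 on ]0, e] and at most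
  [(1 - e / K) ^ d0] above [e]; at 0 it equals [t ^ d]. *)
Lemma scaled_trace_tail d0 d (e b : R) : 0 < e <= 1 -> (mu `]0%R, e]%classic <= b%:E)%E ->
  a d0 - a d <= n%:R * (1 - e / K%:R) ^+ d0 + b.
Proof.
move=> /andP[e0 e1] hb; set y := 1 - e / K%:R.
have y0 : 0 <= y.
  rewrite subr_ge0 ler_pdivrMr // mul1r (le_trans e1) // ler1n double_gt0 //.
pose I : set R := `]0%R, e]%classic.
have mI : measurable I by exact: measurable_itv.
have mt k : measurable_fun E (fun x => (t x ^+ k)%:E) by exact: measurable_pow.
have t0 k x : E x -> (0 <= (t x ^+ k)%:E)%E.
  by move=> /t_itv /andP[h _]; rewrite lee_fin exprn_ge0.
have m1 : measurable_fun E (fun x => (\1_I x : R)%:E).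
  by apply/measurable_EFinP; exact: measurable_indic.
have h : ((a d0)%:E <= (a d)%:E + ((y ^+ d0)%:E * mu E + mu (I `&` E)))%E.
  have i1 : (\int[mu]_(x in E) (\1_I x : R)%:E = mu (I `&` E))%E by exact: integral_indic.
  rewrite -!int_pow -i1 -integral_cst //.
  have c0 x : E x -> (0 <= cst (y ^+ d0)%:E x)%E by move=> _; rewrite lee_fin exprn_ge0.
  have mc : measurable_fun E (cst (y ^+ d0)%:E) by exact: measurable_cst.
  have i0 x : E x -> (0 <= (\1_I x : R)%:E)%E by move=> _; rewrite lee_fin.
  rewrite -(ge0_integralD mu mE c0 mc i0 m1).
  have ci0 x : E x -> (0 <= cst (y ^+ d0)%:E x + (\1_I x : R)%:E)%E.
    by move=> Ex; rewrite adde_ge0 ?c0 ?i0.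
  have mci : measurable_fun E (fun x => cst (y ^+ d0)%:E x + (\1_I x : R)%:E)%E.
    exact: (emeasurable_funD mc m1).
  rewrite -(ge0_integralD mu mE (t0 d) (mt d) ci0 mci).
  apply: (ge0_le_integral mu mE (t0 d0) (mt d0)); first exact: (emeasurable_funD (mt d) mci).
  move=> x Ex; rewrite -!EFinD lee_fin indicE.
  have /andP[tx0 tx1] := t_itv Ex; have /andP[x0 xK] := E_itv Ex.
  have [->|xn0] := eqVneq x 0.
    rewrite /t mul0r subr0 !expr1n lerDl addr_ge0 // exprn_ge0 //.
  have [xe|xe] := leP x e.
    rewrite mem_set; last by rewrite /I /= in_itv /= xe lt_neqAle eq_sym xn0 x0.
    rewrite /= mulr1n.
    have := exprn_ile1 d0 tx0 tx1; have := exprn_ge0 d tx0; have := exprn_ge0 d0 y0; lra.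
  rewrite -[leLHS]add0r; apply: lerD; first exact: exprn_ge0.
  rewrite -[leLHS]addr0; apply: lerD => //.
  apply: lerXn2r; rewrite ?nnegrE // /t /y lerD2l lerN2 ler_pM2r ?invr_gt0 //.
  exact: ltW.
rewrite lerBlDl -lee_fin; apply: le_trans h _; rewrite !EFinD.
apply: leeD2l; apply: leeD.
  rewrite EFinM muleC; apply: lee_wpmul2r => //; by rewrite lee_fin exprn_ge0.
apply: le_trans hb; apply: le_measure; rewrite ?inE //; first exact: measurableI.
Qed.

(** On this interval [- ln] is at least [j / 2], because [ln 2 >= 1 / 2]. *)
Lemma measure_near0 (q : rat) j :
  (- (ratr q)%:E <= \int[mu]_(x in `]0%R, 1%R]) (ln x)%:E)%E -> (0 < j)%N ->
  (mu `]0%R, (2 ^- j : R)]%classic <= (2 * ratr q / j%:R)%:E)%E.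
Proof.
move=> hq j0; pose f (x : R) := (- ln x)%:E.
have jR : 0 < j%:R :> R by rewrite ltr0n.
have f0 x : `]0%R, 1%R]%classic x -> (0 <= f x)%E.
  by rewrite /= in_itv /= => /andP[_ x1]; rewrite lee_fin oppr_ge0 ln_le0.
have mf (A : set R) : measurable_fun A f.
  apply/measurable_EFinP; apply: measurable_funTS.
  by apply: measurableT_comp; [exact: oppr_measurable|exact: measurable_ln].
have hf : (\int[mu]_(x in `]0%R, 1%R]) f x <= (ratr q)%:E)%E.
  rewrite -leeN2 -(integral_ge0N mu f0).
  apply: le_trans hq _; rewrite le_eqVlt; apply/orP; left; apply/eqP.
  by apply: eq_integral => x _; rewrite /f EFinN oppeK.
pose I : set R := `]0%R, 2 ^- j]%classic.
have mI : measurable I by exact: measurable_itv.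
have fI x : I x -> ((j%:R / 2)%:E <= f x)%E.
  rewrite /I /= in_itv /= => /andP[x0 xj]; rewrite lee_fin lerNr.
  apply: (@le_trans _ _ (ln (2^-1 ^+ j))).
    by rewrite ler_ln ?posrE ?exprn_gt0 ?invr_gt0 // exprVn.
  rewrite lnXn ?invr_gt0 // -[ln _ *+ _]mulr_natl -mulrN ler_pM2l //.
  have := @le_ln1Dx R (- 2^-1); rewrite (_ : 1 + - 2^-1 = 2^-1); last by field.
  by apply; lra.
have h : ((j%:R / 2)%:E * mu I <= (ratr q)%:E)%E.
  rewrite -integral_cst //; apply: le_trans hf.
  apply: (@le_trans _ _ (\int[mu]_(x in I) f x)%E).
    apply: ge0_le_integral => //; last exact: mf.
    by move=> x _; rewrite lee_fin divr_ge0 // ltW.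
  apply: ge0_subset_integral => //; first exact: mf.
  move=> x; rewrite /I /= !in_itv /= => /andP[-> /le_trans]; apply.
  by rewrite invf_le1 ?exprn_gt0 // exprn_ege1 // ler1n.
rewrite -/I.
have -> : mu I = ((2 / j%:R)%:E * ((j%:R / 2)%:E * mu I))%E.
  by rewrite muleA -EFinM (_ : _ * _ = 1) ?mul1e //; field; rewrite gt_eqF.
rewrite (_ : 2 * ratr q / j%:R = (2 / j%:R) * ratr q); last by rewrite mulrAC.
by rewrite [leRHS]EFinM; apply: lee_wpmul2l => //; rewrite lee_fin divr_ge0 // ltW.
Qed.

(** Bernoulli's inequality for [(1 + y) ^ d], combined with
  [(1 - y) (1 + y) <= 1]. *)
Lemma bernoulli_inv (y : R) d : 0 <= y <= 1 -> (1 - y) ^+ d * (1 + d%:R * y) <= 1.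
Proof.
move=> /andP[y0 y1]; elim: d => [|d IH]; first by rewrite expr0 mul0r addr0 mul1r.
apply: le_trans IH; rewrite exprSr -mulrA; apply: ler_wpM2l.
  by rewrite exprn_ge0 // subr_ge0.
rewrite -natr1 -subr_ge0.
have -> : 1 + d%:R * y - (1 - y) * (1 + (d%:R + 1) * y) = (d%:R + 1) * y ^+ 2 :> R by ring.
by rewrite mulr_ge0 ?sqr_ge0 // addr_ge0.
Qed.

Lemma kernel_dim_approx (q : rat) (Q k : nat) : self_adjoint X ->
  (- (ratr q)%:E <= \int[mu]_(x in `]0%R, 1%R]) (ln x)%:E)%E -> q <= Q%:R ->
  `|vn_dim (right_mul_ker R X) - a (degree n K Q k)| <= 2 ^- k.+1.
Proof.
move=> Xs hq qQ; have K_gt0 : (0 < K)%N by rewrite double_gt0.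
rewrite (vn_dim_kernel K_gt0 Xs scaled_trace_ge0 scaled_trace_noninc).
set d0 := degree n K Q k; pose j := depth Q k.
have j0 : (0 < j)%N by [].
have jR : 0 < j%:R :> R by rewrite ltr0n.
have kR : 0 < 2 ^+ k :> R by rewrite exprn_gt0.
have jp : 0 < 2 ^+ j :> R by rewrite exprn_gt0.
have cv := scaled_trace_cvg scaled_trace_ge0 scaled_trace_noninc.
have nonincr : nonincreasing_seq a by apply/nonincreasing_seqP; exact: scaled_trace_noninc.
rewrite distrC ger0_norm ?subr_ge0; last exact: nonincreasing_cvgn_ge.
rewrite lerBlDr -lerBlDl; apply: limr_ge => //; apply: nearW => d.
rewrite lerBlDl -lerBlDr.
have e01 : 0 < (2 ^- j : R) <= 1.
  by rewrite invr_gt0 jp invf_le1 // exprn_ege1 // ler1n.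
apply: le_trans (scaled_trace_tail d0 d e01 (measure_near0 hq j0)) _.
have -> : 2 ^- k.+1 = 2 ^- k.+2 + 2 ^- k.+2 :> R.
  by rewrite !exprS; field; rewrite gt_eqF.
apply: lerD.
  have [n0|n0] := posnP n; first by rewrite [X in X%:R]n0 mul0r invr_ge0 exprn_ge0.
  have y01 : 0 <= (2 ^- j / K%:R : R) <= 1.
    rewrite divr_ge0 ?(ltW KR_gt0) ?(ltW (andP e01).1) //= ler_pdivrMr // mul1r.
    by rewrite (le_trans (andP e01).2) // ler1n.
  have := bernoulli_inv d0 y01; set z := (1 - _) ^+ d0.
  have -> : d0%:R * (2 ^- j / K%:R) = n%:R * 2 ^+ k.+2 :> R.
    rewrite /d0 /degree -/j !natrM natrX exprD addn2; field.
    by rewrite !gt_eqF.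
  have z0 : 0 <= z by rewrite exprn_ge0 // subr_ge0 (andP y01).2.
  rewrite -[2 ^- _]mul1r ler_pdivlMr ?exprn_gt0 //; nra.
have qR : ratr q <= Q%:R :> R by rewrite -(ratr_nat R Q) ler_rat.
rewrite ler_pdivrMr // -ler_pdivrMl ?invr_gt0 ?exprn_gt0 // invrK.
apply: (@le_trans _ _ ((Q * 2 ^ (k + 3))%:R)); last by rewrite ler_nat /j /depth.
rewrite natrM natrX exprD [2 ^+ k.+2]exprSr [2 ^+ k.+1]exprSr.
have -> : 2 ^+ k * 2 * 2 * (2 * ratr q) = 2 ^+ k * 2 ^+ 3 * ratr q :> R by ring.
by rewrite mulrC; apply: ler_wpM2r => //; rewrite mulr_ge0 // exprn_ge0.
Qed.

End Spectrum.

Local Open Scope classical_set_scope.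
Local Open Scope ring_scope.

(** * Conclusion *)

Definition rounded_rat (T D k : nat) : rat :=
  (Posz (rounded T D k))%:~R / (Posz (2 ^ k.+1))%:~R.

Lemma rat_code_rounded T D k :
  rat_code (rounded_rat T D k) = pair_code (rounded T D k).*2 (2 ^ k.+1).
Proof.
have co : coprime `|Posz (rounded T D k)|%N `|Posz (2 ^ k.+1)|%N.
  by rewrite /= coprimeXr // coprimen2 /rounded /= odd_double.
have p2 : (0 < 2 ^ k.+1)%N by rewrite expn_gt0.
rewrite /rat_code /rounded_rat coprimeq_num // coprimeq_den //.
rewrite gtr0_sg ?ltz_nat // mul1r gt_eqF ?ltz_nat //.
Qed.

Lemma rounded_rat_near (R : realType) (T D k : nat) : (0 < D)%N ->
  `|T%:R / D%:R - ratr (rounded_rat T D k)| <= 2 ^- k.+1 :> R.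
Proof.
move=> D0; have DR : 0 < D%:R :> R by rewrite ltr0n.
have kR : 0 < 2 ^+ k :> R by rewrite exprn_gt0.
pose f := (T * 2 ^ k %/ D)%N.
have -> : ratr (rounded_rat T D k) = (2 * f%:R + 1) / 2 ^+ k.+1 :> R.
  rewrite /rounded_rat fmorph_div !rmorph_int /rounded -/f -[X in X / _]/((f.*2.+1)%:R).
  rewrite -[X in _ / X]/((2 ^ k.+1)%:R) natrX -natr1 -mul2n natrM; congr (_ / _).
have lo : f%:R * D%:R <= T%:R * 2 ^+ k :> R.
  by rewrite -natrX -!natrM ler_nat /f leq_divM.
have hi : T%:R * 2 ^+ k <= (f%:R + 1) * D%:R :> R.
  by rewrite natr1 -natrX -!natrM ler_nat /f ltnW // ltn_ceil.
have -> : T%:R / D%:R - (2 * f%:R + 1) / 2 ^+ k.+1 =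
    (2 * (T%:R * 2 ^+ k) - (2 * f%:R + 1) * D%:R) / (2 ^+ k.+1 * D%:R) :> R.
  by rewrite exprS; field; rewrite !gt_eqF.
have pk : 0 < 2 ^+ k.+1 :> R by rewrite exprn_gt0.
rewrite normrM normfV [X in _ / X]gtr0_norm ?mulr_gt0 // ler_pdivrMr ?mulr_gt0 //.
rewrite mulKf ?gt_eqF // ler_norml; apply/andP; split; lra.
Qed.

Lemma turing_le_rec f g : turing_le f g -> rec g f.
Proof. by move=> [M hM]; apply: (computes_rec (e := id)) hM; exact: rec_id. Qed.

Lemma degree_rec (a : set (nat -> nat)) o o' : is_turing_degree a -> a o -> a o' -> rec o o'.
Proof.
move=> [f ->] [fo _] [_ o'f].
by apply: rec_oracle_trans (turing_le_rec fo) (turing_le_rec o'f).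
Qed.

Lemma le_int_code (q : rat) : q <= (int_code (numq q))%:R.
Proof.
apply: (@le_trans _ _ (`|numq q|%:~R)).
  rewrite -[X in X <= _]divq_num_den ler_pdivrMr ?ltr0z ?denq_gt0 //.
  apply: (@le_trans _ _ (`|numq q|%:~R)); first by rewrite ler_int ler_norm.
  by rewrite ler_peMr ?ler0z // ler1z -gtz0_ge1 denq_gt0.
by rewrite -[X in _ <= X]/((Posz (int_code (numq q)))%:~R) ler_int; case: (numq q) => z /=; lia.
Qed.

Section Correctness.

Variables (R : realType) (G : groupType) (m : nat) (S : m.-tuple G).
Variables (g : nat -> nat) (W : oracle_machine) (n : nat) (A : 'M[word_comb m]_n).
Variables (mu : {measure set (measurableTypeR R) -> \bar R}) (q : rat).
Hypotheses (hW : solves_word_problem g W S)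
  (A_star : self_adjoint (word_mx_image S A))
  (mu_spec : is_spectral_measure (word_mx_image S A) mu)
  (hq : (- (ratr q)%:E <= \int[mu]_(x in `]0%R, 1%R]) (ln x)%:E)%E).

(** The distance of the scaled trace to its limit and the rounding contribute
  [2 ^ - k.+1] each. *)
Lemma result_correct k t : ready g (input_of W A q k) t ->
  exists s : rat, result g (input_of W A q k) t = rat_code s /\
    `|vn_dim (right_mul_ker R (word_mx_image S A)) - ratr s| <= 2 ^- k.
Proof.
move=> hr; set x := input_of W A q k in hr *; set X := word_mx_image S A.
pose K0 := (word_mx_code A).+1.
have rE : radius x = K0.*2 by rewrite /radius /= code_raw_mx.
have bound p : `|gr_trace (X ^+ p)| <= (n * K0 ^ p)%:Z.
  apply: le_trans (trace_image_bound S A p) _; rewrite code_raw_mx lez_nat leq_mul2l.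
  by apply/orP; right; case: (p) => // p'; rewrite leq_exp2r.
have K0_gt0 : (0 < K0)%N by [].
pose D := (radius x ^ in_degree x)%N.
have D0 : (0 < D)%N by rewrite expn_gt0 rE.
have tr0 : 0 <= gr_trace (((radius x)%:R%:M - X) ^+ in_degree x).
  have := scaled_trace_ge0 mu_spec K0_gt0 bound (in_degree x).
  by rewrite rE /scaled_trace pmulr_lge0 ?invr_gt0 ?exprn_gt0 ?ltr0n // ler0z.
have tE := total_trace hW hr tr0.
have near := kernel_dim_approx mu_spec K0_gt0 bound k A_star hq (le_int_code q).
exists (rounded_rat (total g x t) D k); split; first by rewrite rat_code_rounded.
have dE : scaled_trace R X K0.*2 (degree n K0.*2 (int_code (numq q)) k) =
    (total g x t)%:R / D%:R.
  by rewrite /scaled_trace -rE -[degree _ _ _ _]/(in_degree x) -tE natrX.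
rewrite dE in near; have := rounded_rat_near R (total g x t) k D0.
set r := vn_dim _ in near *; set u := _ / _ in near *; move=> near2.
have -> : r - ratr (rounded_rat (total g x t) D k) =
    (r - u) + (u - ratr (rounded_rat (total g x t) D k)) by ring.
apply: le_trans (ler_normD _ _) _.
have -> : 2 ^- k = 2 ^- k.+1 + 2 ^- k.+1 :> R.
  by rewrite exprS; field; rewrite expf_neq0.
exact: lerD.
Qed.

End Correctness.

(** The search runs with the oracle [o'], on which the machine in [x] relies; as
  [o'] is recursive in [o], so is the whole computation. *)
Lemma uniform_machine (o o' : nat -> nat) : rec o o' ->
  exists M : oracle_machine, forall (x : input), (exists t, ready o' x t) ->
    exists2 t, ready o' x t & computes o M (code x) (result o' x t).
Proof.
move=> oo'.
have [p hp ep] : effective o' (fun y : input * nat => ~~ ready o' y.1 y.2).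
  exact: cpt_not (cpt_ready o').
have [h hh eh] := cpt_result o'.
pose D y := exists x : input, y = seq_code (input_seq x) /\ exists t, ready o' x t.
have [y [x [-> [t ht]]]|M hM] := @search_machine o D p h
  (rec_oracle_trans oo' hp) (rec_oracle_trans oo' hh).
  by exists t; have := ep (x, t); rewrite -code_input /= ht.
exists M => x hx; have [|t [pt ct]] := hM (seq_code (input_seq x)); first by exists x.
rewrite -code_input in pt ct.
exists t; last by rewrite -[result _ _ _](eh (x, t)).
by have := ep (x, t); rewrite [LHS]pt /=; case: (ready _ _ _).
Qed.

Lemma determinant_class_bound (R : realType) (G : groupType) n (X : 'M[group_ring int G]_n) :
  determinant_class R X -> exists (mu : {measure set (measurableTypeR R) -> \bar R}) (q : rat),
    is_spectral_measure X mu /\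
    (- (ratr q)%:E <= \int[mu]_(x in `]0%R, 1%R]) (ln x)%:E)%E.
Proof.
move=> [mu [hmu]]; rewrite /ln_det; case: asboolP => // int_ln _; exists mu.
have int01 : mu.-integrable (`]0%R, 1%R] : set R) (fun x => (ln x)%:E).
  apply: integrableS int_ln => //; [exact: measurable_itv..|].
  by move=> x; rewrite /= !in_itv /= andbT => /andP[].
have fin : (\int[mu]_(x in `]0%R, 1%R]) (ln x)%:E)%E \is a fin_num.
  by apply: integrable_fin_num => //; exact: measurable_itv.
set v := (\int[mu]_(x in _) _)%E in fin *.
exists (Num.bound `|fine v|)%:R; split=> //; rewrite -/v -(fineK fin) -EFinN lee_fin ratr_nat.
rewrite lerNl; apply: le_trans (ltW (archi_boundP (normr_ge0 (fine v)))).
by rewrite -normrN ler_norm.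
Qed.

Theorem theorem1p2 (a : set (nat -> nat)) (a_degree : is_turing_degree a) :
  (forall o o' : nat -> nat, a o -> a o' ->
    exists M : oracle_machine,
    forall (R : realType) (G : groupType) (m : nat) (S : m.-tuple G)
      (W : oracle_machine) (n : nat) (A : 'M[word_comb m]_n)
      (mu : {measure set (measurableTypeR R) -> \bar R}) (q : rat),
    uniq S -> generating S ->
    solves_word_problem o' W S ->
    self_adjoint (word_mx_image S A) ->
    is_spectral_measure (word_mx_image S A) mu ->
    determinant_class R (word_mx_image S A) ->
    (- (ratr q)%:E <= \int[mu]_(x in `]0%R, 1%R]) (ln x)%:E)%E ->
    exists s : nat -> rat,
      (forall k, computes o M (input_code W A q k) (rat_code (s k))) /\
      effectively_converges s (vn_dim (right_mul_ker R (word_mx_image S A))))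
  /\
  (forall (R : realType) (G : groupType) (m : nat) (S : m.-tuple G)
      (o : nat -> nat) (W : oracle_machine) (n : nat)
      (A : 'M[word_comb m]_n),
    uniq S -> generating S ->
    a o -> solves_word_problem o W S ->
    self_adjoint (word_mx_image S A) ->
    determinant_class R (word_mx_image S A) ->
    computable_in_degree a
      (vn_dim (right_mul_ker R (word_mx_image S A)))).
Proof.
have algorithm (o o' : nat -> nat) : a o -> a o' -> exists M : oracle_machine,
    forall (R : realType) (G : groupType) (m : nat) (S : m.-tuple G)
      (W : oracle_machine) (n : nat) (A : 'M[word_comb m]_n)
      (mu : {measure set (measurableTypeR R) -> \bar R}) (q : rat),
    solves_word_problem o' W S ->
    self_adjoint (word_mx_image S A) ->
    is_spectral_measure (word_mx_image S A) mu ->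
    (- (ratr q)%:E <= \int[mu]_(x in `]0%R, 1%R]) (ln x)%:E)%E ->
    exists s : nat -> rat,
      (forall k, computes o M (input_code W A q k) (rat_code (s k))) /\
      effectively_converges s (vn_dim (right_mul_ker R (word_mx_image S A))).
  move=> ao ao'; have [M hM] := uniform_machine (degree_rec a_degree ao ao').
  exists M => R G m S W n A mu q hW A_star mu_spec hq.
  (* The machine is found before the group is known; only the proof that its
     outputs form a sequence with the right limit depends on the group. *)
  suff /choice[s hs] : forall k, exists s : rat,
      computes o M (input_code W A q k) (rat_code s) /\
      `|vn_dim (right_mul_ker R (word_mx_image S A)) - ratr s| <= 2 ^- k.
    by exists s; split=> k; [exact: (hs k).1|exact: (hs k).2].
  move=> k; have [t ht ct] := hM _ (ex_ready A q k hW).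
  have [s [es hs]] := result_correct hW A_star mu_spec hq ht.
  by exists s; split=> //; rewrite -es -code_input_of.
split.
  move=> o o' ao ao'; have [M hM] := algorithm o o' ao ao'.
  by exists M => R G m S W n A mu q _ _ hW A_star mu_spec _; exact: hM.
move=> R G m S o W n A _ _ ao hW A_star /determinant_class_bound[mu [q [mu_spec hq]]].
have [M hM] := algorithm o o ao ao.
have [s [cs hs]] := hM R G m S W n A mu q hW A_star mu_spec hq.
exists s; split=> //; exists o => //; apply: rec_turing_le.
apply: (computes_rec (e := fun k => input_code W A q k)) cs.
have [r hr er] : effective o (fun k : nat =>
    [:: m; machine_code W; n; word_mx_code A; rat_code q; k]) by cpt.
by apply: rec_ext hr _ => k; rewrite [LHS]er code_nats.
Qed.
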